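(* Let $M^{n}$ be a closed smooth manifold of dimension $n \ge 3$ and $g$ a $C^{2}$ Riemannian metric on $M$. Let $(g_{i})$ be a sequence of $C^{2}$ Riemannian metrics on $M$ such that $g_{i}$ converges to $g$ on $M$ in the $C^{0} \cap W^{1,2}$-sense as $i \to \infty$. Then $$\int_{M} R(g_{i})\, d\mathrm{vol}_{g_{i}} \longrightarrow \int_{M} R(g)\, d\mathrm{vol}_{g} \quad \text{as } i \to \infty .$$ In particular, if for some constant $\kappa\in\mathbb{R}$ one has $\int_{M} R(g_{i})\, d\mathrm{vol}_{g_{i}} \ge \kappa$ for all $i$, then $\int_{M} R(g)\, d\mathrm{vol}_{g} \ge \kappa$.
   Context: $R(g)$ denotes the scalar curvature and $d\mathrm{vol}_g$ the Riemannian volume measure of $g$. Closed means compact without boundary. $g_i\to g$ in the $C^0$-sense means $\sup_M|g_i-g|_g\to0$; $g_i\to g$ in the $W^{1,p}$-sense means that $g_i$ and all its first weak derivatives converge respectively to those of $g$ with respect to the $L^p$-norm of $g$. Convergence in the $C^0\cap W^{1,2}$-sense means convergence in both the $C^0$- and the $W^{1,2}$-sense. *)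

(* Defs.v *)
From HB Require Import structures.
From mathcomp Require Import all_boot all_order all_algebra.
From mathcomp Require Import all_classical all_reals all_analysis.

Set Implicit Arguments.
Unset Strict Implicit.
Unset Printing Implicit Defensive.

Import Order.TTheory GRing.Theory Num.Theory.
Import numFieldNormedType.Exports.

Local Open Scope classical_set_scope.
Local Open Scope ring_scope.

Section calculus.
Context {R : realType} {n : nat}.
Implicit Types (D : set 'rV[R]_n) (f : 'rV[R]_n -> R).

Definition partial (j : 'I_n) f : 'rV[R]_n -> R :=
  fun y => 'D_(delta_mx 0 j) f y.

(* f is of class C^k on D, for D open *)
Fixpoint Ck_on (k : nat) D f : Prop :=
  match k with
  | 0 => forall y, D y -> {for y, continuous f}
  | k'.+1 => (forall y, D y -> differentiable f y) /\
             forall j, Ck_on k' D (partial j f)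
  end.

Definition smooth_on D f := forall k, Ck_on k D f.

End calculus.

Section lebesgue.
Context {R : realType}.

Definition tuple_cons n (p : R * n.-tuple R) : n.+1.-tuple R :=
  [tuple of p.1 :: p.2].

Lemma measurable_tuple_cons n :
  measurable_fun [set: R * n.-tuple R] (@tuple_cons n).
Proof. exact: (measurable_cons (T1 := (R * n.-tuple R)%type)). Qed.

(* the pushforward of the product measure by tuple_cons; the constant named
   here is the library's {measure _} instance on pushforward *)
Definition lebesgue_cons n (mu : {measure set (n.-tuple R) -> \bar R}) :
    {measure set (n.+1.-tuple R) -> \bar R} :=
  measure_function_pushforward__canonical__measure_function_Measure
    (lebesgue_measure \x^ mu)%E (@measurable_tuple_cons n).

(* n-dimensional Lebesgue measure, on R^n with its product sigma-algebra. *)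
Fixpoint lebesgue_tuple n : {measure set (n.-tuple R) -> \bar R} :=
  match n with
  | 0 => \d_[tuple]
  | n'.+1 => lebesgue_cons (lebesgue_tuple n')
  end.

Definition row_of_tuple n (t : n.-tuple R) : 'rV[R]_n := \row_j tnth t j.

End lebesgue.

(* Local expressions in a coordinate chart: G is the matrix of the components
   of a metric, H that of a symmetric 2-tensor, both as functions of the
   coordinates. *)
Section local_tensors.
Context {R : realType} {n : nat}.
Implicit Types (G H : 'rV[R]_n -> 'M[R]_n) (y : 'rV[R]_n) (h : 'M[R]_n).

Definition christoffel G (k i j : 'I_n) : 'rV[R]_n -> R := fun y =>
  2^-1 * \sum_l invmx (G y) k l *
    (partial i (fun z => G z j l) y + partial j (fun z => G z i l) y
     - partial l (fun z => G z i j) y).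

(* R^r_{s m v} = d_m Gamma^r_{v s} - d_v Gamma^r_{m s}
     + Gamma^r_{m l} Gamma^l_{v s} - Gamma^r_{v l} Gamma^l_{m s},
   the sign convention for which round spheres have positive Ricci curvature *)
Definition riemann G (r s m v : 'I_n) : 'rV[R]_n -> R := fun y =>
  partial m (christoffel G r v s) y - partial v (christoffel G r m s) y
  + \sum_l (christoffel G r m l y * christoffel G l v s y
            - christoffel G r v l y * christoffel G l m s y).

Definition ricci G (s v : 'I_n) : 'rV[R]_n -> R := fun y =>
  \sum_r riemann G r s r v y.

Definition scalar_curvature_loc G : 'rV[R]_n -> R := fun y =>
  \sum_s \sum_v invmx (G y) s v * ricci G s v y.

(* Levi-Civita derivative of H: (nabla_k H)_{i j} *)
Definition covariant_derivative G H (k i j : 'I_n) : 'rV[R]_n -> R := fun y =>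
  partial k (fun z => H z i j) y
  - \sum_m christoffel G m k i y * H y m j
  - \sum_m christoffel G m k j y * H y i m.

Definition tensor_norm_loc G H : 'rV[R]_n -> R := fun y =>
  Num.sqrt (\sum_i \sum_j \sum_k \sum_l
    invmx (G y) i k * invmx (G y) j l * H y i j * H y k l).

Definition gradient_norm_loc G H : 'rV[R]_n -> R := fun y =>
  Num.sqrt (\sum_k \sum_i \sum_j \sum_p \sum_q \sum_r
    invmx (G y) k p * invmx (G y) i q * invmx (G y) j r *
    covariant_derivative G H k i j y * covariant_derivative G H p q r y).

End local_tensors.

(* [chart a] and [chart_inv a] are only meaningful on [dom a] and on its image
   [cod a].  Second countability is not required: it is automatic on a compact
   space, which is the only case used. *)
Record smooth_manifold (R : realType) (n : nat) (M : ptopologicalType) := {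
  chart_index : Type ;
  dom : chart_index -> set M ;
  chart : chart_index -> M -> 'rV[R]_n ;
  chart_inv : chart_index -> 'rV[R]_n -> M ;
  chart_at : M -> chart_index ;
  dom_chart_at : forall x, dom (chart_at x) x ;
  open_dom : forall a, open (dom a) ;
  open_cod : forall a, open (chart a @` dom a) ;
  chartK : forall a x, dom a x -> chart_inv a (chart a x) = x ;
  chart_continuous : forall a x, dom a x -> {for x, continuous (chart a)} ;
  chart_inv_continuous : forall a y, (chart a @` dom a) y ->
    {for y, continuous (chart_inv a)} ;
  smooth_transition : forall a b (k : 'I_n),
    smooth_on (chart a @` (dom a `&` dom b))
      (fun y => chart b (chart_inv a y) 0 k)
}.

Section manifold.
Context {R : realType} {n : nat} {M : ptopologicalType}.
Variable A : smooth_manifold R n M.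
Local Notation cod a := (chart (s := A) a @` dom (s := A) a).

(* The components of the metric in each chart.  As [jacobian] acts on row
   vectors, its (i, k) entry is the i-th partial derivative of the k-th
   coordinate of the transition map. *)
Record C2_metric := {
  metric_comp : chart_index A -> 'rV[R]_n -> 'M[R]_n ;
  metric_sym : forall a y, cod a y -> (metric_comp a y)^T = metric_comp a y ;
  metric_posdef : forall a y, cod a y -> forall v : 'rV[R]_n, v != 0 ->
    0 < (v *m metric_comp a y *m v^T) 0 0 ;
  metric_C2 : forall a i j, Ck_on 2 (cod a) (fun y => metric_comp a y i j) ;
  metric_change : forall a b x, dom a x -> dom b x ->
    let J := jacobian (chart b \o chart_inv a) (chart a x) in
    metric_comp a (chart a x) = J *m metric_comp b (chart b x) *m J^T
}.

(* The three functions below do not depend on the chart used to compute them,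
   by tensoriality; at x they are evaluated in the chart chosen by chart_at. *)
Definition scalar_curvature (g : C2_metric) (x : M) : R :=
  let a := chart_at A x in scalar_curvature_loc (metric_comp g a) (chart a x).

(* |h - g|_g *)
Definition dist_norm (g h : C2_metric) (x : M) : R :=
  let a := chart_at A x in
  tensor_norm_loc (metric_comp g a)
    (fun y => metric_comp h a y - metric_comp g a y) (chart a x).

(* |nabla^g (h - g)|_g *)
Definition dist_gradient_norm (g h : C2_metric) (x : M) : R :=
  let a := chart_at A x in
  gradient_norm_loc (metric_comp g a)
    (fun y => metric_comp h a y - metric_comp g a y) (chart a x).

Definition borel : measurableType _ := g_sigma_algebraType (@open M).

(* dvol_g = sqrt (det g) dy in every chart. *)
Definition is_riemannian_volume (g : C2_metric)
    (mu : {measure set borel -> \bar R}) : Prop :=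
  forall (a : chart_index A) (B : set borel), measurable B -> B `<=` dom a ->
    mu B = (\int[lebesgue_tuple n]_(t in
              [set t | (chart a @` B) (row_of_tuple t)])
              (Num.sqrt (\det (metric_comp g a (row_of_tuple t))))%:E)%E.

(* On a compact Hausdorff manifold there is exactly one measure with this
   property; the value [mzero] is never taken. *)
Definition riemannian_volume (g : C2_metric) : {measure set borel -> \bar R} :=
  if pselect (exists mu, is_riemannian_volume g mu) is left e
  then projT1 (cid e) else mzero.

Definition total_scalar_curvature (g : C2_metric) : \bar R :=
  (\int[riemannian_volume g]_x (scalar_curvature g x)%:E)%E.

Definition C0_cvg (gs : nat -> C2_metric) (g : C2_metric) : Prop :=
  ereal_sup (range (fun x => (dist_norm g (gs i) x)%:E)) @[i --> \oo] --> 0%E.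

(* The weak derivatives of a C^2 tensor are its classical ones, and
   nabla^g g_i - nabla^g g = nabla^g (g_i - g). *)
Definition W1p_cvg (p : R) (gs : nat -> C2_metric) (g : C2_metric) : Prop :=
  'N[riemannian_volume g]_p%:E[EFin \o dist_norm g (gs i)]%E
    @[i --> \oo] --> 0%E /\
  'N[riemannian_volume g]_p%:E[EFin \o dist_gradient_norm g (gs i)]%E
    @[i --> \oo] --> 0%E.

End manifold.

(* Main.v *)
Require Import Defs.
From HB Require Import structures.
From mathcomp Require Import all_boot all_order all_algebra.
From mathcomp Require Import all_classical all_reals all_analysis.
From mathcomp Require Import ring lra measurable_realfun.

Set Implicit Arguments.
Unset Strict Implicit.
Unset Printing Implicit Defensive.

Import Order.TTheory GRing.Theory Num.Theory.
Import numFieldNormedType.Exports.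

Local Open Scope classical_set_scope.
Local Open Scope ring_scope.

(* In a chart, sqrt(det g) R(g) is a sum of terms u * d_j Gamma and
   u * Gamma * Gamma, where u is a smooth function of the entries of g.  Against
   a compactly supported C^1 weight, the first kind becomes d_j u * Gamma after
   an integration by parts.  So only first derivatives of the metric occur, in
   products of two, and these converge in L^1 when the entries of g_i converge
   uniformly and their first derivatives converge in L^2 on the support of the
   weight.  A partition of unity subordinate to charts reduces the theorem to
   this local statement.  In a chart the entries of a tensor are bounded by a
   multiple of its norm, and its partial derivatives by a multiple of its norm
   and that of its covariant derivative, which gives the local convergences.

   The volume measure is defined by choice, with value 0 if there is none.  If
   some metric has a volume measure then so has every other one, by means of
   the density sqrt(det h / det g); hence if g has none, all total curvatures
   vanish. *)

(** * Differential calculus in coordinates *)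

(** Nothing controls the second derivatives of g_i, so they must be removed exactly, for each metric
    separately, before any limit is taken. As g_i is C^2, the coefficients u and the Christoffel
    symbols are C^1, so the classical integration by parts applies and C^1 cut-offs are smooth
    enough.

    Uniform and L^2 convergence are needed together: a uniform limit times an L^2 limit is again an
    L^2 limit, so the local convergence class is an algebra, stable under determinants, inverses and
    square roots.

    Curvature and norms at x are read in [chart_at A x], which may jump from point to point. Even
    their measurability therefore depends on tensoriality. It comes from uniqueness of the
    Levi-Civita connection: the transported connection is torsion-free and compatible, hence P Gamma
    = A P + dP, where P is the transposed Jacobian and A the pulled-back connection form;
    differentiating this gives the law for curvature.

    Charts take values in row vectors with their topology, while Lebesgue measure lives on tuples
    with the product sigma-algebra; balls with rational data connect the two. *)

Section near_differentiable.
Context {R : numFieldType} {V W : normedModType R}.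

Lemma near0_differentiable (f : V -> W) (y : V) :
  (\forall z \near y, f z = 0) -> differentiable f y.
Proof.
move=> f0.
have E : f \o shift y = cst (f y) + (0 : V -> W) +o_ 0 id.
  apply/eqaddoP => e e0.
  move: (f0) => /nbhs0P f0'.
  near=> z; rewrite /= !fctE /= (nbhs_singleton f0) addr0 subr0 addrC.
  have -> : f (y + z) = 0 by near: z.
  by rewrite normr0 mulr_ge0// ltW.
apply/diff_locallyP.
have c0 : continuous (\0 : V -> W) by move=> x; exact: cvg_cst.
by rewrite (@diff_unique _ _ _ f \0 y c0 E).
Unshelve. all: by end_near. Qed.

Lemma near_eq_differentiable (f g : V -> W) (y : V) :
  (\forall z \near y, f z = g z) -> differentiable f y -> differentiable g y.
Proof.
move=> fg df; have -> : g = f + (g - f) by rewrite addrC subrK.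
apply: differentiableD => //; apply: near0_differentiable.
by apply: filterS fg => z fgz; change (g z - f z = 0); rewrite fgz subrr.
Qed.

End near_differentiable.

Section partial_rules.
Context {R : realType} {n : nat}.
Implicit Types (f g : 'rV[R]_n -> R) (y : 'rV[R]_n) (D : set 'rV[R]_n).

Lemma near_eq_partial f g j y :
  (\forall z \near y, f z = g z) -> partial j f y = partial j g y.
Proof. by move=> fg; exact: near_eq_derive. Qed.

Lemma partial_cst c j y : partial j (fun=> c) y = 0.
Proof. by rewrite /partial derive_cst. Qed.

Lemma partialD f g j y : differentiable f y -> differentiable g y ->
  partial j (fun z => f z + g z) y = partial j f y + partial j g y.
Proof. by move=> df dg; rewrite /partial deriveD//; exact: diff_derivable. Qed.

Lemma partialN f j y : differentiable f y ->
  partial j (fun z => - f z) y = - partial j f y.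
Proof. by move=> df; apply: deriveN; exact: diff_derivable. Qed.

Lemma partialB f g j y : differentiable f y -> differentiable g y ->
  partial j (fun z => f z - g z) y = partial j f y - partial j g y.
Proof. by move=> df dg; rewrite partialD ?partialN//; exact: differentiableN. Qed.

Lemma partialM f g j y : differentiable f y -> differentiable g y ->
  partial j (fun z => f z * g z) y = partial j f y * g y + f y * partial j g y.
Proof.
move=> df dg; rewrite /partial deriveM; [|exact: diff_derivable..].
by rewrite /= addrC /GRing.scale /= (mulrC (g y)).
Qed.

Lemma differentiable_bigsum (I : Type) (r : seq I) (P : pred I)
    (F : I -> 'rV[R]_n -> R) y : (forall i, P i -> differentiable (F i) y) ->
  differentiable (fun z => \sum_(i <- r | P i) F i z) y.
Proof.
move=> dF; elim: r => [|i r ih].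
  by under eq_fun do rewrite big_nil; exact: differentiable_cst.
under eq_fun do rewrite big_cons.
by case Pi : (P i) => //; apply: differentiableD => //; exact: dF.
Qed.

Lemma partial_sum (I : Type) (r : seq I) (P : pred I) (F : I -> 'rV[R]_n -> R)
    j y : (forall i, P i -> differentiable (F i) y) ->
  partial j (fun z => \sum_(i <- r | P i) F i z) y =
  \sum_(i <- r | P i) partial j (F i) y.
Proof.
move=> dF; elim: r => [|i r ih].
  by under eq_fun do rewrite big_nil; rewrite big_nil partial_cst.
under eq_fun do rewrite big_cons; rewrite big_cons; case Pi : (P i) => //.
by rewrite partialD ?ih//; [exact: dF|exact: differentiable_bigsum].
Qed.

Lemma partial_comp1 (h : R -> R) f j y :
  differentiable f y -> derivable h (f y) 1 ->
  differentiable (h \o f) y /\ partial j (h \o f) y = 'D_1 h (f y) * partial j f y.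
Proof.
move=> df /derivable1_diffP dh; split; first exact: differentiable_comp.
rewrite /partial !deriveE//; last exact: differentiable_comp.
rewrite diff_comp//= deriv1E -?derive1E; last exact/derivable1_diffP.
rewrite /= /GRing.scale/= mulrC mul1r. done.
Qed.

End partial_rules.

Section chain_rule.
Context {R : realType} {n m : nat}.
Implicit Types (F : 'rV[R]_n -> 'rV[R]_m) (f : 'rV[R]_m -> R).

Lemma rV_differentiable F y :
  (forall k, differentiable (fun z => F z 0 k) y) -> differentiable F y.
Proof.
move=> dF; rewrite (_ : F = \sum_(k < m) (fun z => F z 0 k *: delta_mx 0 k)).
  by apply: differentiable_sum => k; exact: differentiableZl.
apply/funext => z; rewrite [LHS]row_sum_delta.
by rewrite (big_morph (fun g => g z) (id1 := 0) (op1 := +%R)).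
Qed.

Lemma partial_comp F f j y :
  (forall k, differentiable (fun z => F z 0 k) y) ->
  differentiable f (F y) ->
  partial j (f \o F) y =
  \sum_k partial k f (F y) * partial j (fun z => F z 0 k) y.
Proof.
move=> dFk df; have dF := rV_differentiable dFk.
rewrite {1}/partial deriveE; last exact: differentiable_comp.
rewrite diff_comp//= -(deriveE _ dF) derive_mx; last exact: diff_derivable.
rewrite [X in 'd f _ X]row_sum_delta linear_sum /=; apply: eq_bigr => k _.
by rewrite linearZ/= mxE -(deriveE _ df) mulrC.
Qed.

Lemma jacobianE F y i k : (forall k, differentiable (fun z => F z 0 k) y) ->
  jacobian F y i k = partial i (fun z => F z 0 k) y.
Proof.
move=> dFk; have dF := rV_differentiable dFk.
have := deriveEjacobian (delta_mx 0 i) dF.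
rewrite -rowE derive_mx; last exact: diff_derivable.
by move=> /matrixP /(_ 0 k); rewrite !mxE.
Qed.

End chain_rule.

Lemma near_eq_continuous_at (T U : topologicalType) (f g : T -> U) (y : T) :
  (\forall z \near y, f z = g z) -> {for y, continuous f} ->
  {for y, continuous g}.
Proof.
move=> fg cf; rewrite /prop_for /continuous_at -(nbhs_singleton fg).
by apply: cvg_trans cf; apply: near_eq_cvg; apply: filterS fg => z ->.
Qed.

(** * Functions of class C^1 on an open set *)

Section C1.
Context {R : realType} {n : nat}.
Implicit Types (f g : 'rV[R]_n -> R) (y : 'rV[R]_n).

Definition C1_on (D : set 'rV[R]_n) f := Ck_on 1 D f.

Lemma C1_onS (D E : set 'rV[R]_n) f : D `<=` E -> C1_on E f -> C1_on D f.
Proof.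
by move=> DE [df cf]; split=> [y /DE/df//|j y /DE]; exact: cf.
Qed.

Variables (D : set 'rV[R]_n) (oD : open D).

Let nearD y : D y -> \forall z \near y, D z.
Proof. by move=> Dy; exact: open_nbhs_nbhs. Qed.

Lemma C1_differentiable f y : C1_on D f -> D y -> differentiable f y.
Proof. by move=> [df _]; exact: df. Qed.

Lemma C1_continuous f y : C1_on D f -> D y -> {for y, continuous f}.
Proof. by move=> [df _] /df; exact: differentiable_continuous. Qed.

Lemma C1_partial_continuous f j y : C1_on D f -> D y ->
  {for y, continuous (partial j f)}.
Proof. by move=> [_ cf] /cf; exact. Qed.

(** Since D is open, the candidates [df] equal the partial derivatives near each point of D, so
    continuity passes over. The closure properties below only have to exhibit a formula for the
    derivative. *)
Lemma C1_onI f (df : 'I_n -> 'rV[R]_n -> R) :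
  (forall y, D y -> differentiable f y) ->
  (forall j y, D y -> partial j f y = df j y) ->
  (forall j y, D y -> {for y, continuous (df j)}) -> C1_on D f.
Proof.
move=> dF E cdf; split=> // j y Dy; apply: near_eq_continuous_at (cdf j y Dy).
by apply: filterS (nearD Dy) => z Dz; rewrite E.
Qed.

Lemma C1_eq f g : (forall y, D y -> f y = g y) -> C1_on D f -> C1_on D g.
Proof.
move=> fg Cf; have nfg y : D y -> \forall z \near y, f z = g z.
  by move=> /nearD; apply: filterS.
apply: (@C1_onI _ (fun j => partial j f)) => [y Dy|j y Dy|j y Dy].
- exact: near_eq_differentiable (nfg _ Dy) (C1_differentiable Cf Dy).
- by apply/esym/near_eq_partial/nfg.
- exact: C1_partial_continuous.
Qed.

Lemma C1_cst c : C1_on D (fun=> c).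
Proof.
apply: (@C1_onI _ (fun _ _ => 0)) => [y _|j y _|j y _].
- exact: differentiable_cst.
- exact: partial_cst.
- exact: cst_continuous.
Qed.

Lemma C1D f g : C1_on D f -> C1_on D g -> C1_on D (fun y => f y + g y).
Proof.
move=> Cf Cg.
apply: (@C1_onI _ (fun j y => partial j f y + partial j g y)) => [y Dy|j y Dy|j y Dy].
- by apply: differentiableD; exact: C1_differentiable Dy.
- by apply: partialD; exact: C1_differentiable Dy.
- by apply: continuousD; exact: C1_partial_continuous.
Qed.

Lemma C1M f g : C1_on D f -> C1_on D g -> C1_on D (fun y => f y * g y).
Proof.
move=> Cf Cg.
apply: (@C1_onI _ (fun j y => partial j f y * g y + f y * partial j g y)) => [y Dy|j y Dy|j y Dy].
- by apply: differentiableM; exact: C1_differentiable Dy.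
- by apply: partialM; exact: C1_differentiable Dy.
- by apply: continuousD; apply: continuousM;
    by [exact: C1_partial_continuous|exact: C1_continuous].
Qed.

Lemma C1N f : C1_on D f -> C1_on D (fun y => - f y).
Proof.
move=> Cf; apply: C1_eq (C1M (C1_cst (-1)) Cf) => y _.
by rewrite mulN1r.
Qed.

Lemma C1B f g : C1_on D f -> C1_on D g -> C1_on D (fun y => f y - g y).
Proof. by move=> Cf Cg; exact: C1D Cf (C1N Cg). Qed.

Lemma C1_sum (I : Type) (r : seq I) (P : pred I) (F : I -> 'rV[R]_n -> R) :
  (forall i, P i -> C1_on D (F i)) -> C1_on D (fun y => \sum_(i <- r | P i) F i y).
Proof.
move=> CF; elim: r => [|i r ih].
  by under eq_fun do rewrite big_nil; exact: C1_cst.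
under eq_fun do rewrite big_cons.
by case Pi : (P i); [apply: C1D; [exact: CF|exact: ih]|exact: ih].
Qed.

Lemma C1_prod (I : Type) (r : seq I) (F : I -> 'rV[R]_n -> R) :
  (forall i, C1_on D (F i)) -> C1_on D (fun y => \prod_(i <- r) F i y).
Proof.
move=> CF; elim: r => [|i r ih].
  by under eq_fun do rewrite big_nil; exact: C1_cst.
by under eq_fun do rewrite big_cons; exact: C1M (CF i) ih.
Qed.

Lemma C1_comp1 (h h' : R -> R) f : C1_on D f ->
  (forall y, D y -> is_derive (f y) 1 h (h' (f y))) ->
  (forall y, D y -> {for f y, continuous h'}) ->
  C1_on D (fun y => h (f y)).
Proof.
move=> Cf dh ch.
have H j y : D y -> differentiable (h \o f) y /\ partial j (h \o f) y = h' (f y) * partial j f y.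
  move=> Dy; have [hd he] := dh y Dy.
  by rewrite -he; apply: partial_comp1 => //; exact: C1_differentiable.
apply: (@C1_onI _ (fun j y => h' (f y) * partial j f y)) => [y Dy|j y Dy|j y Dy].
- apply: (differentiable_comp (C1_differentiable Cf Dy)).
  by apply/derivable1_diffP; have [] := dh y Dy.
- by have [] := H j y Dy.
- apply: continuousM; last exact: C1_partial_continuous.
  by apply: (@continuous_comp _ _ _ f h'); [exact: C1_continuous|exact: ch].
Qed.

Lemma C1V f : (forall y, D y -> f y != 0) -> C1_on D f ->
  C1_on D (fun y => (f y)^-1).
Proof.
move=> f0 Cf; apply: (@C1_comp1 _ (fun t => - t ^- 2)) => // y Dy.
- have := @is_deriveV _ id (f y) 1 1 (f0 y Dy) (is_derive_id _ _).
  by rewrite /GRing.scale/= mulr1.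
- apply: continuousN; apply: continuousV; last exact: exprn_continuous.
  by rewrite expf_neq0// f0.
Qed.

Lemma C1_sqrt f : (forall y, D y -> 0 < f y) -> C1_on D f ->
  C1_on D (fun y => Num.sqrt (f y)).
Proof.
move=> f0 Cf; apply: (@C1_comp1 _ (fun t => (2 * Num.sqrt t)^-1)) => // y Dy.
- by apply: is_derive1_sqrt; exact: f0.
- apply: continuousV; first by rewrite mulf_neq0// gt_eqF// sqrtr_gt0 f0.
  by apply: continuousM; [exact: cst_continuous|exact: sqrt_continuous].
Qed.

Lemma C1_det k (F : 'rV[R]_n -> 'M[R]_k) :
  (forall i j, C1_on D (fun y => F y i j)) -> C1_on D (fun y => \det (F y)).
Proof.
move=> CF; rewrite /determinant; apply: C1_sum => s _; apply: C1M.
  exact: C1_cst.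
by apply: C1_prod => i; exact: CF.
Qed.

Lemma C1_invmx k (F : 'rV[R]_n -> 'M[R]_k) : (forall y, D y -> F y \in unitmx) ->
  (forall i j, C1_on D (fun y => F y i j)) ->
  forall i j, C1_on D (fun y => invmx (F y) i j).
Proof.
move=> uF CF i j.
apply: (@C1_eq (fun y => (\det (F y))^-1 * cofactor (F y) j i)).
  by move=> y Dy; rewrite /invmx uF// !mxE.
apply: C1M.
  by apply: C1V; [move=> y /uF; rewrite unitmxE unitfE|exact: C1_det].
apply: C1M; first exact: C1_cst.
apply: C1_det => a b; apply: C1_eq (CF (lift j a) (lift i b)) => y _.
by rewrite !mxE.
Qed.

End C1.

Lemma continuous_at_sum {R : realType} (T : topologicalType) (I : Type)
    (r : seq I) (P : pred I) (F : I -> T -> R) (y : T) :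
  (forall i, P i -> {for y, continuous (F i)}) ->
  {for y, continuous (fun z => \sum_(i <- r | P i) F i z)}.
Proof.
move=> cF; elim: r => [|i r ih].
  have -> : (fun z => \sum_(i <- [::] | P i) F i z) = cst 0.
    by apply/funext => z; rewrite big_nil.
  exact: cst_continuous.
have -> : (fun z => \sum_(j <- i :: r | P j) F j z) =
    (fun z => if P i then F i z + \sum_(j <- r | P j) F j z
              else \sum_(j <- r | P j) F j z).
  by apply/funext => z; rewrite big_cons.
by case Pi : (P i); [apply: continuousD; [exact: cF|exact: ih]|exact: ih].
Qed.

Lemma C1_comp {R : realType} {n m : nat} (D : set 'rV[R]_n) (E : set 'rV[R]_m)
    (F : 'rV[R]_n -> 'rV[R]_m) f : open D ->
  (forall y, D y -> E (F y)) -> (forall k, C1_on D (fun y => F y 0 k)) ->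
  C1_on E f -> C1_on D (f \o F).
Proof.
move=> oD DE CF Cf.
have dF y : D y -> forall k, differentiable (fun z => F z 0 k) y.
  by move=> Dy k; exact: C1_differentiable (CF k) Dy.
apply: (C1_onI oD (df := fun j y => \sum_k partial k f (F y) *
    partial j (fun z => F z 0 k) y)) => [y Dy|j y Dy|j y Dy].
- apply: differentiable_comp; first exact: rV_differentiable (dF y Dy).
  exact: C1_differentiable Cf (DE _ Dy).
- by apply: partial_comp; [exact: dF|exact: C1_differentiable Cf (DE _ Dy)].
- apply: continuous_at_sum => k _; apply: continuousM; last exact: C1_partial_continuous Dy.
  apply: (@continuous_comp _ _ _ F (partial k f)).
    exact: differentiable_continuous (rV_differentiable (dF y Dy)).
  exact: C1_partial_continuous Cf (DE _ Dy).
Qed.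

(** * Mean value theorem along lines and symmetry of second derivatives *)

Section line.
Context {R : realType} {n : nat}.
Implicit Types (f : 'rV[R]_n -> R) (y z e : 'rV[R]_n).

Lemma is_derive_line f z e (t : R) : derivable f (z + t *: e) e ->
  is_derive t 1 (fun s => f (z + s *: e)) ('D_e f (z + t *: e)).
Proof.
move=> df.
have E : (fun h : R => h^-1 *: (((fun s => f (z + s *: e)) \o shift t) (h *: 1) - f (z + t *: e)))
     = (fun h => h^-1 *: ((f \o shift (z + t *: e)) (h *: e) - f (z + t *: e))).
  apply/funext => h /=; congr (_ *: (f _ - _)).
  by rewrite scalerDl [h *: 1]mulr1 addrCA.
by split; rewrite /derivable /derive E.
Qed.

Lemma MVT_line f z e (h : R) : 0 < h ->
  (forall t, 0 <= t <= h -> differentiable f (z + t *: e)) ->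
  exists2 c, 0 < c < h & f (z + h *: e) - f z = h * 'D_e f (z + c *: e).
Proof.
move=> h0 df.
have dl t : 0 <= t <= h ->
    is_derive t 1 (fun s => f (z + s *: e)) ('D_e f (z + t *: e)).
  by move=> /df/diff_derivable dd; apply: is_derive_line.
have [c cI E] : exists2 c, c \in `]0, h[%R & f (z + h *: e) - f (z + 0 *: e) =
    'D_e f (z + c *: e) * (h - 0).
  apply: (@MVT _ (fun s => f (z + s *: e)) (fun s => 'D_e f (z + s *: e))) => //.
    by move=> x /itvP xI; apply: dl; rewrite !xI.
  apply: derivable_within_continuous => x /itvP xI.
  by have [] := dl x; rewrite ?xI.
exists c; first by rewrite !(itvP cI).
by move: E; rewrite scale0r addr0 subr0 mulrC.
Qed.

Lemma partial_shift f j w y : partial j (fun z => f (z + w)) y = partial j f (y + w).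
Proof.
have E : (fun h : R => h^-1 *: (((fun z => f (z + w)) \o shift y) (h *: delta_mx 0 j) - f (y + w)))
     = (fun h => h^-1 *: ((f \o shift (y + w)) (h *: delta_mx 0 j) - f (y + w))).
  by apply/funext => h /=; rewrite addrA.
by rewrite /partial /derive E.
Qed.

Lemma differentiable_shift f w y : differentiable f (y + w) ->
  differentiable (fun z => f (z + w)) y.
Proof.
move=> df; apply: (@differentiable_comp _ _ _ _ (fun z => z + w) f); last by [].
by apply: (@differentiableD _ _ _ id (cst w)) => //; exact: differentiable_cst.
Qed.

Lemma norm_delta_mx_le1 (j : 'I_n) : `|delta_mx 0 j : 'rV[R]_n| <= 1.
Proof.
rewrite /Num.Def.normr/= mx_normrE; apply: bigmax_le => // -[a b] _ /=.
by rewrite mxE; case: (_ && _); rewrite ?normr1 ?normr0.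
Qed.

(* The second difference is symmetric in i and j, so this gives the symmetry of
   second derivatives. *)
Lemma second_difference f (D : set 'rV[R]_n) i j y (eps : R) : open D -> Ck_on 2 D f -> D y ->
  0 < eps ->
  exists2 d, 0 < d & forall s, 0 < s < d ->
  `| (f (y + s *: delta_mx 0 i + s *: delta_mx 0 j) - f (y + s *: delta_mx 0 i)
      - f (y + s *: delta_mx 0 j) + f y) / s ^+ 2
    - partial j (partial i f) y| <= eps.
Proof.
move=> oD [df /(_ i)[dif /(_ j)/= cf]] Dy e0.
have := cf y Dy; move=> /cvgrPdist_le/(_ eps e0) near1.
have near2 : \forall z \near y, D z by exact: open_nbhs_nbhs.
have [d /= d0 H] := (nbhs_ballP _ _).1 (filterI near1 near2).
(* Every point used lies within s + s of y, so s < d / 2 keeps it in the ball of radius d. *)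
exists (d / 2); first by rewrite divr_gt0.
move=> s /andP[s0 sd].
have inb (a b : R) : 0 <= a <= s -> 0 <= b <= s ->
    ball y d (y + a *: delta_mx 0 i + b *: delta_mx 0 j).
  move=> /andP[a0 a1] /andP[b0 b1]; rewrite -ball_normE /=.
  rewrite -addrA opprD addNKr normrN (le_lt_trans (ler_normD _ _))//.
  rewrite !normrZ !ger0_norm//.
  rewrite (@le_lt_trans _ _ (s + s))//; last by lra.
  by apply: lerD; rewrite -[leRHS]mulr1 ler_pM// ?norm_delta_mx_le1.
have inb0 (a : R) : 0 <= a <= s -> ball y d (y + a *: delta_mx 0 i).
  by move=> ias; have := inb a 0 ias; rewrite lexx (ltW s0) scale0r addr0; exact.
have ss : 0 <= s <= s by rewrite lexx ltW.
(* The second difference is the increment of [u] in direction i. One mean value theorem turns it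
   into s times an increment of [partial i f] in direction j, a second one into s^2 times a mixed
   derivative near y. *)
pose u z := f (z + s *: delta_mx 0 j) - f z.
have du (t : R) : 0 <= t <= s -> differentiable u (y + t *: delta_mx 0 i).
  move=> ts; apply: differentiableB; last by apply: df; exact: (H _ (inb0 _ ts)).2.
  by apply: differentiable_shift; apply: df; exact: (H _ (inb _ _ ts ss)).2.
have [c /andP[c0 cs] Ec] := MVT_line s0 du.
have cs' : 0 <= c <= s by rewrite !ltW.
have dv (t : R) : 0 <= t <= s ->
    differentiable (partial i f) (y + c *: delta_mx 0 i + t *: delta_mx 0 j).
  by move=> ts; apply: dif; exact: (H _ (inb _ _ cs' ts)).2.
have [c' /andP[c'0 c's] Ec'] := MVT_line s0 dv.
have Eu : 'D_(delta_mx 0 i) u (y + c *: delta_mx 0 i) =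
    partial i f (y + c *: delta_mx 0 i + s *: delta_mx 0 j) - partial i f (y + c *: delta_mx 0 i).
  rewrite -partial_shift -/(partial i u _) /u partialB//.
    by apply: differentiable_shift; apply: df; exact: (H _ (inb _ _ cs' ss)).2.
  by apply: df; exact: (H _ (inb0 _ cs')).2.
have -> : (f (y + s *: delta_mx 0 i + s *: delta_mx 0 j) - f (y + s *: delta_mx 0 i)
      - f (y + s *: delta_mx 0 j) + f y) =
   s ^+ 2 * partial j (partial i f) (y + c *: delta_mx 0 i + c' *: delta_mx 0 j).
  rewrite -[LHS]/(_ - _ - _ + _) expr2 -mulrA -Ec' -Eu -Ec /u.
  by rewrite opprB addrA addrAC -!addrA; do 2 congr (_ + _); rewrite addrC.
rewrite mulrAC divff ?expf_neq0 ?gt_eqF// mul1r distrC.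
have cs'' : 0 <= c' <= s by rewrite !ltW.
exact: (H _ (inb _ _ cs' cs'')).1.
Qed.

Lemma partial_comm f (D : set 'rV[R]_n) i j y : open D -> Ck_on 2 D f -> D y ->
  partial i (partial j f) y = partial j (partial i f) y.
Proof.
move=> oD Cf Dy; apply/eqP; rewrite -subr_eq0 -normr_le0.
apply/ler_addgt0Pl => e e0; rewrite addr0.
have e20 : 0 < e / 2 by rewrite divr_gt0.
have [d1 d10 H1] := second_difference i j oD Cf Dy e20.
have [d2 d20 H2] := second_difference j i oD Cf Dy e20.
pose s := Num.min d1 d2 / 2.
have m0 : 0 < Num.min d1 d2 by rewrite lt_min d10.
have s0 : 0 < s by rewrite divr_gt0.
have sm : s < Num.min d1 d2 by rewrite /s ltr_pdivrMr// ltr_pMr// ltr1n.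
move: (sm); rewrite lt_min => /andP[sd1 sd2].
have := H1 s; have := H2 s; rewrite s0 sd1 sd2 => /(_ isT) h2 /(_ isT) h1.
rewrite [e]splitr; set a := partial j _ _ in h1 *; set b := partial i _ _ in h2 *.
move: h1 h2; rewrite [y + _ *: delta_mx 0 j + _]addrAC.
set p := f (_ + _ + _); set q := f (_ + _); set r := f (_ + _).
have -> : p - q - r = p - r - q by rewrite addrAC.
set X := _ / _ => h1 h2.
clearbody X a b; apply: le_trans (ler_distD X b a) _.
by apply: lerD; [rewrite distrC|].
Qed.

End line.

(** * Tensoriality of the scalar curvature and of the norms *)

Section matrix_partial.
Context {R : realType} {n : nat}.
Implicit Types (y : 'rV[R]_n).

Definition mx_partial p q (k : 'I_n) (A : 'rV[R]_n -> 'M[R]_(p, q)) y : 'M[R]_(p, q) :=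
  \matrix_(i, j) partial k (fun z => A z i j) y.

Definition mx_differentiable p q (A : 'rV[R]_n -> 'M[R]_(p, q)) y :=
  forall i j, differentiable (fun z => A z i j) y.

Lemma mx_partialM p q r k (A : 'rV[R]_n -> 'M[R]_(p, q)) (B : 'rV[R]_n -> 'M[R]_(q, r)) y :
  mx_differentiable A y -> mx_differentiable B y ->
  mx_partial k (fun z => A z *m B z) y =
  mx_partial k A y *m B y + A y *m mx_partial k B y.
Proof.
move=> dA dB; apply/matrixP => i j; rewrite !mxE.
under [in LHS]eq_fun do rewrite mxE.
rewrite partial_sum => [|l _]; last exact: differentiableM.
by rewrite -big_split/=; apply: eq_bigr => l _; rewrite !mxE partialM.
Qed.

Lemma mx_differentiableM p q r (A : 'rV[R]_n -> 'M[R]_(p, q)) (B : 'rV[R]_n -> 'M[R]_(q, r)) y :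
  mx_differentiable A y -> mx_differentiable B y ->
  mx_differentiable (fun z => A z *m B z) y.
Proof.
move=> dA dB i j; under eq_fun do rewrite mxE.
by apply: differentiable_bigsum => l _; exact: differentiableM.
Qed.

Lemma mx_partialD p q k (A B : 'rV[R]_n -> 'M[R]_(p, q)) y :
  mx_differentiable A y -> mx_differentiable B y ->
  mx_partial k (fun z => A z + B z) y = mx_partial k A y + mx_partial k B y.
Proof.
move=> dA dB; apply/matrixP => i j; rewrite !mxE.
by under [in LHS]eq_fun do rewrite mxE; rewrite partialD.
Qed.

Lemma mx_partial_tr p q k (A : 'rV[R]_n -> 'M[R]_(p, q)) y :
  mx_partial k (fun z => (A z)^T) y = (mx_partial k A y)^T.
Proof.
by apply/matrixP => i j; rewrite !mxE; under [in LHS]eq_fun do rewrite mxE.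
Qed.

Lemma mx_differentiable_tr p q (A : 'rV[R]_n -> 'M[R]_(p, q)) y :
  mx_differentiable A y -> mx_differentiable (fun z => (A z)^T) y.
Proof. by move=> dA i j; under eq_fun do rewrite mxE. Qed.

Lemma near_eq_mx_partial p q k (A B : 'rV[R]_n -> 'M[R]_(p, q)) y :
  (\forall z \near y, A z = B z) -> mx_partial k A y = mx_partial k B y.
Proof.
move=> AB; apply/matrixP => i j; rewrite !mxE; apply: near_eq_partial.
by apply: filterS AB => z ->.
Qed.

End matrix_partial.

Section levi_civita.
Context {R : realType} {n : nat}.
Implicit Types (G : 'rV[R]_n -> 'M[R]_n) (y : 'rV[R]_n).

(** The connection form in direction k, rows carrying the upper index: products of Christoffel
    symbols in the curvature become matrix products. *)
Definition connection_mx G (k : 'I_n) y : 'M[R]_n :=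
  \matrix_(r, s) christoffel G r k s y.

(** These are the Christoffel symbols of the first kind; lowering the index removes the inverse
    matrix. *)
Lemma mul_metric_connection G k y : G y \in unitmx ->
  G y *m connection_mx G k y = \matrix_(l, s) (2^-1 *
    (partial k (fun z => G z s l) y + partial s (fun z => G z k l) y
     - partial l (fun z => G z k s) y)).
Proof.
move=> uG.
pose N := \matrix_(l, s) (2^-1 * (partial k (fun z => G z s l) y
  + partial s (fun z => G z k l) y - partial l (fun z => G z k s) y)).
suff -> : connection_mx G k y = invmx (G y) *m N by rewrite mulKVmx.
apply/matrixP => r s; rewrite !mxE /christoffel mulr_sumr.
by apply: eq_bigr => l _; rewrite !mxE mulrCA.
Qed.

(* Uniqueness of the Levi-Civita connection: the hypotheses on B are absence of
   torsion and compatibility with G. *)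
Lemma connection_mx_unique G y (B : 'I_n -> 'M[R]_n) : G y \in unitmx ->
  (forall k r s, B k r s = B s r k) ->
  (forall k, mx_partial k G y = G y *m B k + (G y *m B k)^T) ->
  forall k, B k = connection_mx G k y.
Proof.
move=> uG sB dG k; rewrite -[LHS](mulKmx uG) -[RHS](mulKmx uG); congr (_ *m _).
rewrite mul_metric_connection//; apply/matrixP => l s; rewrite [RHS]mxE.
have E i a b : partial i (fun z => G z a b) y = (G y *m B i) a b + (G y *m B i) b a.
  by have /matrixP/(_ a b) := dG i; rewrite !mxE.
have S i a b : (G y *m B i) a b = (G y *m B b) a i.
  by rewrite !mxE; apply: eq_bigr => c _; rewrite sB.
(* Koszul's argument: by [E] the three derivatives give six terms, and by the symmetry [S] two pairs
   cancel while the remaining two terms both equal the left side. *)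
rewrite !E (S k s l) (S s k l) (S s l k) (S l s k).
by field.
Qed.

Section compat.
Variables (D : set 'rV[R]_n) (G : 'rV[R]_n -> 'M[R]_n).
Hypotheses (oD : open D) (sG : forall y, D y -> (G y)^T = G y)
  (uG : forall y, D y -> G y \in unitmx).

Let sGp k i j y : D y -> partial k (fun z => G z i j) y = partial k (fun z => G z j i) y.
Proof.
move=> Dy; apply: near_eq_partial.
have : \forall z \near y, D z by exact: open_nbhs_nbhs.
by apply: filterS => z /sG Gz; rewrite -{1}Gz mxE.
Qed.

Lemma connection_mx_sym k r s y : D y ->
  connection_mx G k y r s = connection_mx G s y r k.
Proof.
move=> Dy; rewrite !mxE /christoffel; congr (_ * _); apply: eq_bigr => l _.
by rewrite [in X in _ - X](sGp _ _ _ Dy) [X in X - _]addrC.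
Qed.

Lemma metric_compat k y : D y -> mx_partial k G y =
  G y *m connection_mx G k y + (G y *m connection_mx G k y)^T.
Proof.
move=> Dy; rewrite mul_metric_connection ?uG//; apply/matrixP => i j; rewrite !mxE.
rewrite (sGp k j i Dy) (sGp j k i Dy) (sGp i k j Dy) (sGp j i k Dy) (sGp i j k Dy).
by field.
Qed.

Hypothesis CG : forall i j, Ck_on 2 D (fun y => G y i j).

Lemma C2_C1 f : Ck_on 2 D f -> C1_on D f.
Proof.
move=> [df Cp]; split=> // j y Dy.
exact: C1_continuous (Cp j) Dy.
Qed.

Lemma christoffel_C1 r k s : C1_on D (christoffel G r k s).
Proof.
apply: (C1M oD); first exact: C1_cst.
apply: (C1_sum oD) => l _; apply: (C1M oD).
  apply: (C1_invmx oD) => // i j; exact: C2_C1.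
apply: (C1B oD); last by have [_] := CG k s; exact.
by apply: (C1D oD); [have [_] := CG s l|have [_] := CG k l]; exact.
Qed.

End compat.
End levi_civita.

(** * Matrix algebra of the transformation laws *)

Section change_algebra.
Context {K : fieldType} {n : nat}.
Implicit Types (P Q : 'M[K]_n) (N B dP : 'I_n -> 'M[K]_n).

(** The pull-back of a matrix-valued 1-form by a map F, with P l k standing for d_k F^l. *)
Definition pull_back_form P N k : 'M[K]_n := \sum_l P l k *: N l.

Lemma mulmx_lower_sym Q B : (forall k s p, B k p s = B s p k) ->
  forall k r s, (Q *m B k) r s = (Q *m B s) r k.
Proof. by move=> sB k r s; rewrite !mxE; apply: eq_bigr => p _; rewrite sB. Qed.

(** Absence of torsion for the transported connection, up to the factor P^-1: the first summand is
    symmetric because N has no torsion, the second because dP consists of second derivatives. *)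
Lemma pull_back_lower_sym P N dP : (forall k s p, N k p s = N s p k) ->
  (forall k s p, dP k p s = dP s p k) ->
  forall k s p, (pull_back_form P N k *m P + dP k) p s =
                (pull_back_form P N s *m P + dP s) p k.
Proof.
move=> sN sP k s p; rewrite [LHS]mxE [RHS]mxE sP; congr (_ + _).
rewrite /pull_back_form !mulmx_suml !summxE.
under eq_bigr do rewrite -scalemxAl !mxE mulr_sumr.
rewrite exchange_big/=; apply: eq_bigr => q _.
rewrite -scalemxAl !mxE mulr_sumr; apply: eq_bigr => l _.
by rewrite sN; ring.
Qed.

(** The left side is the product rule for P^T G P. In X, the factor P^T G is the metric P^T G P
    times P^-1, so the identity says that P^-1 (A P + dP) is compatible with the pulled-back
    metric. *)
Lemma pull_back_compat P G N dP (dG' : 'I_n -> 'M[K]_n) : G^T = G ->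
  (forall l, dG' l = G *m N l + (G *m N l)^T) ->
  forall k, let X := P^T *m G *m (pull_back_form P N k *m P + dP k) in
  ((dP k)^T *m G + P^T *m pull_back_form P dG' k) *m P + P^T *m G *m dP k =
  X + X^T.
Proof.
move=> sG dG k X.
have -> : pull_back_form P dG' k =
    G *m pull_back_form P N k + (G *m pull_back_form P N k)^T.
  rewrite /pull_back_form mulmx_sumr [in RHS]raddf_sum -big_split/=.
  apply: eq_bigr => l _.
  by rewrite dG scalerDr -scalemxAr linearZ.
rewrite /X; set A := pull_back_form P N k.
rewrite !trmx_mul !trmxK !linearD/= !trmx_mul sG ?mulmxDr !mulmxDl !mulmxA.
by rewrite [LHS](AC (1*2*1) ((2*4)*(3*1))).
Qed.

(** A gauge transformation: differentiate P Gamma = A P + dP, antisymmetrise in the two directions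
    so that the second derivatives of P drop out, and eliminate dP by the law itself. *)
Lemma curvature_algebra P (A Gam dP : 'I_n -> 'M[K]_n)
    (dGam dA ddP : 'I_n -> 'I_n -> 'M[K]_n) :
  (forall k, P *m Gam k = A k *m P + dP k) ->
  (forall m v, dP m *m Gam v + P *m dGam m v =
     dA m v *m P + A v *m dP m + ddP m v) ->
  (forall m v, ddP m v = ddP v m) -> forall m v,
  P *m (dGam m v - dGam v m + (Gam m *m Gam v - Gam v *m Gam m)) =
  (dA m v - dA v m + (A m *m A v - A v *m A m)) *m P.
Proof.
move=> PG dPG sP m v.
have dPE k : dP k = P *m Gam k - A k *m P by rewrite PG addrAC subrr add0r.
have PdG a b : P *m dGam a b = dA a b *m P + A b *m dP a + ddP a b - dP a *m Gam b.
  by rewrite -dPG addrC addKr.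
rewrite !mulmxDr !mulmxN !PdG sP !dPE !(mulmxDl, mulmxDr, mulNmx, mulmxN, mulmxA).
by apply/matrixP => i j; rewrite !mxE; ring.
Qed.

Definition curvature_mx (Gam : 'I_n -> 'M[K]_n) (dGam : 'I_n -> 'I_n -> 'M[K]_n) m v :=
  dGam m v - dGam v m + (Gam m *m Gam v - Gam v *m Gam m).

Lemma curvature_mxE Gam dGam m v r s : curvature_mx Gam dGam m v r s =
  dGam m v r s - dGam v m r s +
  \sum_l (Gam m r l * Gam v l s - Gam v r l * Gam m l s).
Proof. by rewrite !mxE sumrB. Qed.

(** In the contraction, the factor P of the first form index meets the factor P^-1 of the upper
    index ([PQ]), so only the two covariant factors survive. *)
Lemma ricci_algebra P (Rm Rm' : 'I_n -> 'I_n -> 'M[K]_n) : P \in unitmx ->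
  (forall m v, P *m Rm m v = (\sum_k \sum_l (P k m * P l v) *: Rm' k l) *m P) ->
  \matrix_(s, v) (\sum_r Rm r v r s) =
  P^T *m (\matrix_(s, v) (\sum_r Rm' r v r s)) *m P.
Proof.
move=> uP PR; apply/matrixP => s v.
pose Q := invmx P.
have RmE m : Rm m v = \sum_k \sum_l (P k m * P l v) *: (Q *m (Rm' k l *m P)).
  rewrite -[LHS](mulKmx uP) PR mulmx_suml mulmx_sumr; apply: eq_bigr => k _.
  rewrite mulmx_suml mulmx_sumr; apply: eq_bigr => l _.
  by rewrite -scalemxAl -scalemxAr.
have PQ k p : \sum_r P k r * Q r p = (k == p)%:R.
  by have /matrixP/(_ k p) := mulmxV uP; rewrite !mxE.
rewrite mxE [RHS]mxE.
transitivity (\sum_k \sum_l P l v * (Rm' k l *m P) k s).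
  under eq_bigr => r _.
    rewrite RmE summxE.
    under eq_bigr => k _.
      rewrite summxE.
      under eq_bigr do rewrite mxE mxE.
      over.
    over.
  rewrite exchange_big/=; apply: eq_bigr => k _.
  rewrite exchange_big/=; apply: eq_bigr => l _.
  under eq_bigr do rewrite mulr_sumr.
  rewrite exchange_big/=.
  have E p : \sum_r P k r * P l v * (Q r p * (Rm' k l *m P) p s) =
      (k == p)%:R * (P l v * (Rm' k l *m P) p s).
    by rewrite -PQ mulr_suml; apply: eq_bigr => r _; rewrite mulrACA.
  under eq_bigr do rewrite E.
  rewrite (bigD1 k)//= eqxx mul1r big1 ?addr0// => p pk.
  by rewrite eq_sym (negbTE pk) mul0r.
transitivity (\sum_k \sum_l \sum_q P l v * (Rm' k l k q * P q s)).
  apply: eq_bigr => k _; apply: eq_bigr => l _.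
  by rewrite mxE mulr_sumr.
rewrite exchange_big/=; apply: eq_bigr => l _.
rewrite exchange_big/= mxE mulr_suml; apply: eq_bigr => q _.
by rewrite !mxE mulr_sumr mulr_suml; apply: eq_bigr => k _; ring.
Qed.

(** Full contraction of a contravariant with a covariant 2-tensor; applied to the inverse metric and
    the Ricci tensor it gives the invariance of the scalar curvature. *)
Lemma trace_congruence P W W' S S' : P \in unitmx ->
  W = invmx P *m W' *m (invmx P)^T -> S = P^T *m S' *m P ->
  \tr (W *m S^T) = \tr (W' *m S'^T).
Proof.
move=> uP -> ->; rewrite !trmx_mul trmxK !mulmxA.
rewrite -(mulmxA _ _ P^T) -trmx_mul mulmxV// trmx1 mulmx1.
by rewrite mxtrace_mulC !mulmxA mulmxV// mul1mx.
Qed.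

Lemma invmx_congruence P G G' : P \in unitmx -> G' \in unitmx ->
  G = P^T *m G' *m P -> invmx G = invmx P *m invmx G' *m (invmx P)^T.
Proof.
move=> uP uG' GE; have uG : G \in unitmx by rewrite GE !unitmx_mul unitmx_tr uP uG'.
rewrite -[LHS]mulmx1 -[RHS](mulKmx uG); congr (_ *m _).
rewrite GE !mulmxA -(mulmxA _ P) mulmxV// mulmx1 -(mulmxA _ G') mulmxV// mulmx1.
by rewrite -trmx_mul mulVmx// trmx1.
Qed.

(** The product rule for P^T H' P produces terms in dP that are not tensorial; the dP in the law for
    [Gam] cancels exactly these. *)
Lemma covariant_algebra P H' H N dP (dH' : 'I_n -> 'M[K]_n) (Gam : 'I_n -> 'M[K]_n) :
  H = P^T *m H' *m P ->
  (forall k, P *m Gam k = pull_back_form P N k *m P + dP k) ->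
  forall k, ((dP k)^T *m H' + P^T *m pull_back_form P dH' k) *m P + P^T *m H' *m dP k
    - (Gam k)^T *m H - H *m Gam k =
  P^T *m pull_back_form P (fun l => dH' l - (N l)^T *m H' - H' *m N l) k *m P.
Proof.
move=> HE PG k; set A := pull_back_form P N k.
have -> : pull_back_form P (fun l => dH' l - (N l)^T *m H' - H' *m N l) k =
    pull_back_form P dH' k - A^T *m H' - H' *m A.
  rewrite /A /pull_back_form raddf_sum/= mulmx_sumr mulmx_suml -!sumrB.
  by apply: eq_bigr => l _; rewrite !scalerBr -scalemxAr;
    rewrite (_ : (P l k *: N l)^T = P l k *: (N l)^T) -?scalemxAl//;
    apply/matrixP => i j; rewrite !mxE.
have -> : H *m Gam k = P^T *m H' *m (A *m P + dP k) by rewrite HE -mulmxA PG.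
have -> : (Gam k)^T *m H = (A *m P + dP k)^T *m H' *m P.
  by rewrite HE !mulmxA -trmx_mul PG.
rewrite linearD/= trmx_mul !(mulmxDl, mulmxDr, mulNmx, mulmxN, mulmxA).
by apply/matrixP => i j; rewrite !mxE; ring.
Qed.

(** For W the inverse metric, this and [tensor3_sq] are the squared norms of H and of its covariant
    derivative. As traces, they reduce changes of frame to matrix identities. *)
Definition tensor2_sq (W H : 'M[K]_n) := \tr (W^T *m H *m W *m H^T).

Definition tensor3_sq (W : 'M[K]_n) (T : 'I_n -> 'M[K]_n) :=
  \sum_k \sum_p W k p * \tr (W^T *m T k *m W *m (T p)^T).

Lemma trace4E (W S T : 'M[K]_n) : \tr (W^T *m S *m W *m T^T) =
  \sum_i \sum_j \sum_k \sum_l W i k * W j l * S i j * T k l.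
Proof.
transitivity (\sum_k \sum_l \sum_j \sum_i W i k * W j l * S i j * T k l).
  apply: eq_bigr => k _; rewrite mxE; apply: eq_bigr => l _.
  rewrite !mxE mulr_suml; apply: eq_bigr => j _.
  by rewrite !mxE !mulr_suml; apply: eq_bigr => i _; rewrite !mxE; ring.
under eq_bigr => k _ do rewrite exchange_big/=.
rewrite exchange_big/=.
under eq_bigr => j _ do under eq_bigr => k _ do rewrite exchange_big/=.
under eq_bigr => j _ do rewrite exchange_big/=.
by rewrite exchange_big.
Qed.

Lemma tensor3_sqE (W : 'M[K]_n) (T : 'I_n -> 'M[K]_n) : tensor3_sq W T =
  \sum_k \sum_i \sum_j \sum_p \sum_q \sum_r
    W k p * W i q * W j r * T k i j * T p q r.
Proof.
apply: eq_bigr => k _.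
transitivity (\sum_p \sum_i \sum_j \sum_q \sum_r
    W k p * W i q * W j r * T k i j * T p q r).
  apply: eq_bigr => p _; rewrite trace4E mulr_sumr; apply: eq_bigr => i _.
  rewrite mulr_sumr; apply: eq_bigr => j _.
  rewrite mulr_sumr; apply: eq_bigr => q _.
  by rewrite mulr_sumr; apply: eq_bigr => r _; ring.
by rewrite exchange_big/=; apply: eq_bigr => i _; rewrite exchange_big.
Qed.

(** The bilinear form of the invariance, because [tensor3_sq] pairs different components T k and T
    p. *)
Lemma trace4_congruence P W W' S S' T T' : P \in unitmx ->
  W = invmx P *m W' *m (invmx P)^T -> S = P^T *m S' *m P -> T = P^T *m T' *m P ->
  \tr (W^T *m S *m W *m T^T) = \tr (W'^T *m S' *m W' *m T'^T).
Proof.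
move=> uP -> -> ->; rewrite !trmx_mul !trmxK !mulmxA.
have PT : (invmx P)^T *m P^T = 1%:M by rewrite -trmx_mul mulmxV// trmx1.
rewrite -!(mulmxA _ _ P^T) !PT !mulmx1 -!(mulmxA _ P) !mulmxV// !mulmx1.
by rewrite mxtrace_mulC !mulmxA mulmxV// mul1mx.
Qed.

Lemma tensor2_sq_congruence P W W' S S' : P \in unitmx ->
  W = invmx P *m W' *m (invmx P)^T -> S = P^T *m S' *m P ->
  tensor2_sq W S = tensor2_sq W' S'.
Proof. by move=> uP WE SE; exact: (trace4_congruence uP WE SE SE). Qed.

Lemma tensor3_sq_congruence P W W' T T' : P \in unitmx ->
  W = invmx P *m W' *m (invmx P)^T ->
  (forall k, T k = P^T *m pull_back_form P T' k *m P) ->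
  tensor3_sq W T = tensor3_sq W' T'.
Proof.
move=> uP WE TE; rewrite /tensor3_sq.
pose tau k p := \tr (W'^T *m T' k *m W' *m (T' p)^T).
have E k p : \tr (W^T *m T k *m W *m (T p)^T) =
    \sum_a \sum_b P a k * tau a b * P b p.
  rewrite (trace4_congruence uP WE (TE k) (TE p)) /pull_back_form.
  rewrite mulmx_sumr !mulmx_suml raddf_sum/=; apply: eq_bigr => a _.
  rewrite raddf_sum/= mulmx_sumr raddf_sum/=; apply: eq_bigr => b _.
  rewrite -scalemxAr -!scalemxAl mxtraceZ [(_ *: _)^T]linearZ/= -scalemxAr mxtraceZ.
  by rewrite -/(tau a b); ring.
(* The traces take care of the last two indices; the factors of P that remain belong to the
   derivative index and are absorbed by W. *)
have PW a b : \sum_k \sum_p P a k * W k p * P b p = W' a b.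
  have -> : W' = P *m W *m P^T.
    rewrite WE !mulmxA mulmxV// mul1mx -mulmxA -trmx_mul mulmxV// trmx1.
    by rewrite mulmx1.
  rewrite !mxE exchange_big/=; apply: eq_bigr => p _; rewrite !mxE mulr_suml.
  by apply: eq_bigr.
under [RHS]eq_bigr => a _ do under eq_bigr => b _ do rewrite -PW.
transitivity (\sum_k \sum_p \sum_a \sum_b W k p * (P a k * tau a b * P b p)).
  apply: eq_bigr => k _; apply: eq_bigr => p _.
  by rewrite E mulr_sumr; apply: eq_bigr => a _; rewrite mulr_sumr.
transitivity (\sum_a \sum_b \sum_k \sum_p W k p * (P a k * tau a b * P b p)).
  under eq_bigr => k _ do rewrite exchange_big/=.
  rewrite exchange_big/=; apply: eq_bigr => a _.
  under eq_bigr => k _ do rewrite exchange_big/=.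
  by rewrite exchange_big.
apply: eq_bigr => a _; apply: eq_bigr => b _; rewrite -/(tau a b) mulr_suml.
apply: eq_bigr => k _.
by rewrite mulr_suml; apply: eq_bigr => p _; ring.
Qed.


(** Curvature commutes with pull-back. The hypothesis on dA is the chain rule, with Q the second
    derivatives of the map; being symmetric, they cancel when the directions are antisymmetrised. *)
Lemma pull_back_curvature P N (dN : 'I_n -> 'I_n -> 'M[K]_n) (Q : 'I_n -> 'M[K]_n)
    (dA : 'I_n -> 'I_n -> 'M[K]_n) (A := pull_back_form P N) :
  (forall m l v, Q m l v = Q v l m) ->
  (forall m v, dA m v = \sum_l Q m l v *: N l +
     \sum_k \sum_l (P k m * P l v) *: dN k l) ->
  forall m v, curvature_mx A dA m v =
    \sum_k \sum_l (P k m * P l v) *: curvature_mx N dN k l.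
Proof.
move=> sQ dAE m v; rewrite /curvature_mx.
have AA a b : A a *m A b = \sum_k \sum_l (P k a * P l b) *: (N k *m N l).
  rewrite mulmx_suml; apply: eq_bigr => k _.
  rewrite mulmx_sumr; apply: eq_bigr => l _.
  by rewrite -scalemxAl -scalemxAr scalerA.
have ex (X : 'I_n -> 'I_n -> 'M[K]_n) : \sum_k \sum_l (P k v * P l m) *: X k l =
    \sum_k \sum_l (P k m * P l v) *: X l k.
  rewrite exchange_big/=; apply: eq_bigr => k _; apply: eq_bigr => l _.
  by rewrite mulrC.
rewrite !dAE !AA !ex.
have -> : \sum_l Q v l m *: N l = \sum_l Q m l v *: N l.
  by apply: eq_bigr => l _; rewrite sQ.
rewrite [X in X - _]addrC addrKA -!sumrB -big_split/=; apply: eq_bigr => k _.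
rewrite -!sumrB -big_split/=; apply: eq_bigr => l _.
by rewrite -!scalerBr -scalerDr.
Qed.

End change_algebra.

Section local_expressions.
Context {R : realType} {n : nat}.

Lemma riemannE (H : 'rV[R]_n -> 'M[R]_n) y m v r s : riemann H r s m v y =
  curvature_mx (fun k => connection_mx H k y)
    (fun a b => mx_partial a (connection_mx H b) y) m v r s.
Proof.
have dE a b : mx_partial a (connection_mx H b) y r s = partial a (christoffel H r b s) y.
  rewrite [LHS]mxE; congr (partial a _ y).
  by apply/funext => z; rewrite mxE.
rewrite curvature_mxE.
rewrite /riemann; congr (_ - _ + _); [exact/esym/dE|exact/esym/dE|].
by apply: eq_bigr => l _; rewrite /connection_mx !mxE.
Qed.

Lemma scalar_curvature_locE (H : 'rV[R]_n -> 'M[R]_n) y : scalar_curvature_loc H y =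
  \tr (invmx (H y) *m (\matrix_(s, v) (\sum_r curvature_mx
    (fun k => connection_mx H k y) (fun a b => mx_partial a (connection_mx H b) y)
    r v r s))^T).
Proof.
rewrite /scalar_curvature_loc /mxtrace; apply: eq_bigr => s _.
rewrite [RHS]mxE; apply: eq_bigr => v _; congr (_ * _).
by rewrite !mxE /ricci; apply: eq_bigr => r _; rewrite riemannE.
Qed.

Definition covariant_mx (g h : 'rV[R]_n -> 'M[R]_n) k y : 'M[R]_n :=
  \matrix_(i, j) covariant_derivative g h k i j y.

Lemma covariant_mxE (g h : 'rV[R]_n -> 'M[R]_n) k y : covariant_mx g h k y =
  mx_partial k h y - (connection_mx g k y)^T *m h y - h y *m connection_mx g k y.
Proof.
apply/matrixP => i j; rewrite !mxE; congr (_ - _ - _).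
  by apply: eq_bigr => m _; rewrite !mxE.
by apply: eq_bigr => m _; rewrite !mxE mulrC.
Qed.

Lemma tensor_norm_locE (g h : 'rV[R]_n -> 'M[R]_n) y :
  tensor_norm_loc g h y = Num.sqrt (tensor2_sq (invmx (g y)) (h y)).
Proof. by rewrite /tensor_norm_loc /tensor2_sq trace4E. Qed.

Lemma gradient_norm_locE (g h : 'rV[R]_n -> 'M[R]_n) y :
  gradient_norm_loc g h y =
  Num.sqrt (tensor3_sq (invmx (g y)) (fun k => covariant_mx g h k y)).
Proof.
rewrite /gradient_norm_loc tensor3_sqE; congr Num.sqrt.
apply: eq_bigr => k _; apply: eq_bigr => i _; apply: eq_bigr => j _.
apply: eq_bigr => p _; apply: eq_bigr => q _; apply: eq_bigr => r _.
have E a b c : covariant_mx g h a y b c = covariant_derivative g h a b c y.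
  by rewrite mxE.
by congr (_ * _ * _); exact/esym/E.
Qed.

End local_expressions.

Section change_of_coordinates.
Context {R : realType} {n : nat}.
Variables (D E : set 'rV[R]_n) (F : 'rV[R]_n -> 'rV[R]_n).
Variables (G G' : 'rV[R]_n -> 'M[R]_n).
Hypotheses (oD : open D) (oE : open E) (DE : forall y, D y -> E (F y)).
Hypothesis CF : forall k, Ck_on 3 D (fun y => F y 0 k).
Hypotheses (sG : forall y, D y -> (G y)^T = G y)
  (sG' : forall y, E y -> (G' y)^T = G' y)
  (uG : forall y, D y -> G y \in unitmx)
  (uG' : forall y, E y -> G' y \in unitmx)
  (CG : forall i j, Ck_on 2 D (fun y => G y i j))
  (CG' : forall i j, Ck_on 2 E (fun y => G' y i j)).
Hypothesis GE : forall y, D y ->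
  G y = jacobian F y *m G' (F y) *m (jacobian F y)^T.

(** The transpose of [jacobian F], acting on columns, so that covariant 2-tensors pull back as P^T S
    P. *)
Let P y : 'M[R]_n := \matrix_(k, i) partial i (fun z => F z 0 k) y.

Let C3_C2 f : Ck_on 3 D f -> Ck_on 2 D f.
Proof.
by move=> [df Cp]; split=> // j; exact/(C2_C1)/Cp.
Qed.

Let dF y : D y -> forall k, differentiable (fun z => F z 0 k) y.
Proof. by move=> Dy k; have [d _] := CF k; exact: d. Qed.

Let PE y : D y -> (jacobian F y)^T = P y.
Proof. by move=> Dy; apply/matrixP => i j; rewrite [LHS]mxE jacobianE ?[RHS]mxE//; exact: dF. Qed.

Let GP y : D y -> G y = (P y)^T *m G' (F y) *m P y.
Proof. by move=> Dy; rewrite GE// -PE// trmxK. Qed.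

Let uP y : D y -> P y \in unitmx.
Proof. by move=> Dy; have := uG Dy; rewrite GP// unitmx_mul => /andP[]. Qed.

Let nearD y : D y -> \forall z \near y, D z.
Proof. by move=> Dy; exact: open_nbhs_nbhs. Qed.

Let CP i j : Ck_on 2 D (fun z => P z i j).
Proof.
have [_ /(_ j)] := CF i.
suff -> : (fun z => P z i j) = partial j (fun z => F z 0 i) by [].
by apply/funext => z; rewrite mxE.
Qed.

Let dP y : D y -> mx_differentiable P y.
Proof. by move=> Dy i j; have [d _] := CP i j; exact: d. Qed.

Let dPsym y m v : D y -> forall p, mx_partial m P y p v = mx_partial v P y p m.
Proof.
move=> Dy p; rewrite [LHS]mxE [RHS]mxE.
have PF j : (fun z => P z p j) = partial j (fun z => F z 0 p).
  by apply/funext => z; rewrite mxE.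
rewrite !PF; exact: partial_comm oD (C3_C2 (CF p)) Dy.
Qed.

Let dcomp p q (A : 'rV[R]_n -> 'M[R]_(p, q)) y : D y -> mx_differentiable A (F y) ->
  mx_differentiable (A \o F) y.
Proof.
move=> Dy dA i j.
apply: (@differentiable_comp _ _ _ _ F (fun z => A z i j)); last exact: dA.
exact/rV_differentiable/dF.
Qed.

Let mx_partial_comp p q (A : 'rV[R]_n -> 'M[R]_(p, q)) k y : D y ->
  mx_differentiable A (F y) ->
  mx_partial k (A \o F) y = \sum_l P y l k *: mx_partial l A (F y).
Proof.
move=> Dy dA; apply/matrixP => i j; rewrite mxE summxE.
rewrite (@partial_comp _ _ _ F (fun z => A z i j)); [|exact: dF|exact: dA].
by apply: eq_bigr => l _; rewrite !mxE mulrC.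
Qed.

Let A k y : 'M[R]_n := pull_back_form (P y) (fun l => connection_mx G' l (F y)) k.

(* The connection transported by F is torsion-free and compatible with G. *)
Lemma connection_mx_change k y : D y ->
  P y *m connection_mx G k y = A k y *m P y + mx_partial k P y.
Proof.
move=> Dy; pose B k := A k y *m P y + mx_partial k P y.
suff -> : connection_mx G k y = invmx (P y) *m B k by rewrite mulKVmx ?uP.
apply/esym; move: k; apply: connection_mx_unique; first exact: uG.
  move=> k r s; apply: mulmx_lower_sym => {r s} k s p; rewrite /B.
  apply: (@pull_back_lower_sym _ _ _ _ (fun k => mx_partial k P y)) => {k s p} k s p;
    last exact: dPsym.
  exact: (connection_mx_sym oE sG' _ _ _ (DE Dy)).
move=> k; rewrite GP// !mulmxA mulmxK ?uP//.
have dG' : mx_differentiable G' (F y).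
  by move=> i j; have [d _] := CG' i j; apply: d; exact: DE.
have -> : mx_partial k G y =
    mx_partial k (fun z => (P z)^T *m (G' \o F) z *m P z) y.
  by apply: near_eq_mx_partial; apply: filterS (nearD Dy) => z; exact: GP.
have dPT := mx_differentiable_tr (dP Dy).
have dGF := dcomp Dy dG'.
rewrite mx_partialM//; [|exact: mx_differentiableM|exact: dP].
rewrite mx_partialM// mx_partial_tr mx_partial_comp//.
exact: (@pull_back_compat _ _ (P y) (G' (F y)) (fun l => connection_mx G' l (F y))
  (fun k => mx_partial k P y) (fun l => mx_partial l G' (F y)) (sG' (DE Dy))
  (fun l => metric_compat oE sG' uG' _ (DE Dy)) k).
Qed.

Let dN y l : D y -> mx_differentiable (connection_mx G' l) (F y).
Proof.
move=> Dy i j.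
have -> : (fun z => connection_mx G' l z i j) = christoffel G' i l j.
  by apply/funext => z; rewrite mxE.
exact: C1_differentiable (christoffel_C1 oE uG' CG' _ _ _) (DE Dy).
Qed.

Let dGam y l : D y -> mx_differentiable (connection_mx G l) y.
Proof.
move=> Dy i j.
have -> : (fun z => connection_mx G l z i j) = christoffel G i l j.
  by apply/funext => z; rewrite mxE.
exact: C1_differentiable (christoffel_C1 oD uG CG _ _ _) Dy.
Qed.

Let AE v i j : (fun z => A v z i j) =
  (fun z => \sum_l P z l v * ((fun u => connection_mx G' l u i j) \o F) z).
Proof. by apply/funext => z; rewrite summxE; apply: eq_bigr => l _; rewrite mxE. Qed.

Let dAt y v : D y -> mx_differentiable (A v) y.
Proof.
move=> Dy i j; rewrite AE; apply: differentiable_bigsum => l _.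
apply: differentiableM; first exact: dP.
exact: dcomp Dy (dN _ Dy) i j.
Qed.

Let dAE y m v : D y -> mx_partial m (A v) y =
  \sum_l mx_partial m P y l v *: connection_mx G' l (F y) +
  \sum_k \sum_l (P y k m * P y l v) *: mx_partial k (connection_mx G' l) (F y).
Proof.
move=> Dy; apply/matrixP => i j; rewrite [LHS]mxE AE partial_sum; last first.
  move=> l _; apply: differentiableM; first exact: dP.
  exact: dcomp Dy (dN _ Dy) i j.
rewrite [RHS]mxE exchange_big/= !summxE -big_split/=; apply: eq_bigr => l _.
rewrite partialM; [|exact: dP|exact: dcomp Dy (dN _ Dy) i j].
rewrite [in RHS]mxE [mx_partial m P y l v]mxE summxE; congr (_ + _).
rewrite (@partial_comp _ _ _ F (fun u => connection_mx G' l u i j)); [|exact: dF|exact: dN Dy i j].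
rewrite mulr_sumr; apply: eq_bigr => k _; rewrite [in RHS]mxE [mx_partial _ _ _ _ _]mxE.
have -> : P y k m = partial m (fun z => F z 0 k) y by rewrite mxE.
by ring.
Qed.


(** The second derivatives of P, which commute by [partial_comm], are third derivatives of F; this
    is where the order 3 in [CF] comes from. *)
Lemma curvature_change y m v : D y ->
  P y *m curvature_mx (fun k => connection_mx G k y)
    (fun a b => mx_partial a (connection_mx G b) y) m v =
  (\sum_k \sum_l (P y k m * P y l v) *:
    curvature_mx (fun k => connection_mx G' k (F y))
    (fun a b => mx_partial a (connection_mx G' b) (F y)) k l) *m P y.
Proof.
move=> Dy.
rewrite -(@pull_back_curvature _ _ (P y) _ _ (fun k => mx_partial k P y)
  (fun m v => mx_partial m (A v) y)); last 2 first.
- by move=> a l b; exact: dPsym.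
- by move=> a b; exact: dAE.
apply: (@curvature_algebra _ _ (P y) (A^~ y) (fun k => connection_mx G k y)
  (fun k => mx_partial k P y) (fun a b => mx_partial a (connection_mx G b) y)
  (fun a b => mx_partial a (A b) y) (fun a b => mx_partial a (mx_partial b P) y)).
- by move=> k; exact: connection_mx_change.
- move=> a b.
  have ddP : mx_differentiable (mx_partial b P) y.
    move=> i j.
    have -> : (fun z => mx_partial b P z i j) = partial b (fun z => P z i j).
      by apply/funext => z; rewrite mxE.
    by have [_ /(_ b)[d _]] := CP i j; exact: d.
  rewrite -mx_partialM; [|exact: dP|exact: dGam].
  rewrite -mx_partialM; [|exact: dAt|exact: dP].
  rewrite -mx_partialD; [|by apply: mx_differentiableM; [exact: dAt|exact: dP]|by []].
  apply: near_eq_mx_partial; apply: filterS (nearD Dy) => z Dz.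
  exact: connection_mx_change.
- move=> a b; apply/matrixP => i j; rewrite [LHS]mxE [RHS]mxE.
  have cE c : (fun z => mx_partial c P z i j) = partial c (fun z => P z i j).
    by apply/funext => z; rewrite mxE.
  have cP c d : partial d (fun z => mx_partial c P z i j) y =
    partial d (partial c (fun z => P z i j)) y by congr (partial d _ y).
  exact: (etrans (cP b a) (etrans (partial_comm a b oD (CP i j) Dy) (esym (cP a b)))).
Qed.


Let invG y : D y -> invmx (G y) = invmx (P y) *m invmx (G' (F y)) *m (invmx (P y))^T.
Proof. by move=> Dy; apply: invmx_congruence; [exact: uP|exact: uG' (DE Dy)|exact: GP]. Qed.

Theorem scalar_curvature_change y : D y ->
  scalar_curvature_loc G y = scalar_curvature_loc G' (F y).
Proof.
move=> Dy; rewrite !scalar_curvature_locE.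
apply: (trace_congruence (uP Dy) (invG Dy)).
by apply: (ricci_algebra (uP Dy)) => m v; exact: curvature_change.
Qed.

Variables (H H' : 'rV[R]_n -> 'M[R]_n).
Hypotheses (HE : forall y, D y ->
    H y = jacobian F y *m H' (F y) *m (jacobian F y)^T)
  (dH' : forall y, E y -> mx_differentiable H' y).

Let HP y : D y -> H y = (P y)^T *m H' (F y) *m P y.
Proof. by move=> Dy; rewrite HE// -PE// trmxK. Qed.


Lemma covariant_change k y : D y -> covariant_mx G H k y =
  (P y)^T *m pull_back_form (P y) (fun l => covariant_mx G' H' l (F y)) k *m P y.
Proof.
move=> Dy; rewrite covariant_mxE.
have dPT := mx_differentiable_tr (dP Dy).
have dHF := dcomp Dy (dH' (DE Dy)).
have -> : mx_partial k H y =
    mx_partial k (fun z => (P z)^T *m (H' \o F) z *m P z) y.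
  by apply: near_eq_mx_partial; apply: filterS (nearD Dy) => z; exact: HP.
rewrite mx_partialM//; [|exact: mx_differentiableM|exact: dP].
rewrite mx_partialM// mx_partial_tr mx_partial_comp//; last exact: dH' (DE Dy).
rewrite (@covariant_algebra _ _ (P y) (H' (F y)) (H y)
  (fun l => connection_mx G' l (F y)) (fun k => mx_partial k P y)
  (fun l => mx_partial l H' (F y)) (fun k => connection_mx G k y) (HP Dy)
  (fun k => connection_mx_change k Dy)).
congr (_ *m pull_back_form _ _ _ *m _); apply/funext => l.
by rewrite covariant_mxE.
Qed.

Theorem tensor_norm_change y : D y ->
  tensor_norm_loc G H y = tensor_norm_loc G' H' (F y).
Proof.
move=> Dy; rewrite !tensor_norm_locE.
by rewrite (tensor2_sq_congruence (uP Dy) (invG Dy) (HP Dy)).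
Qed.

Theorem gradient_norm_change y : D y ->
  gradient_norm_loc G H y = gradient_norm_loc G' H' (F y).
Proof.
move=> Dy; rewrite !gradient_norm_locE.
rewrite (tensor3_sq_congruence (T' := fun l => covariant_mx G' H' l (F y)) (uP Dy) (invG Dy))//.
by move=> k; exact: covariant_change.
Qed.

End change_of_coordinates.

(** * Positive definite matrices *)

Section positive_definite.
Context {R : realType}.

Definition posdef n (G : 'M[R]_n) :=
  G^T = G /\ forall v : 'rV[R]_n, v != 0 -> 0 < (v *m G *m v^T) 0 0.

Lemma posdef_unitmx n (G : 'M[R]_n) : posdef G -> G \in unitmx.
Proof.
move=> [_ pG]; rewrite -row_free_unit -kermx_eq0; apply/eqP/row_matrixP => i.
rewrite row0; apply/eqP; apply: contraT => /pG.
by rewrite -row_mul mulmx_ker row0 mul0mx mxE ltxx.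
Qed.

(** Induction on the size: split off the first coordinate and factor the Schur complement S, which
    is again positive definite. *)
Lemma posdef_cholesky n (G : 'M[R]_n) : posdef G -> exists C : 'M[R]_n, G = C^T *m C.
Proof.
elim: n G => [|n ih] G; first by move=> _; exists 0; apply/matrixP => -[].
rewrite -[n.+1]/(1 + n)%N in G *.
move: G => G [sG pG].
pose a := ulsubmx G; pose b := ursubmx G; pose G1 := drsubmx G.
have dlE : dlsubmx G = b^T by rewrite /b trmx_ursub sG.
have GE : G = block_mx a b b^T G1 by rewrite -dlE submxK.
have sG1 : G1^T = G1 by rewrite /G1 trmx_drsub sG.
pose al := a 0 0.
have aE : a = al%:M by rewrite [a]mx11_scalar.
have al0 : 0 < al.
  have := pG (row_mx 1%:M 0).
  rewrite GE mul_row_block tr_row_mx mul_row_col !mul1mx !mul0mx !addr0 trmx1 mulmx1.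
  rewrite trmx0 mulmx0 addr0; apply.
  apply/eqP => /matrixP /(_ 0 (lshift n 0)); rewrite row_mxEl !mxE eqxx.
  by move/eqP; rewrite oner_eq0.
pose S := G1 - al^-1 *: (b^T *m b).
have [C1 C1E] : exists C : 'M[R]_n, S = C^T *m C.
  apply: ih; split.
    by rewrite /S linearB/= sG1 linearZ/= trmx_mul trmxK.
  (* The first coordinate that minimises the quadratic form of G over all completions of v; the
     minimum is the value of S at v. *)
  move=> v v0; pose u := - (al^-1 *: (v *m b^T)).
  have := pG (row_mx u v).
  have -> : row_mx u v *m G *m (row_mx u v)^T = v *m S *m v^T.
    rewrite GE mul_row_block tr_row_mx mul_row_col aE /u /S.
    rewrite mul_mx_scalar scalerN scalerA divff ?gt_eqF// scale1r addNr mul0mx add0r.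
    by rewrite mulNmx -scalemxAl mulmxBr -scalemxAr mulmxA addrC.
  apply; apply/eqP => /matrixP uv0; case/eqP: v0; apply/rowP => j.
  by have := uv0 0 (rshift 1 j); rewrite row_mxEr !mxE.
exists (block_mx (Num.sqrt al)%:M ((Num.sqrt al)^-1 *: b) 0 C1).
have sq : Num.sqrt al * Num.sqrt al = al by rewrite -expr2 sqr_sqrtr// ltW.
have sn0 : Num.sqrt al != 0 by rewrite gt_eqF// sqrtr_gt0.
rewrite tr_block_mx mulmx_block !trmx0 !mul0mx !mulmx0 !addr0.
rewrite tr_scalar_mx -scalar_mxM sq mul_scalar_mx scalerA divff// scale1r.
rewrite [(_ *: b)^T]linearZ/= mul_mx_scalar scalerA divff// scale1r.
rewrite -scalemxAl -scalemxAr scalerA -C1E /S -invfM sq addrC subrK.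
by rewrite GE aE.
Qed.

Lemma posdef_det_gt0 n (G : 'M[R]_n) : posdef G -> 0 < \det G.
Proof.
move=> pG; have [C CE] := posdef_cholesky pG.
have := posdef_unitmx pG; rewrite unitmxE unitfE CE det_mulmx det_tr -expr2 => h.
by rewrite lt0r h sqr_ge0.
Qed.

Lemma sqr_mx_entry_le n (C : 'M[R]_n) i j : C i j ^+ 2 <= (C^T *m C) j j.
Proof.
rewrite mxE (bigD1 i)//= mxE -expr2 lerDl sumr_ge0// => k _.
by rewrite mxE -expr2 sqr_ge0.
Qed.

(** Cruder than the square root of M, but it keeps the constants below polynomial in M. *)
Lemma norm_le_1D (x M : R) : x ^+ 2 <= M -> `|x| <= 1 + M.
Proof.
move=> xM; have [x1|x1] := leP `|x| 1.
  by rewrite (le_trans x1)// lerDl (le_trans _ xM)// sqr_ge0.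
rewrite (@le_trans _ _ (x ^+ 2))//; last by rewrite (le_trans xM)// lerDr.
by rewrite -real_normK ?num_real// expr2 ler_peMr// ltW.
Qed.

Lemma norm_le_sqrt_sum (I : finType) (F : I -> R) i :
  `|F i| <= Num.sqrt (\sum_j F j ^+ 2).
Proof.
rewrite -sqrtr_sqr ler_wsqrtr// (bigD1 i)//= lerDl.
by apply: sumr_ge0 => j _; exact: sqr_ge0.
Qed.

Lemma norm_mulmx_le n p q (A : 'M[R]_(p, n)) (B : 'M[R]_(n, q)) (a b : R) :
  0 <= a -> (forall i j, `|A i j| <= a) -> (forall i j, `|B i j| <= b) ->
  forall i j, `|(A *m B) i j| <= n%:R * (a * b).
Proof.
move=> a0 Aa Bb i j; rewrite mxE (le_trans (ler_norm_sum _ _ _))//.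
rewrite (@le_trans _ _ (\sum_(k < n) a * b))//.
  by apply: ler_sum => k _; rewrite normrM ler_pM.
by rewrite sumr_const card_ord mulr_natl.
Qed.

Lemma mxtrace_mul_tr n (S : 'M[R]_n) :
  \tr (S *m S^T) = \sum_a \sum_b S a b ^+ 2.
Proof.
apply: eq_bigr => a _; rewrite mxE; apply: eq_bigr => b _.
by rewrite mxE expr2.
Qed.

(* If G = C^T C, the squared norm of H is the sum of the squares of the entries
   of C^-T H C^-1, and the entries of C are at most 1 + M. *)
Lemma tensor2_sq_lower_bound n (G H : 'M[R]_n) (M : R) : posdef G -> 0 <= M ->
  (forall i, G i i <= M) -> forall i j,
  `|H i j| <= (n%:R * (1 + M)) ^+ 2 * Num.sqrt (tensor2_sq (invmx G) H).
Proof.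
move=> pG M0 GM.
have [C CE] := posdef_cholesky pG.
have uC : C \in unitmx by have := posdef_unitmx pG; rewrite CE unitmx_mul => /andP[].
pose B := invmx C; pose S := B^T *m H *m B.
have HE : H = C^T *m S *m C.
  rewrite /S !mulmxA -trmx_mul mulVmx// trmx1 mul1mx -mulmxA mulVmx// mulmx1.
  by [].
have u1 : (1%:M : 'M[R]_n) \in unitmx by rewrite unitmx1.
have WE : invmx G = invmx C *m 1%:M *m (invmx C)^T.
  by rewrite (@invmx_congruence _ _ C G 1%:M) ?invmx1// mulmx1.
rewrite (tensor2_sq_congruence uC WE HE) /tensor2_sq trmx1 mul1mx mulmx1.
rewrite mxtrace_mul_tr (pair_bigA _ (fun a b => S a b ^+ 2))/=.
set s := Num.sqrt _.
have Ss i j : `|S i j| <= s.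
  exact: (norm_le_sqrt_sum (fun p : 'I_n * 'I_n => S p.1 p.2) (i, j)).
have Cm i j : `|C i j| <= 1 + M.
  by apply: norm_le_1D; apply: le_trans (GM j); rewrite CE sqr_mx_entry_le.
have m0 : 0 <= 1 + M by rewrite addr_ge0.
move=> i j; rewrite {1}HE.
have Ct k l : `|C^T k l| <= 1 + M by rewrite mxE.
have CS := norm_mulmx_le m0 Ct Ss.
have := norm_mulmx_le _ CS Cm i j.
have s0 : 0 <= s by rewrite sqrtr_ge0.
rewrite mulr_ge0// ?mulr_ge0// => /(_ isT)/le_trans; apply.
by rewrite le_eqVlt; apply/orP; left; apply/eqP; ring.
Qed.

(** As for 2-tensors: [U] has all three indices in the frame given by the Cholesky factor, where the
    norm is the Euclidean one. Going back costs one factor n (1 + M) per index, hence the cube. *)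
Lemma tensor3_sq_lower_bound n (G : 'M[R]_n) (T : 'I_n -> 'M[R]_n) (M : R) :
  posdef G -> 0 <= M -> (forall i, G i i <= M) -> forall k i j,
  `|T k i j| <= (n%:R * (1 + M)) ^+ 3 * Num.sqrt (tensor3_sq (invmx G) T).
Proof.
move=> pG M0 GM.
have [C CE] := posdef_cholesky pG.
have uC : C \in unitmx by have := posdef_unitmx pG; rewrite CE unitmx_mul => /andP[].
pose B := invmx C; pose S k := B^T *m T k *m B.
have TE k : T k = C^T *m S k *m C.
  by rewrite /S !mulmxA -trmx_mul mulVmx// trmx1 mul1mx -mulmxA mulVmx// mulmx1.
pose U k := pull_back_form B S k.
have SE k : S k = pull_back_form C U k.
  rewrite /pull_back_form /U /pull_back_form.
  under eq_bigr do rewrite scaler_sumr.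
  rewrite exchange_big/= (bigD1 k)//= [X in _ + X]big1 ?addr0 => [|l lk].
    under eq_bigr do rewrite scalerA mulrC.
    rewrite -scaler_suml; have /matrixP/(_ k k) := mulVmx uC.
    by rewrite !mxE eqxx => ->; rewrite scale1r.
  under eq_bigr do rewrite scalerA mulrC.
  rewrite -scaler_suml; have /matrixP/(_ l k) := mulVmx uC.
  by rewrite !mxE (negbTE lk) => ->; rewrite scale0r.
have WE : invmx G = invmx C *m 1%:M *m (invmx C)^T.
  by rewrite (@invmx_congruence _ _ C G 1%:M) ?invmx1 ?unitmx1// mulmx1.
have TU k : T k = C^T *m pull_back_form C U k *m C by rewrite -SE.
rewrite (tensor3_sq_congruence uC WE TU).
have -> : tensor3_sq 1%:M U = \sum_(p : 'I_n * ('I_n * 'I_n)) U p.1 p.2.1 p.2.2 ^+ 2.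
  rewrite -(pair_bigA _ (fun a b => U a b.1 b.2 ^+ 2))/=; apply: eq_bigr => k _.
  rewrite (bigD1 k)//= big1 ?addr0 => [|p pk]; last first.
    by rewrite mxE eq_sym (negbTE pk) mul0r.
  rewrite mxE eqxx mul1r trmx1 mul1mx mulmx1.
  by rewrite mxtrace_mul_tr (pair_bigA _ (fun a b => U k a b ^+ 2)).
set s := Num.sqrt _.
have Us k i j : `|U k i j| <= s.
  exact: (norm_le_sqrt_sum (fun p : 'I_n * ('I_n * 'I_n) => U p.1 p.2.1 p.2.2) (k, (i, j))).
have Cm i j : `|C i j| <= 1 + M.
  by apply: norm_le_1D; apply: le_trans (GM j); rewrite CE sqr_mx_entry_le.
have m0 : 0 <= 1 + M by rewrite addr_ge0.
have s0 : 0 <= s by rewrite sqrtr_ge0.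
move=> k i j; rewrite TE.
have Ct a l : `|C^T a l| <= 1 + M by rewrite mxE.
have Ss a b : `|S k a b| <= n%:R * ((1 + M) * s).
  rewrite SE summxE (le_trans (ler_norm_sum _ _ _))//.
  rewrite (@le_trans _ _ (\sum_(l < n) (1 + M) * s))//.
    by apply: ler_sum => l _; rewrite mxE normrM ler_pM.
  by rewrite sumr_const card_ord mulr_natl.
have CS := norm_mulmx_le m0 Ct Ss.
have := norm_mulmx_le _ CS Cm i j.
rewrite !mulr_ge0// => /(_ isT)/le_trans; apply.
by rewrite le_eqVlt; apply/orP; left; apply/eqP; ring.
Qed.

End positive_definite.

(** * Lebesgue measure on row vectors *)

Section row_of_tuple.
Context {R : realType}.

(** A countable base. Such a ball is a cube for the max norm, so its preimage in the tuples is a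
    finite intersection of measurable cylinders. *)
Definition rat_ball n (p : 'rV[rat]_n * nat) : set 'rV[R]_n :=
  ball (\row_j ratr (p.1 0 j) : 'rV[R]_n) p.2.+1%:R^-1.

Lemma open_bigcup_rat_ball n (U : set 'rV[R]_n) : open U ->
  U = \bigcup_(p in [set p | rat_ball p `<=` U]) rat_ball p.
Proof.
move=> oU; apply/seteqP; split => [y Uy|y [p /= pU /pU]//].
have [d /= d0 dU] := (nbhs_ballP _ _).1 (open_nbhs_nbhs (conj oU Uy)).
have d20 : 0 < d / 2 by rewrite divr_gt0.
have [k kd] : exists k : nat, k.+1%:R^-1 < d / 2.
  have /= [k _] := near_infty_natSinv_lt (PosNum d20).
  by move=> /(_ k (leqnn k)) /= ?; exists k.
have k0 : 0 < k.+1%:R^-1 :> R by rewrite invr_gt0.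
have qex j : exists q : rat, `|ratr q - y 0 j| < k.+1%:R^-1.
  have yk : y 0 j < y 0 j + k.+1%:R^-1 by rewrite ltrDl.
  have [q] := rat_in_itvoo yk; rewrite in_itv/= => /andP[q1 q2].
  by exists q; rewrite ger0_norm ?subr_ge0 ?(ltW q1)// ltrBlDl.
pose q : 'rV[rat]_n := \row_j sval (cid (qex j)).
have yq : rat_ball (q, k) y.
  split=> // i j; rewrite /ball/= !mxE (ord1 i).
  exact: svalP (cid (qex j)).
exists (q, k) => // z /= [_ qz]; apply: dU; split=> // i j.
have [_ /(_ i j) qy] := yq; move: qy (qz i j); rewrite /ball /= => qy qz'.
rewrite [d]splitr (le_lt_trans (ler_distD ((\row_j ratr (q 0 j) : 'rV[R]_n) i j) _ _))//.
by rewrite ltrD// ?(lt_trans qz')// distrC (lt_trans qy).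
Qed.

Lemma measurable_row_of_tuple n (U : set 'rV[R]_n) : open U ->
  measurable ((@row_of_tuple R n) @^-1` U).
Proof.
move=> oU; rewrite (open_bigcup_rat_ball oU) bigcup_mkcond preimage_bigcup.
apply: countable_bigcupT_measurable => [|p]; first exact: countableP.
case: ifPn => _; last by rewrite preimage_set0.
have -> : (@row_of_tuple R n) @^-1` rat_ball p =
    \bigcap_(j in [set: 'I_n])
      ((tnth (T:=R))^~ j @^-1` ball (ratr (p.1 0 j) : R) p.2.+1%:R^-1).
  apply/seteqP; split => [t [_ tp] j _ /=|t tp].
    by have := tp 0 j; rewrite !mxE.
  by split=> [|i j]; rewrite ?invr_gt0// !mxE; exact: tp.
apply: fin_bigcap_measurable => [|j _]; first exact: finite_finset.
rewrite -[X in measurable X]setTI.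
by apply: measurable_tnth => //; rewrite ball_itv; exact: measurable_itv.
Qed.

Definition tuple_shift n (s : 'I_n -> R) (t : n.-tuple R) : n.-tuple R :=
  [tuple tnth t i + s i | i < n].

Lemma measurable_tuple_shift n (s : 'I_n -> R) :
  measurable_fun [set: n.-tuple R] (tuple_shift s).
Proof.
apply/measurable_fun_tnthP => i.
rewrite (_ : _ \o _ = fun t => tnth t i + s i).
  by apply: measurable_funD; [exact: measurable_tnth|exact: measurable_cst].
by apply/funext => t; rewrite /= tnth_mktuple.
Qed.

Lemma row_of_tuple_shift n (s : 'I_n -> R) (t : n.-tuple R) :
  row_of_tuple (tuple_shift s t) = row_of_tuple t + \row_j s j.
Proof. by apply/rowP => j; rewrite !mxE tnth_mktuple. Qed.

Lemma tuple_shift_cons n (s : 'I_n.+1 -> R) (x : R) (t : n.-tuple R) :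
  tuple_shift s (tuple_cons (x, t)) =
  tuple_cons (x + s ord0, tuple_shift (fun j => s (lift ord0 j)) t).
Proof.
apply: eq_from_tnth => i; rewrite tnth_mktuple.
case: (unliftP ord0 i) => [j ->|->]; last by rewrite !tnth0.
by rewrite !tnthS tnth_mktuple.
Qed.

Lemma lebesgue_measure_shift (a : R) (A : set R) : measurable A ->
  (@lebesgue_measure R) ((fun x => x + a) @^-1` A) = lebesgue_measure A.
Proof.
move=> mA; have mf : measurable_fun [set: measurableTypeR R]
    ((fun x => x + a) : measurableTypeR R -> measurableTypeR R).
  by apply: (@measurable_funD _ R R setT id (cst a)) => //; exact: measurable_cst.
pose mu := measure_function_pushforward__canonical__measure_function_Measure
  (@lebesgue_measure R) mf.
have := @lebesgue_measure_unique R mu _ A mA; rewrite /mu/= /pushforward => -> //.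
move=> _ [[b c] _ <-] /=; rewrite /pushforward.
have -> : (fun x => x + a) @^-1` `]b, c]%classic = `]b - a, c - a]%classic.
  by apply/seteqP; split => x /=; rewrite !in_itv/= ltrBlDr lerBrDr.
rewrite !lebesgue_measure_itv /= !lte_fin ltrD2r.
by case: ifP => // _; rewrite -!EFinB; congr EFin; ring.
Qed.

Lemma lebesgue_tupleS n (A : set (n.+1.-tuple R)) :
  lebesgue_tuple n.+1 A =
  (\int[lebesgue_tuple n]_t
     lebesgue_measure (ysection (@tuple_cons R n @^-1` A) t))%E.
Proof. by []. Qed.

(** Induction on the dimension: the slices are translated by the first coordinate of s, the base by
    the others. *)
Lemma lebesgue_tuple_shift n (s : 'I_n -> R) (A : set (n.-tuple R)) :
  measurable A -> lebesgue_tuple n (tuple_shift s @^-1` A) = lebesgue_tuple n A.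
Proof.
elim: n s A => [|n ih] s A mA.
  have -> // : tuple_shift s @^-1` A = A.
  by apply/seteqP; split => t /=; rewrite (tuple0 t) (tuple0 (tuple_shift _ _)).
rewrite !lebesgue_tupleS.
pose s' j := s (lift ord0 j).
have mA' : measurable (@tuple_cons R n @^-1` A).
  by rewrite -[X in measurable X]setTI; exact: measurable_tuple_cons.
pose f t := lebesgue_measure (ysection (@tuple_cons R n @^-1` A) t).
have mf : measurable_fun setT f by exact: measurable_fun_ysection.
transitivity (\int[lebesgue_tuple n]_t (f \o tuple_shift s') t)%E.
  apply: eq_integral => t _; rewrite /f /= -[RHS](lebesgue_measure_shift (s ord0)).
    congr lebesgue_measure; apply/seteqP; split => x; rewrite /ysection /= !inE /=.
      by rewrite tuple_shift_cons.
    by rewrite tuple_shift_cons.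
  exact: measurable_ysection.
have ms := measurable_tuple_shift s'.
rewrite -[LHS](@ge0_integral_pushforward _ _ _ _ _ _ ms (lebesgue_tuple n) setT)//.
by apply: eq_measure_integral => B mB _; exact: ih.
Qed.

Lemma ge0_integral_tuple_shift n (s : 'I_n -> R) (f : n.-tuple R -> \bar R) :
  measurable_fun setT f -> (forall t, 0 <= f t)%E ->
  (\int[lebesgue_tuple n]_t f (tuple_shift s t) = \int[lebesgue_tuple n]_t f t)%E.
Proof.
move=> mf f0; have ms := measurable_tuple_shift s.
rewrite -[LHS](@ge0_integral_pushforward _ _ _ _ _ _ ms (lebesgue_tuple n) setT)//.
by apply: eq_measure_integral => B mB _; exact: lebesgue_tuple_shift.
Qed.

(** Cubes have finite measure, so their indicators serve as dominating functions for compactly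
    supported integrands. *)
Definition tuple_box n (M : R) : set (n.-tuple R) :=
  [set t | forall j, `|tnth t j| <= M].
Arguments tuple_box : clear implicits.

Lemma measurable_tuple_box n M : measurable (tuple_box n M).
Proof.
have -> : tuple_box n M =
    \bigcap_(j in [set: 'I_n]) ((tnth (T:=R))^~ j @^-1` `[- M, M]%classic).
  apply/seteqP; split => [t tM j _ /=|t tM j]; first by rewrite in_itv/= -ler_norml.
  by have := tM j I; rewrite /= in_itv/= -ler_norml.
apply: fin_bigcap_measurable => [|j _]; first exact: finite_finset.
by rewrite -[X in measurable X]setTI; exact: measurable_tnth.
Qed.

Lemma lebesgue_tuple_box_lty n M : (lebesgue_tuple n (tuple_box n M) < +oo)%E.
Proof.
elim: n => [|n ih]; first by rewrite /= diracE ltry.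
have -> : lebesgue_tuple n.+1 (tuple_box n.+1 M) =
   (lebesgue_measure \x^ lebesgue_tuple n)%E (`[- M, M]%classic `*` tuple_box n M).
  rewrite /= /pushforward; congr (_ _).
  apply/seteqP; split => [[x t] xt|[x t] /= [xM tM] j].
    split=> [|j]; first by have := xt ord0; rewrite tnth0 /= in_itv/= ler_norml.
    by have := xt (lift ord0 j); rewrite tnthS.
  case: (unliftP ord0 j) => [i ->|->]; first by rewrite tnthS; exact: tM.
  by rewrite tnth0 ler_norml; move: xM; rewrite in_itv.
rewrite product_measure2E//; last exact: measurable_tuple_box.
have lM : lebesgue_measure (`[- M, M]%classic : set R) \is a fin_num.
  by rewrite lebesgue_measure_itv /=; case: ifP.
exact: lte_mul_pinfty (measure_ge0 _ _) lM ih.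
Qed.

End row_of_tuple.
Arguments tuple_box {R} n M.
Arguments measurable_tuple_box {R} n M.
Arguments lebesgue_tuple_box_lty {R} n M.

Section open_measurable.
Context {R : realType}.

Lemma measurable_fun_open d (T : measurableType d) (D : set T) (f : T -> R) :
  (forall U : set R, open U -> measurable (D `&` f @^-1` U)) -> measurable_fun D f.
Proof.
move=> fU; apply: (measurability _ (RGenOInfty.measurableE R)) => _ [_ [x ->] <-].
by apply: fU; exact: interval_open.
Qed.

Lemma open_setI_preimage (T U : topologicalType) (f : T -> U) (D : set T) (V : set U) :
  open D -> (forall x, D x -> {for x, continuous f}) -> open V ->
  open (D `&` f @^-1` V).
Proof.
move=> oD cf oV; rewrite openE => x [Dx Vfx]; rewrite /interior.
apply: filterI; first exact: open_nbhs_nbhs.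
by apply: (cf x Dx); exact: open_nbhs_nbhs.
Qed.

Lemma measurable_fun_row n (D : set 'rV[R]_n) (f : 'rV[R]_n -> R) : open D ->
  (forall y, D y -> {for y, continuous f}) ->
  measurable_fun (@row_of_tuple R n @^-1` D) (f \o @row_of_tuple R n).
Proof.
move=> oD cf; apply: measurable_fun_open => U oU.
rewrite (_ : _ `&` _ = @row_of_tuple R n @^-1` (D `&` f @^-1` U))//.
by apply: measurable_row_of_tuple; exact: open_setI_preimage.
Qed.

Lemma integral_tuple_shift n (s : 'I_n -> R) (f : n.-tuple R -> \bar R) :
  measurable_fun setT f ->
  (\int[lebesgue_tuple n]_t f (tuple_shift s t) = \int[lebesgue_tuple n]_t f t)%E.
Proof.
move=> mf; rewrite integralE [RHS]integralE.
have Ep := ge0_integral_tuple_shift s (measurable_funepos mf) (funepos_ge0 f).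
have En := ge0_integral_tuple_shift s (measurable_funeneg mf) (funeneg_ge0 f).
rewrite -Ep -En.
by congr (_ - _)%E; apply: eq_integral => t _; rewrite ?funeposE ?funenegE.
Qed.

Lemma boxed_integrable n (h : n.-tuple R -> R) (C M : R) : 0 <= C ->
  measurable_fun setT h ->
  (forall t, `|h t| <= C * \1_(tuple_box n M) t) ->
  (lebesgue_tuple n).-integrable setT (EFin \o h).
Proof.
move=> C0 mh hC; have mB := measurable_tuple_box n M.
apply: (@le_integrable _ _ _ _ _ measurableT _
    (fun t => C%:E * (\1_(tuple_box n M) t)%:E)%E).
- exact/measurable_EFinP.
- move=> t _ /=; rewrite lee_fin (le_trans (hC t))//.
  by rewrite ler_norm.
- apply: integrableZl => //; apply/integrableP; split.
    exact/measurable_EFinP/measurable_indic.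
  under eq_integral do rewrite gee0_abs ?lee_fin//.
  by rewrite integral_indic// setIT lebesgue_tuple_box_lty.
Qed.

Lemma compact_rV_norm_le n (K : set 'rV[R]_n) : compact K ->
  exists2 M : R, 0 <= M & forall y, K y -> forall j, `|y 0 j| <= M.
Proof.
move=> /compact_bounded[M [_ MK]].
exists (`|M| + 1); first by rewrite addr_ge0.
move=> y Ky j; have := MK (`|M| + 1); rewrite ltr_pwDr// ?ler_norm//.
move=> /(_ isT y Ky) /=; apply: le_trans.
by rewrite [leRHS]/Num.Def.normr/= mx_normrE; exact: (le_bigmax _ _ (0, j)).
Qed.

Lemma compact_continuous_bounded (T : topologicalType) (K : set T) (g : T -> R) :
  compact K -> (forall y, K y -> {for y, continuous g}) ->
  exists2 C : R, 0 <= C & forall y, K y -> `|g y| <= C.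
Proof.
move=> cK cg; have cgK : compact (g @` K).
  apply: continuous_compact => //; apply: continuous_in_subspaceT => y.
  by rewrite inE => /cg.
have [C [_ HC]] := compact_bounded cgK.
exists (`|C| + 1); first by rewrite addr_ge0.
move=> y Ky; apply: (HC (`|C| + 1)) => /=; last by exists y.
by rewrite ltr_pwDr// ler_norm.
Qed.

End open_measurable.

Section integral_partial.
Context {R : realType} {n : nat}.
Variables (f : 'rV[R]_n -> R) (j : 'I_n) (K : set 'rV[R]_n).
Hypotheses (df : forall y, differentiable f y)
  (cf : forall y, {for y, continuous (partial j f)})
  (cK : compact K) (f0 : forall y, ~ K y -> f y = 0).

Let row := @row_of_tuple R n.

(* By translation invariance the difference quotients of f have integral 0;
   they are dominated and converge to the partial derivative. *)
Lemma integral_partial_eq0 :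
  (\int[lebesgue_tuple n]_t (partial j f (row t))%:E)%E = 0%E.
Proof.
have clK : closed K by apply: compact_closed => //; exact: norm_hausdorff.
have pf0 y : ~ K y -> partial j f y = 0.
  move=> Ky; rewrite -(@partial_cst R n 0 j y); apply: near_eq_partial.
  have oK : open (~` K) by rewrite openC.
  by apply: filterS (open_nbhs_nbhs (conj oK Ky)) => z /f0.
have contf y : {for y, continuous f} by exact: differentiable_continuous.
have bounded (g : 'rV[R]_n -> R) : (forall y, {for y, continuous g}) ->
    (forall y, ~ K y -> g y = 0) -> exists2 C : R, 0 <= C & forall y, `|g y| <= C.
  move=> cg g0; have [C C0 HC] := compact_continuous_bounded cK (fun y _ => cg y).
  exists C => // y; have [/HC//|Ky] := pselect (K y).
  by rewrite g0// normr0.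
have [L L0 HL] := bounded _ cf pf0.
have [C C0 HC] := bounded _ contf f0.
have [M M0 HM] := compact_rV_norm_le cK.
(* K lies in the cube of radius [M], so all difference quotients with step at most 1 vanish outside
   the cube of radius [M + 1], which carries the dominating function. *)
have notbox t s : ~ tuple_box n (M + 1) t -> `|s| <= 1 -> ~ K (row t + s *: delta_mx 0 j).
  move=> tb s1 /HM H; apply: tb => i.
  have := H i; rewrite !mxE /= => h.
  rewrite -[tnth t i](addrK (s * (i == j)%:R)) (le_trans (ler_normB _ _))// lerD//.
  by rewrite normrM; case: (i == j); rewrite ?normr1 ?mulr1// normr0 mulr0.
pose s k : R := k.+1%:R^-1.
have s0 k : 0 < s k by rewrite invr_gt0.
have s1 k : `|s k| <= 1.
  by rewrite ger0_norm ?(ltW (s0 k))// invf_le1// ler1n.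
pose sh k : 'I_n -> R := fun i => s k * (i == j)%:R.
have rsh k t : row (tuple_shift (sh k) t) = row t + s k *: delta_mx 0 j.
  by rewrite /row row_of_tuple_shift; congr (_ + _); apply/rowP => i; rewrite !mxE.
pose F k t := (s k)^-1 * (f (row (tuple_shift (sh k) t)) - f (row t)).
have mfr : measurable_fun setT (f \o row).
  by have := @measurable_fun_row R n setT f openT (fun y _ => contf y); rewrite preimage_setT.
have mpr : measurable_fun setT (partial j f \o row).
  by have := @measurable_fun_row R n setT (partial j f) openT (fun y _ => @cf y); rewrite preimage_setT.
have mfs k : measurable_fun setT (fun t => f (row (tuple_shift (sh k) t))).
  by apply: (measurableT_comp mfr); exact: measurable_tuple_shift.
have mF k : measurable_fun setT (F k).
  by apply: measurable_funM; [exact: measurable_cst|exact: measurable_funB].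
have ifr : (lebesgue_tuple n).-integrable setT (EFin \o (f \o row)).
  apply: (@boxed_integrable R n _ C (M + 1)) => // t; rewrite indicE.
  case: (boolP (t \in _)) => [_|/negP tb]; first by rewrite mulr1; exact: HC.
  have := notbox t 0; rewrite scale0r addr0 normr0 => h.
  by rewrite /= f0 ?normr0 ?mulr0//; apply: h => // tb'; apply: tb; rewrite inE.
have ifs k : (lebesgue_tuple n).-integrable setT
    (EFin \o (fun t => f (row (tuple_shift (sh k) t)))).
  apply: (@boxed_integrable R n _ C (M + 1)) => // t; rewrite indicE.
  case: (boolP (t \in _)) => [_|/negP tb]; first by rewrite mulr1; exact: HC.
  rewrite rsh f0 ?normr0 ?mulr0//; apply: notbox => // tb'.
  by apply: tb; rewrite inE.
have IF k : (\int[lebesgue_tuple n]_t (F k t)%:E)%E = 0%E.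
  under eq_integral do rewrite EFinM EFinB.
  rewrite integralZl//; last exact: (integrableB measurableT (ifs k) ifr).
  rewrite integralB_EFin//.
  rewrite (integral_tuple_shift (sh k) (f := EFin \o (f \o row))); last exact/measurable_EFinP.
  by rewrite subee ?mule0//; exact: integrable_fin_num.
have FL k t : `|F k t| <= L * \1_(tuple_box n (M + 1)) t.
  rewrite indicE; case: (boolP (t \in _)) => [_|/negP tb]; last first.
    have tb' : ~ tuple_box n (M + 1) t by move=> ?; apply: tb; rewrite inE.
    rewrite /F rsh f0; last exact: notbox.
    have := notbox t 0 tb'; rewrite scale0r addr0 normr0 => h.
    by rewrite f0 ?subr0 ?mulr0 ?normr0//; exact: h.
  rewrite /F rsh; have [c _ ->] := @MVT_line R n f (row t) (delta_mx 0 j) (s k) (s0 k) (fun u _ => @df _).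
  rewrite mulrA mulVf ?gt_eqF// mul1r mulr1; exact: HL.
have Fcvg t : F k t @[k --> \oo] --> partial j f (row t).
  have dj : derivable f (row t) (delta_mx 0 j) by exact: diff_derivable.
  have sc : s k @[k --> \oo] --> (0 : R)^'.
    move=> A A0; have : \forall k \near \oo, s k != 0 -> A (s k) := @cvg_harmonic R _ A0.
    by rewrite near_simpl; apply: filterS => k /= Ak; apply: Ak; exact: lt0r_neq0 (s0 k).
  have H : (fun h : R => h^-1 *: ((f \o shift (row t)) (h *: delta_mx 0 j) - f (row t)))
    @ (0 : R)^' --> partial j f (row t) := dj.
  have := cvg_comp _ _ sc H; apply: cvg_trans; apply: near_eq_cvg; apply: nearW => k.
  by rewrite /F rsh /= (addrC (row t)).
have := @dominated_convergence _ _ R (lebesgue_tuple n) setT measurableT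
  (fun k t => (F k t)%:E) (fun t => (partial j f (row t))%:E)
  (fun t => (L * \1_(tuple_box n (M + 1)) t)%:E).
case.
- by move=> k; exact/measurable_EFinP.
- exact/measurable_EFinP.
- apply: aeW => t _; apply: cvg_EFin; last exact: Fcvg.
  exact: nearW.
- apply: (@boxed_integrable R n _ L (M + 1)) => //.
    by apply: measurable_funM; [exact: measurable_cst|apply: measurable_indic; exact: measurable_tuple_box].
  by move=> t; rewrite ger0_norm// mulr_ge0.
- by apply: aeW => t k _; rewrite lee_fin.
move=> _ _; under eq_fun do rewrite IF.
by move=> /cvg_lim <-//; rewrite lim_cst.
Qed.

End integral_partial.

(** * Measures with density and change of variables *)

Section density.
Local Open Scope ereal_scope.
Context d (T : measurableType d) (R : realType).
Variables (mu : {measure set T -> \bar R}) (w : T -> R).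
Hypotheses (mw : measurable_fun setT w) (w0 : forall x, (0 <= w x)%R).

Let mwE : measurable_fun setT (EFin \o w).
Proof. exact/measurable_EFinP. Qed.

Definition density_fun (A : set T) := \int[mu]_(x in A) (w x)%:E.

Let density0 : density_fun set0 = 0.
Proof. by rewrite /density_fun integral_set0. Qed.

Let density_ge0 A : 0 <= density_fun A.
Proof. by apply: integral_ge0 => x _; rewrite lee_fin. Qed.

Let density_sigma_additive : semi_sigma_additive density_fun.
Proof.
move=> F mF tF mUF; rewrite /density_fun ge0_integral_bigcup//.
- by apply: is_cvg_ereal_nneg_natsum_cond => i _ _; apply: integral_ge0 => x _; rewrite lee_fin.
- exact: measurable_funTS.
- by move=> x _; rewrite lee_fin.
Qed.

Definition density_isMeasure := isMeasure.Build _ _ _ density_fun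
  density0 density_ge0 density_sigma_additive.

Definition density_measure : {measure set T -> \bar R} :=
  HB.pack density_fun density_isMeasure.

Import HBNNSimple.

(** True by linearity for simple functions; monotone convergence on both sides gives the general
    case. *)
Lemma ge0_integral_density (f : T -> \bar R) :
  measurable_fun setT f -> (forall x, 0 <= f x) ->
  \int[density_measure]_x f x = \int[mu]_x (f x * (w x)%:E).
Proof.
move=> mf f0; pose f_ := nnsfun_approx measurableT mf.
have fcvg x : (f_ ^~ x n)%:E @[n --> \oo] --> f x by apply: cvg_nnsfun_approx.
have fnd x m n : (m <= n)%N -> (f_ m x)%:E <= (f_ n x)%:E.
  by move=> mn; rewrite lee_fin; exact/lefP/nd_nnsfun_approx.
have mf_ n : measurable_fun setT (fun x => (f_ n x)%:E).
  exact/measurable_EFinP/measurable_funP.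
transitivity (limn (fun n => \int[density_measure]_x (f_ n x)%:E)).
  rewrite -monotone_convergence//.
  - by apply: eq_integral => x _; apply/esym/cvg_lim.
  - by move=> n x _; rewrite lee_fin.
  - by move=> x _ m n; exact: fnd.
have -> : \int[mu]_x (f x * (w x)%:E) = limn (fun n => \int[mu]_x ((f_ n x)%:E * (w x)%:E)).
  rewrite -monotone_convergence//; last 3 first.
  - by move=> n; apply: emeasurable_funM.
  - by move=> n x _; rewrite mule_ge0// lee_fin.
  - by move=> x _ m n mn; apply: lee_wpmul2r; [rewrite lee_fin|exact: fnd].
  apply: eq_integral => x _; apply/esym/cvg_lim => //.
  by apply: cvgeZr.
congr (limn _); apply/funext => n.
rewrite integralT_nnsfun sintegralE.
transitivity (\sum_(r \in range (f_ n)) \int[mu]_x (r%:E * (\1_(f_ n @^-1` [set r]) x)%:E * (w x)%:E)).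
  apply: eq_fsbigr => r; rewrite inE => -[x _ rE].
  have r0 : (0 <= r)%R by rewrite -rE.
  under eq_integral do rewrite -muleA.
  rewrite ge0_integralZl//; last 2 first.
  - by apply: emeasurable_funM => //; exact/measurable_EFinP/measurable_indic.
  - by move=> y _; rewrite mule_ge0// lee_fin.
  congr (_ * _); rewrite [LHS]integral_mkcond; apply: eq_integral => y _.
  by rewrite patchE indicE; case: ifPn => _; rewrite ?mul1e ?mul0e.
rewrite -ge0_integral_fsum//.
- apply: eq_integral => x _.
  rewrite -ge0_mule_fsuml => [|y]; last exact: nnfun_muleindic_ge0.
  by rewrite fsumEFin // -(fimfunE _ x).
- move=> r; apply: emeasurable_funM => //.
  by apply/measurable_EFinP; apply: measurable_funM; [exact: measurable_cst|exact: measurable_indic].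
- by move=> r x _; rewrite mule_ge0 ?nnfun_muleindic_ge0// lee_fin.
Qed.

End density.

Section change_of_variables.
Local Open Scope ereal_scope.
Context d1 d2 (X : measurableType d1) (T : measurableType d2) (R : realType).
Variables (mu : {measure set X -> \bar R}) (leb : {measure set T -> \bar R}).
Variables (D : set X) (Phi : T -> X) (w : T -> R).
Hypotheses (mPhi : measurable_fun setT Phi)
  (mw : measurable_fun setT w) (w0 : forall t, (0 <= w t)%R)
  (muE : forall B, measurable B -> B `<=` D ->
    mu B = \int[leb]_(t in Phi @^-1` B) (w t)%:E).

(** On measurable subsets of D, [mu] is the push-forward by [Phi] of the measure with density [w].
    As F vanishes off D, both integrals only see D. *)
Lemma ge0_integral_change (F : X -> R) : measurable_fun setT F ->
  (forall x, (0 <= F x)%R) -> (forall x, ~ D x -> F x = 0%R) ->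
  \int[mu]_x (F x)%:E = \int[leb]_t (F (Phi t) * w t)%:E.
Proof.
move=> mF F0 FD.
have mFE : measurable_fun setT (EFin \o F) by exact/measurable_EFinP.
pose nu := measure_function_pushforward__canonical__measure_function_Measure
  (density_measure leb mw w0) mPhi.
have FE : EFin \o F = (EFin \o F) \_ D.
  apply/funext => x; rewrite patchE; case: ifPn => // /negP; rewrite inE => /FD.
  by move=> /= ->.
have condD (m : {measure set X -> \bar R}) :
    \int[m]_x (F x)%:E = \int[m]_(x in D) (F x)%:E.
  by rewrite [RHS]integral_mkcond; congr (integral m setT _).
transitivity (\int[nu]_(x in D) (F x)%:E).
  by rewrite condD; apply: eq_measure_integral => B mB BD; rewrite muE.
rewrite -condD.
rewrite /nu ge0_integral_pushforward//; last by move=> y _; rewrite lee_fin.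
rewrite preimage_setT ge0_integral_density//.
  exact: measurableT_comp mFE mPhi.
by move=> t; rewrite lee_fin.
Qed.

Lemma integral_change (F : X -> R) : measurable_fun setT F ->
  (forall x, ~ D x -> F x = 0%R) ->
  \int[mu]_x (F x)%:E = \int[leb]_t (F (Phi t) * w t)%:E.
Proof.
(* As [w] is nonnegative, taking positive or negative parts commutes with multiplication by it. *)
move=> mF FD; rewrite integralE [RHS]integralE; congr (_ - _).
  transitivity (\int[mu]_x (Num.max (F x) 0)%:E).
    by apply: eq_integral => x _; rewrite funeposE EFin_max.
  rewrite ge0_integral_change//.
  - apply: eq_integral => t _; rewrite funeposE -[RHS]EFin_max.
    by rewrite maxr_pMl// mul0r.
  - by apply: measurable_maxr.
  - by move=> x; rewrite le_max lexx orbT.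
  - by move=> x /FD ->; rewrite maxxx.
transitivity (\int[mu]_x (Num.max (- F x) 0)%:E).
  by apply: eq_integral => x _; rewrite funenegE EFin_max.
rewrite (ge0_integral_change (F := fun x => Num.max (- F x)%R 0%R))//.
- apply: eq_integral => t _; rewrite funenegE -[RHS]EFin_max.
  by rewrite maxr_pMl// mul0r mulNr.
- by apply: measurable_maxr => //; exact: measurableT_comp.
- by move=> x; rewrite le_max lexx orbT.
- by move=> x /FD ->; rewrite oppr0 maxxx.
Qed.

End change_of_variables.

(** * Tensor fields on a manifold *)

Section local_continuity.
Context {R : realType} {n : nat}.
Variables (D : set 'rV[R]_n) (G : 'rV[R]_n -> 'M[R]_n).
Hypotheses (oD : open D) (uG : forall y, D y -> G y \in unitmx)
  (CG : forall i j, Ck_on 2 D (fun y => G y i j)).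

Lemma metric_entry_C1 i j : C1_on D (fun y => G y i j).
Proof. exact/C2_C1/CG. Qed.

Lemma invmx_metric_C1 i j : C1_on D (fun y => invmx (G y) i j).
Proof. by apply: C1_invmx => // a b; exact: metric_entry_C1. Qed.

Lemma scalar_curvature_loc_continuous y : D y ->
  {for y, continuous (scalar_curvature_loc G)}.
Proof.
move=> Dy; have cC r k s := christoffel_C1 oD uG CG r k s.
apply: continuous_at_sum => s _; apply: continuous_at_sum => v _.
apply: continuousM; first exact: C1_continuous (invmx_metric_C1 s v) Dy.
apply: continuous_at_sum => r _; apply: continuousD.
  by apply: continuousB; exact: C1_partial_continuous Dy.
apply: continuous_at_sum => l _.
by apply: continuousB; apply: continuousM; exact: C1_continuous Dy.
Qed.

Lemma sqrt_continuous_at (T : topologicalType) (f : T -> R) (y : T) :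
  {for y, continuous f} -> {for y, continuous (fun z => Num.sqrt (f z))}.
Proof.
move=> cf; apply: (@continuous_comp _ _ _ f (@Num.sqrt R)) => //.
exact: sqrt_continuous.
Qed.

Variable H : 'rV[R]_n -> 'M[R]_n.
Hypothesis CH : forall i j, C1_on D (fun y => H y i j).

Lemma covariant_derivative_continuous k i j y : D y ->
  {for y, continuous (covariant_derivative G H k i j)}.
Proof.
move=> Dy; have cC r p s := christoffel_C1 oD uG CG r p s.
apply: continuousB; first apply: continuousB.
- exact: C1_partial_continuous (CH i j) Dy.
- by apply: continuous_at_sum => m _; apply: continuousM; exact: C1_continuous Dy.
- by apply: continuous_at_sum => m _; apply: continuousM; exact: C1_continuous Dy.
Qed.

Lemma gradient_norm_loc_continuous y : D y ->
  {for y, continuous (gradient_norm_loc G H)}.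
Proof.
move=> Dy; apply: sqrt_continuous_at.
do 6 apply: continuous_at_sum => ? _.
apply: continuousM; last exact: covariant_derivative_continuous.
apply: continuousM; last exact: covariant_derivative_continuous.
by do 2 (apply: continuousM; last exact: C1_continuous (invmx_metric_C1 _ _) Dy);
  exact: C1_continuous (invmx_metric_C1 _ _) Dy.
Qed.

End local_continuity.

Section charts.
Context {R : realType} {n : nat} {M : ptopologicalType}.
Variable A : smooth_manifold R n M.
Local Notation dom a := (dom (s := A) a).
Local Notation chart a := (chart (s := A) a).
Local Notation chart_inv a := (chart_inv (s := A) a).
Local Notation cod a := (chart a @` dom a).
Implicit Types (a b : chart_index A) (g h : C2_metric A).

Lemma dom_chart_inv a y : cod a y -> dom a (chart_inv a y).
Proof. by move=> [x ax <-]; rewrite chartK. Qed.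

Lemma chart_invK a y : cod a y -> chart a (chart_inv a y) = y.
Proof. by move=> [x ax <-]; rewrite chartK. Qed.

Lemma overlapE a b : chart a @` (dom a `&` dom b) = cod a `&` chart_inv a @^-1` dom b.
Proof.
apply/seteqP; split => [_ [x [ax bx] <-]|y [ay by_]].
  by split; [exists x|rewrite /= chartK].
by exists (chart_inv a y); [split=> //; exact: dom_chart_inv|exact: chart_invK].
Qed.

Lemma overlap_open a b : open (chart a @` (dom a `&` dom b)).
Proof.
rewrite overlapE; apply: open_setI_preimage; first exact: open_cod.
- by move=> y; exact: chart_inv_continuous.
- exact: open_dom.
Qed.

Lemma continuous_of_charts (f : M -> R) (floc : chart_index A -> 'rV[R]_n -> R) :
  (forall a x, dom a x -> f x = floc a (chart a x)) ->
  (forall a y, cod a y -> {for y, continuous (floc a)}) ->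
  forall x, {for x, continuous f}.
Proof.
move=> fE cf x; pose a := chart_at A x; have ax : dom a x := dom_chart_at A x.
apply: (@near_eq_continuous_at _ _ (floc a \o chart a)).
  have nx : \forall z \near x, dom a z by apply: open_nbhs_nbhs; split=> //; exact: open_dom.
  by apply: filterS nx => z az /=; rewrite (fE a z az).
apply: continuous_comp; first exact: chart_continuous.
by apply: cf; exists x.
Qed.

Lemma metric_posdefE g a y : cod a y -> posdef (metric_comp g a y).
Proof.
by move=> ay; split; [exact: Defs.metric_sym|exact: metric_posdef].
Qed.

Lemma metric_unitmx g a y : cod a y -> metric_comp g a y \in unitmx.
Proof. by move=> ay; apply: posdef_unitmx; exact: metric_posdefE. Qed.

Section overlap.
Variables (a b : chart_index A) (x : M).
Hypotheses (ax : dom a x) (bx : dom b x).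
Let D := chart a @` (dom a `&` dom b).
Let F := chart b \o chart_inv a.

Let Dx : D (chart a x). Proof. by exists x. Qed.
Let Da y : D y -> cod a y. Proof. by move=> [z [az _] <-]; exists z. Qed.
Let FE y : D y -> cod b (F y).
Proof. by move=> [z [az bz] <-]; rewrite /F /= chartK//; exists z. Qed.
Let Fx : F (chart a x) = chart b x. Proof. by rewrite /F /= chartK. Qed.
Let CF k : Ck_on 3 D (fun y => F y 0 k).
Proof. exact: smooth_transition a b k 3. Qed.

Let CkS k (U V : set 'rV[R]_n) f : U `<=` V -> Ck_on k V f -> Ck_on k U f.
Proof.
elim: k f => [|k ih] f UV /=; first by move=> cf y /UV; exact: cf.
by move=> [df Cp]; split=> [y /UV|j]; [exact: df|exact: ih].
Qed.

Let CG g i j : Ck_on 2 D (fun y => metric_comp g a y i j).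
Proof. by apply: CkS Da _; exact: metric_C2. Qed.

Let oD : open D. Proof. exact: overlap_open. Qed.
Let oE : open (cod b). Proof. exact: open_cod. Qed.

Let GE g y : D y -> metric_comp g a y =
  jacobian F y *m metric_comp g b (F y) *m (jacobian F y)^T.
Proof.
move=> [z [az bz] <-]; rewrite {1}(metric_change g az bz).
by rewrite /F /= chartK.
Qed.

Lemma scalar_curvature_overlap g :
  scalar_curvature_loc (metric_comp g a) (chart a x) =
  scalar_curvature_loc (metric_comp g b) (chart b x).
Proof.
have := (@scalar_curvature_change R n D (cod b) F
  (metric_comp g a) (metric_comp g b) oD oE FE CF
  (fun y Ey => Defs.metric_sym g Ey)
  (fun y Dy => metric_unitmx g (Da Dy)) (fun y Ey => metric_unitmx g Ey)
  (CG g) (fun i j => metric_C2 g b i j) (@GE g) _ Dx).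
by rewrite Fx.
Qed.

Let dGE g h y : D y -> metric_comp h a y - metric_comp g a y =
  jacobian F y *m (metric_comp h b (F y) - metric_comp g b (F y)) *m (jacobian F y)^T.
Proof. by move=> Dy; rewrite (GE g Dy) (GE h Dy) mulmxBr mulmxBl. Qed.

Lemma tensor_norm_overlap g h :
  tensor_norm_loc (metric_comp g a) (fun y => metric_comp h a y - metric_comp g a y) (chart a x) =
  tensor_norm_loc (metric_comp g b) (fun y => metric_comp h b y - metric_comp g b y) (chart b x).
Proof.
have := (@tensor_norm_change R n D (cod b) F
  (metric_comp g a) (metric_comp g b) FE CF
  (fun y Dy => metric_unitmx g (Da Dy)) (fun y Ey => metric_unitmx g Ey)
  (@GE g) (fun y => metric_comp h a y - metric_comp g a y)
  (fun y => metric_comp h b y - metric_comp g b y) (@dGE g h) _ Dx).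
by rewrite Fx.
Qed.

Lemma gradient_norm_overlap g h :
  gradient_norm_loc (metric_comp g a) (fun y => metric_comp h a y - metric_comp g a y) (chart a x) =
  gradient_norm_loc (metric_comp g b) (fun y => metric_comp h b y - metric_comp g b y) (chart b x).
Proof.
have dH y : cod b y -> mx_differentiable (fun y => metric_comp h b y - metric_comp g b y) y.
  move=> by_ i j; under eq_fun do rewrite mxE mxE.
  by apply: differentiableB; [have [d _] := metric_C2 h b i j|have [d _] := metric_C2 g b i j]; exact: d.
have := (@gradient_norm_change R n D (cod b) F
  (metric_comp g a) (metric_comp g b) oD oE FE CF
  (fun y Ey => Defs.metric_sym g Ey)
  (fun y Dy => metric_unitmx g (Da Dy)) (fun y Ey => metric_unitmx g Ey)
  (fun i j => metric_C2 g b i j)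
  (@GE g) (fun y => metric_comp h a y - metric_comp g a y)
  (fun y => metric_comp h b y - metric_comp g b y) (@dGE g h) dH _ Dx).
by rewrite Fx.
Qed.

(** Both determinants change by the squared Jacobian determinant. The quotient is thus a function on
    M, the square of the density of the volume of h with respect to that of g. *)
Lemma det_metric_overlap g h :
  \det (metric_comp h a (chart a x)) / \det (metric_comp g a (chart a x)) =
  \det (metric_comp h b (chart b x)) / \det (metric_comp g b (chart b x)).
Proof.
have uJ : jacobian F (chart a x) \in unitmx.
  have := metric_unitmx g (Da Dx); rewrite (GE g Dx) unitmx_mul => /andP[_].
  by rewrite unitmx_tr.
rewrite (GE g Dx) (GE h Dx) Fx !det_mulmx det_tr.
have dJ : \det (jacobian F (chart a x)) != 0 by rewrite -unitfE -unitmxE.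
have dg : \det (metric_comp g b (chart b x)) != 0.
  by rewrite -unitfE -unitmxE metric_unitmx//; exists x.
by field; rewrite dJ dg.
Qed.

End overlap.


Lemma scalar_curvatureE g a x : dom a x ->
  scalar_curvature g x = scalar_curvature_loc (metric_comp g a) (chart a x).
Proof. by move=> ax; exact: (scalar_curvature_overlap (dom_chart_at A x) ax). Qed.

Lemma dist_normE g h a x : dom a x -> dist_norm g h x =
  tensor_norm_loc (metric_comp g a)
    (fun y => metric_comp h a y - metric_comp g a y) (chart a x).
Proof. by move=> ax; exact: (tensor_norm_overlap (dom_chart_at A x) ax). Qed.

Lemma dist_gradient_normE g h a x : dom a x -> dist_gradient_norm g h x =
  gradient_norm_loc (metric_comp g a)
    (fun y => metric_comp h a y - metric_comp g a y) (chart a x).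
Proof. by move=> ax; exact: (gradient_norm_overlap (dom_chart_at A x) ax). Qed.

Lemma scalar_curvature_continuous g x : {for x, continuous (scalar_curvature g)}.
Proof.
apply: (continuous_of_charts (fun a x ax => @scalar_curvatureE g a x ax)) => a y ay.
have oc : open (cod a) by exact: open_cod.
by apply: (scalar_curvature_loc_continuous oc (@metric_unitmx g a) _ ay) => i j;
  exact: metric_C2.
Qed.

Lemma metric_diff_C1 g h a i j :
  C1_on (cod a) (fun y => (metric_comp h a y - metric_comp g a y) i j).
Proof.
have oc : open (cod a) by exact: open_cod.
have E : (fun y => (metric_comp h a y - metric_comp g a y) i j) =
  (fun y => metric_comp h a y i j - metric_comp g a y i j).
  by apply/funext => y; rewrite !mxE.
by rewrite E; apply: (C1B oc); apply: C2_C1; exact: metric_C2.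
Qed.

Lemma dist_gradient_norm_continuous g h x :
  {for x, continuous (dist_gradient_norm g h)}.
Proof.
apply: (@continuous_of_charts _ (fun a => gradient_norm_loc (metric_comp g a)
    (fun y => metric_comp h a y - metric_comp g a y))) => [a z az|a y ay].
  exact: dist_gradient_normE.
have oc : open (cod a) by exact: open_cod.
exact: (@gradient_norm_loc_continuous _ _ _ _ oc (@metric_unitmx g a)
  (fun i j => metric_C2 g a i j) (fun y => metric_comp h a y - metric_comp g a y)
  (@metric_diff_C1 g h a) _ ay).
Qed.

End charts.

(** * Integration against the Riemannian volume *)

Section volume.
Context {R : realType} {n : nat} {M : ptopologicalType}.
Variable A : smooth_manifold R n M.
Local Notation dom a := (dom (s := A) a).
Local Notation chart a := (chart (s := A) a).
Local Notation chart_inv a := (chart_inv (s := A) a).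
Local Notation cod a := (chart a @` dom a).
Local Notation row := (@row_of_tuple R n).
Implicit Types (a b : chart_index A) (g h : C2_metric A).

Lemma measurable_borel_open (U : set M) : open U -> measurable (U : set (@borel M)).
Proof. by move=> oU; exact: sub_sigma_algebra. Qed.

Lemma continuous_measurable_borel (f : M -> R) :
  (forall x, {for x, continuous f}) -> measurable_fun [set: @borel M] f.
Proof.
move=> cf; apply: measurable_fun_open => U oU; apply: measurable_borel_open.
by apply: open_setI_preimage => //; exact: openT.
Qed.

(** The inverse chart, made total so that measures can be pushed forward along it. The default
    [point] may lie in [dom a]; this is harmless because the weight used with it vanishes off
    [cod a]. *)
Definition chart_param a (t : n.-tuple R) : @borel M :=
  if row t \in cod a then chart_inv a (row t) else point.

Lemma measurable_cod a : measurable (row @^-1` cod a).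
Proof. by apply: measurable_row_of_tuple; exact: open_cod. Qed.

Lemma measurable_chart_param a : measurable_fun setT (chart_param a).
Proof.
apply: (@measurability _ _ _ (@borel M) setT (chart_param a) (@open M) erefl) => _ [U oU <-]; rewrite setTI.
have -> : chart_param a @^-1` U =
    row @^-1` (cod a `&` chart_inv a @^-1` U) `|`
    (~` (row @^-1` cod a) `&` [set _ | U point]).
  apply/seteqP; split => t; rewrite /preimage /= /chart_param.
    by case: ifPn; [rewrite inE; left|move=> /negP; rewrite inE; right].
  by case: ifPn => [|/negP]; rewrite inE => ta [[]|[]].
apply: measurableU.
  apply: measurable_row_of_tuple; apply: open_setI_preimage => //.
    exact: open_cod.
  by move=> y; exact: chart_inv_continuous.
apply: measurableI; first by apply: measurableC; exact: measurable_cod.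
have [pU|pU] := pselect (U point).
  by rewrite (_ : [set _ | _] = setT)//; apply/seteqP; split.
by rewrite (_ : [set _ | _] = set0)//; apply/seteqP; split.
Qed.

Lemma measurable_row_patch (D : set 'rV[R]_n) (f : 'rV[R]_n -> R) : open D ->
  (forall y, D y -> {for y, continuous f}) ->
  measurable_fun setT (fun t => f (row t) * \1_D (row t)).
Proof.
move=> oD cf.
have -> : (fun t => f (row t) * \1_D (row t)) = (f \o row) \_ (row @^-1` D).
  apply/funext => t; rewrite patchE indicE.
  have -> : (t \in row @^-1` D) = (row t \in D) by apply/idP/idP; rewrite !inE.
  by case: ifP; rewrite ?mulr1 ?mulr0.
apply/(measurable_restrictT _ _).1; last exact: measurable_fun_row.
exact: measurable_row_of_tuple.
Qed.

Definition volume_density g a (y : 'rV[R]_n) : R := Num.sqrt (\det (metric_comp g a y)).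

Lemma metric_det_gt0 g a y : cod a y -> 0 < \det (metric_comp g a y).
Proof. by move=> ay; apply: posdef_det_gt0; exact: metric_posdefE. Qed.

Lemma volume_density_C1 g a : C1_on (cod a) (volume_density g a).
Proof.
have oc : open (cod a) by exact: open_cod.
apply: (C1_sqrt oc); first exact: metric_det_gt0.
by apply: (C1_det oc) => i j; apply: C2_C1; exact: metric_C2.
Qed.

Lemma volume_density_continuous g a y : cod a y -> {for y, continuous (volume_density g a)}.
Proof. exact: C1_continuous (volume_density_C1 g a). Qed.

Section given_volume.
Variables (g : C2_metric A) (mu : {measure set (@borel M) -> \bar R}).
Hypothesis gmu : is_riemannian_volume g mu.

Lemma integral_chart a (F : M -> R) (Floc : 'rV[R]_n -> R) :
  measurable_fun [set: @borel M] F ->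
  (forall x, ~ dom a x -> F x = 0) -> (forall x, dom a x -> F x = Floc (chart a x)) ->
  (\int[mu]_x (F x)%:E =
   \int[lebesgue_tuple n]_t
     (Floc (row t) * (volume_density g a (row t) * \1_(cod a) (row t)))%:E)%E.
Proof.
move=> mF F0 FE.
have mw : measurable_fun setT (fun t => volume_density g a (row t) * \1_(cod a) (row t)).
  apply: measurable_row_patch; first exact: open_cod.
  exact: volume_density_continuous.
have w0 t : 0 <= volume_density g a (row t) * \1_(cod a) (row t).
  by rewrite mulr_ge0// sqrtr_ge0.
rewrite (@integral_change _ _ _ _ _ mu (lebesgue_tuple n) (dom a) _ _ (measurable_chart_param a) mw w0)//.
  apply: eq_integral => t _; congr EFin; rewrite indicE /chart_param.
  case: ifPn => [|_]; last by rewrite !mulr0.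
  rewrite inE => ta; rewrite FE; last exact: dom_chart_inv.
  by rewrite chart_invK.
(* The image of B under the chart and the preimage of B under [chart_param a] differ only by tuples
   off [cod a], where the weight is 0. *)
move=> B mB Ba; rewrite (gmu mB Ba) [LHS]integral_mkcond [RHS]integral_mkcond.
apply: eq_integral => t _; rewrite !patchE indicE -/(volume_density g a _).
have [ta|ta] := boolP (row t \in cod a); last first.
  rewrite mulr0; have -> : (t \in [set t | (chart a @` B) (row t)]) = false.
    apply/negP; rewrite inE => -[x Bx xt]; move/negP: ta; apply; rewrite inE -xt.
    by exists x => //; exact: Ba.
  by case: ifP.
rewrite mulr1; congr (if _ then _ else _); apply/idP/idP; rewrite !inE /preimage /= /chart_param ta.
  by move=> [x Bx <-]; rewrite chartK//; exact: Ba.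
move=> Bt; exists (chart_inv a (row t)) => //.
by rewrite chart_invK//; move: ta; rewrite inE.
Qed.

Lemma volume_transfer h : exists nu : {measure set (@borel M) -> \bar R}, is_riemannian_volume h nu.
Proof.
pose rloc a y := Num.sqrt (\det (metric_comp h a y) / \det (metric_comp g a y)).
pose rho x := rloc (chart_at A x) (chart (chart_at A x) x).
have rhoE a x : dom a x -> rho x = rloc a (chart a x).
  by move=> ax; rewrite /rho /rloc (det_metric_overlap (dom_chart_at A x) ax).
have crho x : {for x, continuous rho}.
  apply: (continuous_of_charts rhoE) => a y ay.
  have oc : open (cod a) by exact: open_cod.
  apply: sqrt_continuous_at; apply: continuousM.
    by apply: (C1_continuous _ ay); apply: (C1_det oc) => i j; apply: C2_C1; exact: metric_C2.
  apply: continuousV; first by rewrite gt_eqF// metric_det_gt0.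
  by apply: (C1_continuous _ ay); apply: (C1_det oc) => i j; apply: C2_C1; exact: metric_C2.
have mrho := continuous_measurable_borel crho.
have rho0 x : 0 <= rho x by rewrite sqrtr_ge0.
exists (density_measure mu mrho rho0) => a B mB Ba.
have mB1 : measurable_fun [set: @borel M] (\1_B : @borel M -> R) by exact: measurable_indic.
transitivity (\int[mu]_x (rho x * \1_B x)%:E)%E.
  rewrite [LHS]integral_mkcond; apply: eq_integral => x _.
  by rewrite patchE indicE; case: ifP => _; rewrite ?mulr1 ?mulr0.
rewrite (@integral_chart a _ (fun y => rloc a y * \1_(chart a @` B) y)).
- rewrite [RHS]integral_mkcond; apply: eq_integral => t _; rewrite patchE !indicE.
  have -> : (t \in [set t | (chart a @` B) (row t)]) = (row t \in chart a @` B).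
    by apply/idP/idP; rewrite !inE.
  case: ifPn => [|_]; last by rewrite mulr0 mul0r.
  rewrite inE => -[x Bx xt]; have ta : cod a (row t) by rewrite -xt; exists x => //; exact: Ba.
  rewrite mem_set// !mulr1 /rloc /volume_density -sqrtrM.
    by rewrite divfK// gt_eqF// metric_det_gt0.
  by rewrite ltW// divr_gt0// metric_det_gt0.
- exact: measurable_funM.
- by move=> x nax; rewrite indicE memNset ?mulr0// => /Ba.
- move=> x ax; rewrite (rhoE a x ax); congr (_ * _); rewrite !indicE; congr ((nat_of_bool _)%:R).
  apply/esym; apply/idP/idP; rewrite !inE.
    by move=> [z Bz zx]; rewrite -(chartK ax) -zx chartK//; exact: Ba.
  by move=> Bx; exists x.
Qed.

End given_volume.

Lemma riemannian_volumeP g : (exists mu, is_riemannian_volume g mu) ->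
  is_riemannian_volume g (riemannian_volume g).
Proof.
by rewrite /riemannian_volume; case: pselect => // e _; case: cid.
Qed.

Lemma riemannian_volume_mzero g : ~ (exists mu, is_riemannian_volume g mu) ->
  riemannian_volume g = mzero :> {measure set (@borel M) -> \bar R}.
Proof. by rewrite /riemannian_volume; case: pselect. Qed.

Lemma total_scalar_curvature_no_volume g h : ~ (exists mu, is_riemannian_volume g mu) ->
  total_scalar_curvature h = 0%E.
Proof.
move=> ng; rewrite /total_scalar_curvature riemannian_volume_mzero.
  exact: integral_measure_zero.
by move=> [mu hmu]; apply: ng; exact: volume_transfer hmu g.
Qed.

End volume.

(** * Uniform and L2 convergence on a compact set *)

Lemma sqr_le_of_norm_le {R : realDomainType} (x c : R) : `|x| <= c -> x ^+ 2 <= c ^+ 2.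
Proof.
move=> xc; rewrite -[leLHS]real_normK ?num_real// lerXn2r ?nnegrE//.
exact: le_trans xc.
Qed.

Lemma sqrD_le {R : realDomainType} (p q : R) :
  (p + q) ^+ 2 <= 2 * (p ^+ 2 + q ^+ 2).
Proof.
rewrite -subr_ge0 (_ : _ - _ = (p - q) ^+ 2) ?sqr_ge0//.
by ring.
Qed.

(** Expand the squares of a + d b and a - d b. The weight d will make the share of a bounded factor
    small at the expense of a factor that tends to 0. *)
Lemma norm_young {R : realFieldType} (a b d : R) : 0 < d ->
  `|a * b| <= 2^-1 * (d^-1 * a ^+ 2 + d * b ^+ 2).
Proof.
move=> d0; have h s : 0 <= d^-1 * (a + s * d * b) ^+ 2.
  by rewrite mulr_ge0 ?sqr_ge0// invr_ge0 ltW.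
have E s : d^-1 * (a + s * d * b) ^+ 2 =
    d^-1 * a ^+ 2 + 2 * s * (a * b) + s ^+ 2 * (d * b ^+ 2).
  by field; rewrite gt_eqF.
have h1 := h 1; have h2 := h (-1); rewrite !E sqrrN expr1n !mul1r in h1 h2.
by rewrite ler_norml; apply/andP; split; lra.
Qed.

Section compact_integral.
Context {R : realType} {n : nat}.
Variables (D K : set 'rV[R]_n).
Hypotheses (oD : open D) (cK : compact K) (KD : K `<=` D).
Implicit Types (f g u v : 'rV[R]_n -> R) (us vs : nat -> 'rV[R]_n -> R).
Local Notation row := (@row_of_tuple R n).

Definition continuous_on f := forall y, D y -> {for y, continuous f}.

Definition compact_integral f : R :=
  Rintegral (lebesgue_tuple n) (row @^-1` K) (f \o row).
Local Notation I := compact_integral.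

Let clK : closed K. Proof. by apply: compact_closed => //; exact: norm_hausdorff. Qed.

Lemma measurable_row_compact : measurable (row @^-1` K).
Proof.
rewrite -[K]setCK -preimage_setC; apply: measurableC.
by apply: measurable_row_of_tuple; rewrite openC.
Qed.

Lemma lebesgue_row_compact_lty : (lebesgue_tuple n (row @^-1` K) < +oo)%E.
Proof.
have [M M0 HM] := compact_rV_norm_le cK.
apply: le_lt_trans (lebesgue_tuple_box_lty n M).
apply: le_measure; rewrite ?inE.
- exact: measurable_row_compact.
- exact: measurable_tuple_box.
- by move=> t /= /HM h j; have := h j; rewrite mxE.
Qed.

Lemma continuous_on_integrable f : continuous_on f ->
  (lebesgue_tuple n).-integrable (row @^-1` K) (EFin \o (f \o row)).
Proof.
move=> cf; apply: measurable_bounded_integrable.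
- exact: measurable_row_compact.
- exact: lebesgue_row_compact_lty.
- apply: (@measurable_funS _ _ _ _ (row @^-1` D)).
  + by apply: measurable_row_of_tuple.
  + by move=> t /= /KD.
  + exact: measurable_fun_row.
- have [C C0 HC] := compact_continuous_bounded cK (fun y Ky => cf y (KD Ky)).
  exists C; split; first exact: num_real.
  by move=> x Cx t /= Kt; rewrite (le_trans (HC _ Kt))// ltW.
Qed.

Lemma continuous_onD f g : continuous_on f -> continuous_on g ->
  continuous_on (fun y => f y + g y).
Proof. by move=> cf cg y Dy; apply: continuousD; [exact: cf|exact: cg]. Qed.

Lemma continuous_onM f g : continuous_on f -> continuous_on g ->
  continuous_on (fun y => f y * g y).
Proof. by move=> cf cg y Dy; apply: continuousM; [exact: cf|exact: cg]. Qed.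

Lemma continuous_on_cst c : continuous_on (fun=> c).
Proof. by move=> y _; exact: cst_continuous. Qed.

Lemma continuous_onB f g : continuous_on f -> continuous_on g ->
  continuous_on (fun y => f y - g y).
Proof. by move=> cf cg y Dy; apply: continuousB; [exact: cf|exact: cg]. Qed.

Lemma continuous_onX f k : continuous_on f -> continuous_on (fun y => f y ^+ k).
Proof.
move=> cf y Dy; apply: (@continuous_comp _ _ _ f (fun x => x ^+ k)); first exact: cf.
exact: exprn_continuous.
Qed.

Lemma compact_integralD f g : continuous_on f -> continuous_on g ->
  I (fun y => f y + g y) = I f + I g.
Proof.
move=> cf cg; apply: RintegralD; first exact: measurable_row_compact.
  exact: continuous_on_integrable.
exact: continuous_on_integrable.
Qed.

Lemma compact_integralZ c f : continuous_on f -> I (fun y => c * f y) = c * I f.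
Proof.
move=> cf; apply: RintegralZl; first exact: measurable_row_compact.
exact: continuous_on_integrable.
Qed.

Lemma compact_integralB f g : continuous_on f -> continuous_on g ->
  I (fun y => f y - g y) = I f - I g.
Proof.
move=> cf cg; have -> : (fun y => f y - g y) = (fun y => f y + (-1) * g y).
  by apply/funext => y; rewrite mulN1r.
rewrite compact_integralD// ?compact_integralZ// ?mulN1r//.
by apply: continuous_onM => //; exact: continuous_on_cst.
Qed.

Lemma le_compact_integral f g : continuous_on f -> continuous_on g ->
  (forall y, K y -> f y <= g y) -> I f <= I g.
Proof.
move=> cf cg fg; apply: le_Rintegral; first exact: measurable_row_compact.
- exact: continuous_on_integrable.
- exact: continuous_on_integrable.
- by move=> t /= /fg.
Qed.

Lemma eq_compact_integral f g : (forall y, K y -> f y = g y) -> I f = I g.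
Proof. by move=> fg; apply: eq_Rintegral => t; rewrite inE => /fg. Qed.

Lemma compact_integral_ge0 f : (forall y, K y -> 0 <= f y) -> 0 <= I f.
Proof. by move=> f0; apply: Rintegral_ge0 => t /f0. Qed.

Lemma norm_compact_integral_le f g : continuous_on f -> continuous_on g ->
  (forall y, K y -> `|f y| <= g y) -> `|I f| <= I g.
Proof.
move=> cf cg fg; rewrite ler_norml; apply/andP; split.
  rewrite lerNl -mulN1r -compact_integralZ//; apply: le_compact_integral => //.
    by apply: continuous_onM => //; exact: continuous_on_cst.
  by move=> y /fg; rewrite ler_norml mulN1r lerNl => /andP[].
by apply: le_compact_integral => // y /fg; rewrite ler_norml => /andP[].
Qed.

(** Extended by zero from D, f is C^1 on the whole space: D and the complement of K are open and
    cover it, and the extension is f on the first and 0 on the second. *)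
Lemma compact_integral_partial_eq0 f j : C1_on D f ->
  (forall y, D y -> ~ K y -> f y = 0) -> I (partial j f) = 0.
Proof.
move=> Cf f0; pose F y := f y * \1_K y.
have FD y : D y -> F y = f y.
  move=> Dy; rewrite /F indicE; have [Ky|Ky] := pselect (K y).
    by rewrite mem_set// mulr1.
  by rewrite f0// mul0r.
have FK y : ~ K y -> F y = 0 by move=> Ky; rewrite /F indicE memNset// mulr0.
have nearD y : D y -> \forall z \near y, f z = F z.
  move=> Dy; have : \forall z \near y, D z by exact: open_nbhs_nbhs.
  by apply: filterS => z Dz; rewrite FD.
have nearK y : ~ K y -> \forall z \near y, 0 = F z.
  move=> Ky; have : \forall z \near y, (~` K) z.
    by apply: open_nbhs_nbhs; split=> //; rewrite openC.
  by apply: filterS => z Kz; rewrite FK.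
have dF y : differentiable F y.
  have [Ky|Ky] := pselect (K y).
    exact: near_eq_differentiable (nearD _ (KD Ky)) (C1_differentiable Cf (KD Ky)).
  exact: near_eq_differentiable (nearK _ Ky) (differentiable_cst _ _).
have pFD y : D y -> partial j f y = partial j F y.
  by move=> Dy; apply: near_eq_partial; exact: nearD.
have pFK y : ~ K y -> 0 = partial j F y.
  by move=> Ky; rewrite -(@partial_cst R n 0 j y); apply: near_eq_partial; exact: nearK.
have cF y : {for y, continuous (partial j F)}.
  have [Ky|Ky] := pselect (K y).
    have nD : \forall z \near y, D z by apply: open_nbhs_nbhs; split=> //; exact: KD.
    apply: (@near_eq_continuous_at _ _ (partial j f)); last exact: C1_partial_continuous Cf (KD Ky).
    by apply: filterS nD => z; exact: pFD.
  have nK : \forall z \near y, (~` K) z.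
    by apply: open_nbhs_nbhs; split=> //; rewrite openC.
  apply: (@near_eq_continuous_at _ _ (cst 0)); last exact: cst_continuous.
  by apply: filterS nK => z; exact: pFK.
have := integral_partial_eq0 dF cF cK FK.
rewrite /compact_integral /Rintegral => H.
rewrite -[RHS]/(fine 0%E) -H [in RHS]integral_mkcond; congr fine.
rewrite integral_mkcond; apply: eq_integral => t _; rewrite !patchE in_setT.
case: ifPn => [|/negP]; rewrite inE => Kt /=; first by rewrite pFD//; exact: KD.
by rewrite -pFK.
Qed.

Lemma compact_integral_by_parts f g j : C1_on D f -> C1_on D g ->
  (forall y, D y -> ~ K y -> f y = 0) ->
  I (fun y => f y * partial j g y) = - I (fun y => partial j f y * g y).
Proof.
move=> Cf Cg f0; apply/eqP; rewrite -addr_eq0 -compact_integralD.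
- rewrite -(@compact_integral_partial_eq0 (fun y => f y * g y) j).
  + apply/eqP/eq_compact_integral => y Ky; rewrite partialM.
    * by rewrite addrC.
    * exact: C1_differentiable Cf (KD Ky).
    * exact: C1_differentiable Cg (KD Ky).
  + exact: C1M.
  + by move=> y Dy nKy; rewrite f0// mul0r.
- apply: continuous_onM => y Dy; first exact: C1_continuous Cf Dy.
  exact: C1_partial_continuous Cg Dy.
- apply: continuous_onM => y Dy; last exact: C1_continuous Cg Dy.
  exact: C1_partial_continuous Cf Dy.
Qed.

(** Each mode of convergence on K carries continuity on D, which makes every integral over K finite
    and is preserved by the algebraic operations. *)
Definition unif_cvg us u := [/\ forall i, continuous_on (us i), continuous_on u &
  forall e : R, 0 < e -> \forall i \near \oo, forall y, K y -> `|us i y - u y| <= e].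

Definition L2_cvg us u := [/\ forall i, continuous_on (us i), continuous_on u &
  forall e : R, 0 < e -> \forall i \near \oo, I (fun y => (us i y - u y) ^+ 2) <= e].

Definition C0W12_cvg us u := [/\ forall i, C1_on D (us i), C1_on D u, unif_cvg us u &
  forall j, L2_cvg (fun i => partial j (us i)) (partial j u)].

Definition integral_cvg us u := [/\ forall i, continuous_on (us i), continuous_on u &
  forall e : R, 0 < e -> \forall i \near \oo, `|I (us i) - I u| <= e].

Let bounded_on f : continuous_on f -> exists2 C : R, 0 < C & forall y, K y -> `|f y| <= C.
Proof.
move=> cf; have [C C0 HC] := compact_continuous_bounded cK (fun y Ky => cf y (KD Ky)).
exists (C + 1); first by rewrite ltr_wpDl.
by move=> y /HC; move/le_trans; apply; rewrite lerDl.
Qed.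

Lemma unif_cvg_cst f : continuous_on f -> unif_cvg (fun=> f) f.
Proof.
move=> cf; split=> // e e0; apply: nearW => i y _.
by rewrite subrr normr0 ltW.
Qed.

Lemma unif_cvgD us u vs v : unif_cvg us u -> unif_cvg vs v ->
  unif_cvg (fun i y => us i y + vs i y) (fun y => u y + v y).
Proof.
move=> [cus cu hu] [cvs cv hv]; split.
- by move=> i; exact: continuous_onD.
- exact: continuous_onD.
- move=> e e0; have e20 : 0 < e / 2 by rewrite divr_gt0.
  apply: filterS2 (hu _ e20) (hv _ e20) => i hui hvi y Ky.
  rewrite opprD addrACA (le_trans (ler_normD _ _))// [leRHS]splitr lerD//.
    exact: hui.
  exact: hvi.
Qed.

Lemma unif_cvg_bounded us u : unif_cvg us u ->
  exists2 C : R, 0 < C & \forall i \near \oo, forall y, K y -> `|us i y| <= C.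
Proof.
move=> [_ cu hu]; have [C C0 HC] := bounded_on cu.
exists (C + 1); first by rewrite addr_gt0.
apply: filterS (hu 1 ltr01) => i hui y Ky.
rewrite -[us i y](subrK (u y)) (le_trans (ler_normD _ _))// addrC lerD//.
  exact: HC.
exact: hui.
Qed.

Lemma unif_cvgM us u vs v : unif_cvg us u -> unif_cvg vs v ->
  unif_cvg (fun i y => us i y * vs i y) (fun y => u y * v y).
Proof.
move=> hus hvs; have [C C0 HC] := unif_cvg_bounded hus.
move: hus hvs => [cus cu hu] [cvs cv hv]; have [B B0 HB] := bounded_on cv.
split.
- by move=> i; exact: continuous_onM.
- exact: continuous_onM.
- move=> e e0.
  have e1 : 0 < e / 2 / C by rewrite !divr_gt0.
  have e2 : 0 < e / 2 / B by rewrite !divr_gt0.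
  apply: filterS3 HC (hv _ e1) (hu _ e2) => i hC hvi hui y Ky.
  have -> : us i y * vs i y - u y * v y = us i y * (vs i y - v y) + (us i y - u y) * v y.
    by ring.
  rewrite (le_trans (ler_normD _ _))// !normrM [leRHS]splitr lerD//.
    rewrite -[e / 2](divfK (lt0r_neq0 C0)) [leRHS]mulrC.
    by rewrite ler_pM//; [exact: hC|exact: hvi].
  rewrite -[e / 2](divfK (lt0r_neq0 B0)).
  by rewrite ler_pM//; [exact: hui|exact: HB].
Qed.

(** A Lipschitz bound near the values of u suffices; this covers the inverse and the square root,
    which are not Lipschitz near 0. *)
Lemma unif_cvg_comp (h : R -> R) us u : unif_cvg us u ->
  (forall i, continuous_on (fun y => h (us i y))) -> continuous_on (fun y => h (u y)) ->
  (exists C : R, exists d : R, [/\ 0 < C, 0 < d & forall i y, K y ->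
     `|us i y - u y| <= d -> `|h (us i y) - h (u y)| <= C * `|us i y - u y|]) ->
  unif_cvg (fun i y => h (us i y)) (fun y => h (u y)).
Proof.
move=> [cus cu hu] chs ch [C [d [C0 d0 HC]]]; split=> // e e0.
have eC : 0 < e / C by rewrite divr_gt0.
apply: filterS2 (hu _ d0) (hu _ eC) => i hd hC y Ky.
rewrite (le_trans (HC i y Ky (hd y Ky)))// mulrC -ler_pdivlMr//.
exact: hC.
Qed.

Lemma L2_cvg_eq us u vs v : (forall i y, D y -> us i y = vs i y) ->
  (forall y, D y -> u y = v y) -> L2_cvg us u -> L2_cvg vs v.
Proof.
move=> uvs uv [cus cu hu].
have ceq f g : (forall y, D y -> f y = g y) -> continuous_on f -> continuous_on g.
  move=> fg cf y Dy; apply: near_eq_continuous_at (cf y Dy).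
  have nD : \forall z \near y, D z by exact: open_nbhs_nbhs.
  by apply: filterS nD => z; exact: fg.
split; [by move=> i; exact: ceq (uvs i) (cus i)|exact: ceq uv cu|].
move=> e /hu; apply: filterS => i; apply: le_trans.
by rewrite le_eqVlt; apply/orP; left; apply/eqP/eq_compact_integral => y /KD Dy;
  rewrite uvs// uv.
Qed.

Lemma unif_L2_cvg us u : unif_cvg us u -> L2_cvg us u.
Proof.
move=> [cus cu hu]; split=> // e e0.
pose V := I (fun=> 1).
have V0 : 0 <= V by apply: compact_integral_ge0.
(* Chosen so that d^2 V <= e; the 1 guards against V = 0. *)
pose d := Num.sqrt (e / (1 + V)).
have d0 : 0 < d by rewrite sqrtr_gt0 divr_gt0// ltr_pwDl.
apply: filterS (hu _ d0) => i hui.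
rewrite (@le_trans _ _ (I (fun=> d ^+ 2 * 1)))//.
  apply: le_compact_integral.
  - by apply: continuous_onX; exact: continuous_onB.
  - exact: continuous_on_cst.
  - move=> y Ky; rewrite mulr1; apply: sqr_le_of_norm_le; exact: hui.
rewrite compact_integralZ; last exact: continuous_on_cst.
rewrite -/V sqr_sqrtr; last by rewrite divr_ge0 ?addr_ge0 ?(ltW e0).
by rewrite mulrAC ler_pdivrMr ?ltr_pwDl// ler_pM2l// lerDr.
Qed.

Lemma L2_cvgD us u vs v : L2_cvg us u -> L2_cvg vs v ->
  L2_cvg (fun i y => us i y + vs i y) (fun y => u y + v y).
Proof.
move=> [cus cu hu] [cvs cv hv]; split.
- by move=> i; exact: continuous_onD.
- exact: continuous_onD.
- move=> e e0; have e40 : 0 < e / 4 by rewrite divr_gt0.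
  apply: filterS2 (hu _ e40) (hv _ e40) => i hui hvi.
  have c1 : continuous_on (fun y => (us i y - u y) ^+ 2).
    by apply: continuous_onX; exact: continuous_onB.
  have c2 : continuous_on (fun y => (vs i y - v y) ^+ 2).
    by apply: continuous_onX; exact: continuous_onB.
  rewrite (@le_trans _ _ (I (fun y => 2 * ((us i y - u y) ^+ 2 + (vs i y - v y) ^+ 2))))//.
    apply: le_compact_integral.
    + by apply: continuous_onX; apply: continuous_onB; exact: continuous_onD.
    + by apply: continuous_onM; [exact: continuous_on_cst|exact: continuous_onD].
    + by move=> y _; rewrite opprD addrACA sqrD_le.
  rewrite compact_integralZ; last exact: continuous_onD.
  by rewrite compact_integralD//; lra.
Qed.

(** The difference splits as us (vs - v) + (us - u) v: an eventual uniform bound [C] on us controls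
    the first term, the bound [B] on the continuous limit v the second. *)
Lemma unif_L2_cvgM us u vs v : unif_cvg us u -> L2_cvg vs v ->
  L2_cvg (fun i y => us i y * vs i y) (fun y => u y * v y).
Proof.
move=> hus [cvs cv hv]; have [C C0 HC] := unif_cvg_bounded hus.
move: hus => [cus cu hu]; have [B B0 HB] := bounded_on cv.
split.
- by move=> i; exact: continuous_onM.
- exact: continuous_onM.
- move=> e e0; pose V := I (fun=> 1).
  have V0 : 0 <= V by apply: compact_integral_ge0.
  (* With the factor 2 from [sqrD_le], this threshold and [d] below leave at most e / 2 for each of
     the two terms. *)
  have e1 : 0 < e / (4 * C ^+ 2) by rewrite divr_gt0// mulr_gt0// exprn_gt0.
  pose d := Num.sqrt (e / (4 * B ^+ 2 * (1 + V))).
  have q0 : 0 < 4 * B ^+ 2 * (1 + V) by rewrite !mulr_gt0 ?exprn_gt0// ltr_pwDl.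
  have d0 : 0 < d by rewrite sqrtr_gt0 divr_gt0.
  have d2 : d ^+ 2 = e / (4 * B ^+ 2 * (1 + V)) by rewrite sqr_sqrtr// ltW// divr_gt0.
  apply: filterS3 HC (hv _ e1) (hu _ d0) => i hC hvi hui.
  have c2 : continuous_on (fun y => (vs i y - v y) ^+ 2).
    by apply: continuous_onX; exact: continuous_onB.
  rewrite (@le_trans _ _ (I (fun y => 2 * C ^+ 2 * (vs i y - v y) ^+ 2 + 2 * d ^+ 2 * B ^+ 2 * 1)))//.
    apply: le_compact_integral.
    + by apply: continuous_onX; apply: continuous_onB; exact: continuous_onM.
    + apply: continuous_onD; last exact: continuous_on_cst.
      by apply: continuous_onM => //; exact: continuous_on_cst.
    + move=> y Ky.
      have -> : us i y * vs i y - u y * v y = us i y * (vs i y - v y) + (us i y - u y) * v y.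
        by ring.
      have h1 : us i y ^+ 2 <= C ^+ 2.
        by apply: sqr_le_of_norm_le; exact: hC.
      have h2 : (us i y - u y) ^+ 2 <= d ^+ 2.
        by apply: sqr_le_of_norm_le; exact: hui.
      have h3 : v y ^+ 2 <= B ^+ 2.
        by apply: sqr_le_of_norm_le; exact: HB.
      set X := us i y * _; set Y := (us i y - u y) * _.
      rewrite (@le_trans _ _ (2 * X ^+ 2 + 2 * Y ^+ 2))// -?mulrDr ?sqrD_le//.
      rewrite mulrDr.
      rewrite mulr1 -2!mulrA lerD// ler_pM2l// /X /Y exprMn ?ler_wpM2r ?sqr_ge0//.
      by rewrite ler_pM// sqr_ge0.
  rewrite compact_integralD ?compact_integralZ//; last 3 first.
  - exact: continuous_on_cst.
  - by apply: continuous_onM => //; exact: continuous_on_cst.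
  - exact: continuous_on_cst.
  rewrite -/V d2 [leRHS]splitr lerD//.
    rewrite (@le_trans _ _ (2 * C ^+ 2 * (e / (4 * C ^+ 2))))//.
      by rewrite ler_pM2l// mulr_gt0// exprn_gt0.
    by rewrite le_eqVlt; apply/orP; left; apply/eqP; field; rewrite gt_eqF.
  rewrite (@le_trans _ _ (2 * (e / (4 * B ^+ 2 * (1 + V))) * B ^+ 2 * (1 + V)))//.
    have z0 : 0 < 2 * (e / (4 * B ^+ 2 * (1 + V))) * B ^+ 2.
      by rewrite mulr_gt0 ?exprn_gt0// mulr_gt0// divr_gt0.
    by rewrite ler_pM2l// lerDr.
  by rewrite le_eqVlt; apply/orP; left; apply/eqP; field; rewrite !gt_eqF// ltr_pwDl.
Qed.

(** With p = us - u and q = vs - v, the difference of products is p q + p v + u q. The weighted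
    Young inequality takes the place of Cauchy-Schwarz for the two mixed terms. *)
Lemma L2_cvg_mul us u vs v : L2_cvg us u -> L2_cvg vs v ->
  integral_cvg (fun i y => us i y * vs i y) (fun y => u y * v y).
Proof.
move=> [cus cu hu] [cvs cv hv]; split.
- by move=> i; exact: continuous_onM.
- exact: continuous_onM.
- move=> e e0.
  have cu2 : continuous_on (fun y => u y ^+ 2) by exact: continuous_onX.
  have cv2 : continuous_on (fun y => v y ^+ 2) by exact: continuous_onX.
  pose N := I (fun y => u y ^+ 2) + I (fun y => v y ^+ 2).
  have N0 : 0 <= N by rewrite addr_ge0//; apply: compact_integral_ge0 => y _; exact: sqr_ge0.
  (* The weight [d] leaves at most e / 2 from the integrals of u^2 and v^2; [c] collects the
     coefficients of p^2 and q^2, whose integrals are then made smaller than e / (2 c). *)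
  pose d := e / (1 + N).
  have d0 : 0 < d by rewrite divr_gt0// ltr_pwDl.
  pose c := 1 + d^-1.
  have c0 : 0 < c by rewrite addr_gt0// invr_gt0.
  have e1 : 0 < e / (2 * c) by rewrite divr_gt0// mulr_gt0.
  apply: filterS2 (hu _ e1) (hv _ e1) => i hui hvi.
  have c1 : continuous_on (fun y => (us i y - u y) ^+ 2).
    by apply: continuous_onX; exact: continuous_onB.
  have c2 : continuous_on (fun y => (vs i y - v y) ^+ 2).
    by apply: continuous_onX; exact: continuous_onB.
  have c3 := continuous_onD c1 c2.
  have c4 := continuous_onD cu2 cv2.
  have cc := continuous_on_cst.
  rewrite -compact_integralB; [|exact: continuous_onM|exact: continuous_onM].
  rewrite (@le_trans _ _ (I (fun y => 2^-1 * c * ((us i y - u y) ^+ 2 + (vs i y - v y) ^+ 2)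
     + 2^-1 * d * (u y ^+ 2 + v y ^+ 2))))//.
    apply: norm_compact_integral_le.
    + by apply: continuous_onB; exact: continuous_onM.
    + by apply: continuous_onD; apply: continuous_onM.
    + move=> y _; set p := us i y - u y; set q := vs i y - v y.
      have -> : us i y * vs i y - u y * v y = p * q + p * v y + u y * q.
        by rewrite /p /q; ring.
      rewrite (le_trans (ler_normD _ _))// (le_trans (lerD (ler_normD _ _) (lexx _)))//.
      have pq : `|p * q| <= 2^-1 * (p ^+ 2 + q ^+ 2).
        by have := norm_young p q ltr01; rewrite invr1 !mul1r.
      have y1 := norm_young p (v y) d0; have y2 := norm_young q (u y) d0.
      rewrite [u y * q]mulrC (le_trans (lerD (lerD pq y1) y2))//.
      by rewrite /c le_eqVlt; apply/orP; left; apply/eqP; ring.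
  rewrite compact_integralD ?compact_integralZ ?compact_integralD -/N//; try exact: continuous_onM.
  have cE : 2^-1 * c * (e / (2 * c) + e / (2 * c)) = e / 2 by field; rewrite gt_eqF.
  have dE : 2^-1 * d * (1 + N) = e / 2.
    by rewrite /d; field; rewrite gt_eqF// ltr_pwDl.
  rewrite [e]splitr -{1}cE -dE lerD//; last by rewrite ler_pM2l ?lerDr// mulr_gt0.
  by rewrite ler_pM2l ?mulr_gt0// lerD.
Qed.

Lemma L2_cvg_cst0 : L2_cvg (fun _ _ => 0) (fun=> 0).
Proof. by apply: unif_L2_cvg; apply: unif_cvg_cst; exact: continuous_on_cst. Qed.

Lemma L2_cvg_sum (T : Type) (r : seq T) (us : T -> nat -> 'rV[R]_n -> R)
    (u : T -> 'rV[R]_n -> R) :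
  (forall a, L2_cvg (us a) (u a)) ->
  L2_cvg (fun i y => \sum_(a <- r) us a i y) (fun y => \sum_(a <- r) u a y).
Proof.
move=> h; elim: r => [|a r ih].
  by apply: L2_cvg_eq L2_cvg_cst0 => [i y _|y _]; rewrite big_nil.
by apply: L2_cvg_eq (L2_cvgD (h a) ih) => [i y _|y _]; rewrite big_cons.
Qed.

Lemma integral_cvg_eq us u vs v : (forall i y, D y -> us i y = vs i y) ->
  (forall y, D y -> u y = v y) -> integral_cvg us u -> integral_cvg vs v.
Proof.
move=> uvs uv [cus cu hu].
have ceq f g : (forall y, D y -> f y = g y) -> continuous_on f -> continuous_on g.
  move=> fg cf y Dy; apply: near_eq_continuous_at (cf y Dy).
  have nD : \forall z \near y, D z by exact: open_nbhs_nbhs.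
  by apply: filterS nD => z; exact: fg.
split; [by move=> i; exact: ceq (uvs i) (cus i)|exact: ceq uv cu|].
move=> e /hu; apply: filterS => i; apply: le_trans.
rewrite (@eq_compact_integral (vs i) (us i)) => [|y /KD Dy]; last by rewrite uvs.
by rewrite (@eq_compact_integral v u) => [|y /KD Dy]//; rewrite uv.
Qed.

Lemma integral_cvgD us u vs v : integral_cvg us u -> integral_cvg vs v ->
  integral_cvg (fun i y => us i y + vs i y) (fun y => u y + v y).
Proof.
move=> [cus cu hu] [cvs cv hv]; split.
- by move=> i; exact: continuous_onD.
- exact: continuous_onD.
- move=> e e0; have e20 : 0 < e / 2 by rewrite divr_gt0.
  apply: filterS2 (hu _ e20) (hv _ e20) => i hui hvi.
  rewrite !compact_integralD// opprD addrACA (le_trans (ler_normD _ _))//.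
  by rewrite [leRHS]splitr lerD.
Qed.

Lemma integral_cvg_sum (T : Type) (r : seq T) (us : T -> nat -> 'rV[R]_n -> R)
    (u : T -> 'rV[R]_n -> R) :
  (forall a, integral_cvg (us a) (u a)) ->
  integral_cvg (fun i y => \sum_(a <- r) us a i y) (fun y => \sum_(a <- r) u a y).
Proof.
move=> h; elim: r => [|a r ih].
  apply: (@integral_cvg_eq (fun _ _ => 0) (fun=> 0)) => [i y _|y _|].
  - by rewrite big_nil.
  - by rewrite big_nil.
  - split=> [i||e e0]; try exact: continuous_on_cst.
    by apply: nearW => i; rewrite subrr normr0 ltW.
by apply: integral_cvg_eq (integral_cvgD (h a) ih) => [i y _|y _]; rewrite big_cons.
Qed.

Lemma unif_cvgV us u : unif_cvg us u ->
  (forall i y, D y -> us i y != 0) -> (forall y, D y -> u y != 0) ->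
  unif_cvg (fun i y => (us i y)^-1) (fun y => (u y)^-1).
Proof.
move=> hus us0 u0; have [cus cu _] := hus.
have cV f : continuous_on f -> (forall y, D y -> f y != 0) ->
    continuous_on (fun y => (f y)^-1).
  by move=> cf f0 y Dy; apply: continuousV; [exact: f0|exact: cf].
have [B B0 HB] := bounded_on (cV _ cu u0).
apply: (unif_cvg_comp (h := fun t => t^-1)) => //.
- by move=> i; apply: cV => //; exact: us0.
- exact: cV.
(* On K the limit is at least 1 / B in absolute value, so a perturbation by at most 1 / (2 B) stays
   at least 1 / (2 B); the two inverses contribute 2 B and B. *)
exists (2 * B ^+ 2), (2 * B)^-1; split; [by rewrite mulr_gt0// exprn_gt0|by rewrite invr_gt0 mulr_gt0|].
move=> i y Ky hd; have Dy := KD Ky.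
have a0 := us0 i y Dy; have b0 := u0 y Dy.
set a := us i y in hd a0 *; set b := u y in hd b0 *.
have -> : a^-1 - b^-1 = (b - a) * a^-1 * b^-1 by field; rewrite a0 b0.
have hb : `|b^-1| <= B by exact: HB.
have ha : `|a^-1| <= 2 * B.
  rewrite normfV invf_ple ?posrE ?normr_gt0 ?mulr_gt0//.
  have : B^-1 <= `|b|.
    by rewrite invf_ple ?posrE ?normr_gt0// -normfV.
  move=> hb'; have : `|b| <= `|a - b| + `|a|.
    by rewrite -{1}(subrK a b) (le_trans (ler_normD _ _))// distrC.
  move: hd; rewrite invfM => hd hab.
  have : B^-1 = 2^-1 * B^-1 + 2^-1 * B^-1 by field; rewrite gt_eqF.
  by lra.
have -> : 2 * B ^+ 2 * `|a - b| = `|a - b| * (2 * B) * B by ring.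
by rewrite !normrM distrC ler_pM ?mulr_ge0// ler_wpM2l.
Qed.

Lemma unif_cvg_sqrt us u : unif_cvg us u ->
  (forall i y, D y -> 0 < us i y) -> (forall y, D y -> 0 < u y) ->
  unif_cvg (fun i y => Num.sqrt (us i y)) (fun y => Num.sqrt (u y)).
Proof.
move=> hus us0 u0; have [cus cu _] := hus.
have cS f : continuous_on f -> continuous_on (fun y => Num.sqrt (f y)).
  move=> cf y Dy; apply: (@continuous_comp _ _ _ f (@Num.sqrt R)); first exact: cf.
  exact: sqrt_continuous.
have cV : continuous_on (fun y => (Num.sqrt (u y))^-1).
  move=> y Dy; apply: continuousV; last exact: cS.
  by rewrite gt_eqF// sqrtr_gt0 u0.
have [B B0 HB] := bounded_on cV.
apply: (unif_cvg_comp (h := Num.sqrt)) => //; [by move=> i; exact: cS|exact: cS|].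
(* Dividing a - b by the sum of the square roots costs at most [B], the bound on the inverse square
   root of the limit. This holds without closeness, so the radius 1 is arbitrary. *)
exists B, 1; split=> // i y Ky _; have Dy := KD Ky.
have a0 := us0 i y Dy; have b0 := u0 y Dy.
set a := us i y in a0 *; set b := u y in b0 *.
have sa := sqr_sqrtr (ltW a0); have sb := sqr_sqrtr (ltW b0).
have pa : 0 < Num.sqrt a by rewrite sqrtr_gt0.
have pb : 0 < Num.sqrt b by rewrite sqrtr_gt0.
have hb : (Num.sqrt b)^-1 <= B by apply: le_trans (HB y Ky); exact: ler_norm.
have E : (Num.sqrt a - Num.sqrt b) * (Num.sqrt a + Num.sqrt b) = a - b.
  by transitivity (Num.sqrt a ^+ 2 - Num.sqrt b ^+ 2); [ring|rewrite sa sb].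
rewrite -E normrM mulrCA ler_peMr//.
rewrite (@le_trans _ _ (B * Num.sqrt b))//.
  by rewrite -ler_pdivrMr// mul1r.
by rewrite ler_pM2l// (le_trans _ (ler_norm _))// lerDr ltW.
Qed.

(** * The algebra of uniform convergence with L^2 convergence of first derivatives *)

Lemma C0W12_cst f : C1_on D f -> C0W12_cvg (fun=> f) f.
Proof.
move=> Cf; split; [by move=> _|exact: Cf| |].
  by apply: unif_cvg_cst => y; exact: C1_continuous Cf.
by move=> j; apply: unif_L2_cvg; apply: unif_cvg_cst => y; exact: C1_partial_continuous.
Qed.

Lemma C0W12D us u vs v : C0W12_cvg us u -> C0W12_cvg vs v ->
  C0W12_cvg (fun i y => us i y + vs i y) (fun y => u y + v y).
Proof.
move=> [Cus Cu hu du] [Cvs Cv hv dv]; split.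
- by move=> i; exact: (C1D oD (Cus i) (Cvs i)).
- exact: (C1D oD Cu Cv).
- exact: unif_cvgD.
- move=> j; apply: L2_cvg_eq (L2_cvgD (du j) (dv j)) => [i y Dy|y Dy].
    by rewrite partialD//; [exact: C1_differentiable (Cus i) Dy|exact: C1_differentiable (Cvs i) Dy].
  by rewrite partialD//; [exact: C1_differentiable Cu Dy|exact: C1_differentiable Cv Dy].
Qed.

(** In the product rule every term is a uniformly convergent factor times an L^2 convergent
    derivative. *)
Lemma C0W12M us u vs v : C0W12_cvg us u -> C0W12_cvg vs v ->
  C0W12_cvg (fun i y => us i y * vs i y) (fun y => u y * v y).
Proof.
move=> [Cus Cu hu du] [Cvs Cv hv dv]; split.
- by move=> i; exact: (C1M oD (Cus i) (Cvs i)).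
- exact: (C1M oD Cu Cv).
- exact: unif_cvgM.
- move=> j.
  apply: L2_cvg_eq (L2_cvgD (unif_L2_cvgM hv (du j)) (unif_L2_cvgM hu (dv j))) => [i y Dy|y Dy].
    rewrite partialM; [by rewrite [X in X + _]mulrC|exact: C1_differentiable (Cus i) Dy|].
    exact: C1_differentiable (Cvs i) Dy.
  rewrite partialM; [by rewrite [X in X + _]mulrC|exact: C1_differentiable Cu Dy|].
  exact: C1_differentiable Cv Dy.
Qed.

Lemma C0W12_eq us u vs v : (forall i y, D y -> us i y = vs i y) ->
  (forall y, D y -> u y = v y) -> C0W12_cvg us u -> C0W12_cvg vs v.
Proof.
move=> uvs uv [Cus Cu [cus cu hu] du].
have Cvs i : C1_on D (vs i) by exact: (C1_eq oD (uvs i) (Cus i)).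
have Cv : C1_on D v by exact: (C1_eq oD uv Cu).
have peq f g j y : (forall y, D y -> f y = g y) -> D y -> partial j f y = partial j g y.
  move=> fg Dy; apply: near_eq_partial.
  have nD : \forall z \near y, D z by exact: open_nbhs_nbhs.
  by apply: filterS nD => z; exact: fg.
split; [exact: Cvs|exact: Cv| |].
  split; [by move=> i y; exact: C1_continuous (Cvs i)|by move=> y; exact: C1_continuous Cv|].
  move=> e /hu; apply: filterS => i hi y Ky.
  by rewrite -(uvs i y (KD Ky)) -(uv y (KD Ky)) hi.
by move=> j; apply: L2_cvg_eq (du j) => [i y|y] Dy; [exact: peq (uvs i) Dy|exact: peq uv Dy].
Qed.

Lemma C0W12_sum (T : Type) (r : seq T) (us : T -> nat -> 'rV[R]_n -> R)
    (u : T -> 'rV[R]_n -> R) :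
  (forall a, C0W12_cvg (us a) (u a)) ->
  C0W12_cvg (fun i y => \sum_(a <- r) us a i y) (fun y => \sum_(a <- r) u a y).
Proof.
move=> h; elim: r => [|a r ih].
  by apply: C0W12_eq (C0W12_cst (C1_cst oD 0)) => [i y _|y _]; rewrite big_nil.
by apply: C0W12_eq (C0W12D (h a) ih) => [i y _|y _]; rewrite big_cons.
Qed.

Lemma C0W12_prod (T : Type) (r : seq T) (us : T -> nat -> 'rV[R]_n -> R)
    (u : T -> 'rV[R]_n -> R) :
  (forall a, C0W12_cvg (us a) (u a)) ->
  C0W12_cvg (fun i y => \prod_(a <- r) us a i y) (fun y => \prod_(a <- r) u a y).
Proof.
move=> h; elim: r => [|a r ih].
  by apply: C0W12_eq (C0W12_cst (C1_cst oD 1)) => [i y _|y _]; rewrite big_nil.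
by apply: C0W12_eq (C0W12M (h a) ih) => [i y _|y _]; rewrite big_cons.
Qed.

Lemma C0W12V us u : (forall i y, D y -> us i y != 0) -> (forall y, D y -> u y != 0) ->
  C0W12_cvg us u -> C0W12_cvg (fun i y => (us i y)^-1) (fun y => (u y)^-1).
Proof.
move=> us0 u0 [Cus Cu hu du]; have hV := unif_cvgV hu us0 u0.
have pV f j y : C1_on D f -> (forall y, D y -> f y != 0) -> D y ->
    - 1 * ((f y)^-1 * (f y)^-1) * partial j f y = partial j (fun z => (f z)^-1) y.
  move=> Cf f0 Dy; have [h1 h2] := @is_deriveV _ id (f y) 1 1 (f0 y Dy) (is_derive_id _ _).
  have [_ ->] := partial_comp1 j (C1_differentiable Cf Dy) h1.
  by rewrite h2 /GRing.scale/= mulr1 mulN1r -invfM expr2.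
split.
- by move=> i; exact: (C1V oD (us0 i) (Cus i)).
- exact: (C1V oD u0 Cu).
- exact: hV.
- move=> j; have cN : unif_cvg (fun _ _ => -1) (fun=> -1).
    by apply: unif_cvg_cst; exact: continuous_on_cst.
  apply: L2_cvg_eq (unif_L2_cvgM (unif_cvgM cN (unif_cvgM hV hV)) (du j)) => [i y|y] Dy.
    exact: (pV _ _ _ (Cus i) (us0 i) Dy).
  exact: (pV _ _ _ Cu u0 Dy).
Qed.

Lemma C0W12_sqrt us u : (forall i y, D y -> 0 < us i y) -> (forall y, D y -> 0 < u y) ->
  C0W12_cvg us u -> C0W12_cvg (fun i y => Num.sqrt (us i y)) (fun y => Num.sqrt (u y)).
Proof.
move=> us0 u0 [Cus Cu hu du]; have hS := unif_cvg_sqrt hu us0 u0.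
have hV : unif_cvg (fun i y => (Num.sqrt (us i y))^-1) (fun y => (Num.sqrt (u y))^-1).
  apply: unif_cvgV hS _ _ => [i y Dy|y Dy]; rewrite gt_eqF// sqrtr_gt0; [exact: us0|exact: u0].
have pS f j y : C1_on D f -> (forall y, D y -> 0 < f y) -> D y ->
    2^-1 * (Num.sqrt (f y))^-1 * partial j f y = partial j (fun z => Num.sqrt (f z)) y.
  move=> Cf f0 Dy; have [h1 h2] := is_derive1_sqrt (f0 y Dy).
  have [_ ->] := partial_comp1 j (C1_differentiable Cf Dy) h1.
  by rewrite h2 invfM.
split.
- by move=> i; exact: (C1_sqrt oD (us0 i) (Cus i)).
- exact: (C1_sqrt oD u0 Cu).
- exact: hS.
- move=> j; have c2 : unif_cvg (fun _ _ => 2^-1) (fun=> 2^-1).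
    by apply: unif_cvg_cst; exact: continuous_on_cst.
  apply: L2_cvg_eq (unif_L2_cvgM (unif_cvgM c2 hV) (du j)) => [i y|y] Dy.
    exact: (pS _ _ _ (Cus i) (us0 i) Dy).
  exact: (pS _ _ _ Cu u0 Dy).
Qed.

Lemma C0W12_det k (Gs : nat -> 'rV[R]_n -> 'M[R]_k) (G : 'rV[R]_n -> 'M[R]_k) :
  (forall a b, C0W12_cvg (fun i y => Gs i y a b) (fun y => G y a b)) ->
  C0W12_cvg (fun i y => \det (Gs i y)) (fun y => \det (G y)).
Proof.
move=> h; rewrite /determinant; apply: C0W12_sum => s; apply: C0W12M.
  by apply: C0W12_cst; exact: C1_cst.
by apply: C0W12_prod => a; exact: h.
Qed.

Lemma C0W12_invmx k (Gs : nat -> 'rV[R]_n -> 'M[R]_k) (G : 'rV[R]_n -> 'M[R]_k) :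
  (forall i y, D y -> Gs i y \in unitmx) -> (forall y, D y -> G y \in unitmx) ->
  (forall a b, C0W12_cvg (fun i y => Gs i y a b) (fun y => G y a b)) ->
  forall a b, C0W12_cvg (fun i y => invmx (Gs i y) a b) (fun y => invmx (G y) a b).
Proof.
move=> uGs uG h a b.
apply: (@C0W12_eq (fun i y => (\det (Gs i y))^-1 * cofactor (Gs i y) b a)
                  (fun y => (\det (G y))^-1 * cofactor (G y) b a)).
- by move=> i y Dy; rewrite /invmx uGs// !mxE.
- by move=> y Dy; rewrite /invmx uG// !mxE.
- apply: C0W12M.
    apply: C0W12V => [i y /(uGs i)|y /uG|]; [by rewrite unitmxE unitfE|by rewrite unitmxE unitfE|].
    exact: C0W12_det.
  apply: C0W12M; first by apply: C0W12_cst; exact: C1_cst.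
  apply: C0W12_det => c d; apply: C0W12_eq (h (lift b c) (lift a d)) => [i y _|y _];
    by rewrite !mxE.
Qed.

(** Only vs itself converges in L^2, not its derivatives. Integration by parts, done for each i and
    for the limit, puts the derivative on us and leaves a product of two L^2 limits. *)
Lemma integral_cvg_partial us u vs v j : C0W12_cvg us u ->
  (forall i y, D y -> ~ K y -> us i y = 0) -> (forall y, D y -> ~ K y -> u y = 0) ->
  L2_cvg vs v -> (forall i, C1_on D (vs i)) -> C1_on D v ->
  integral_cvg (fun i y => us i y * partial j (vs i) y) (fun y => u y * partial j v y).
Proof.
move=> [Cus Cu hu du] us0 u0 hv Cvs Cv.
have [_ _ h] := L2_cvg_mul (du j) hv.
split.
- move=> i; apply: continuous_onM => y Dy; first exact: C1_continuous (Cus i) Dy.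
  exact: C1_partial_continuous (Cvs i) Dy.
- apply: continuous_onM => y Dy; first exact: C1_continuous Cu Dy.
  exact: C1_partial_continuous Cv Dy.
- move=> e e0; apply: filterS (h e e0) => i.
  rewrite (compact_integral_by_parts j (Cus i) (Cvs i) (us0 i)).
  rewrite (compact_integral_by_parts j Cu Cv u0).
  by rewrite -opprD normrN.
Qed.

End compact_integral.

(** * Local convergence of the scalar curvature *)

Section local_curvature_cvg.
Context {R : realType} {n : nat}.
Variables (D K : set 'rV[R]_n).
Hypotheses (oD : open D) (cK : compact K) (KD : K `<=` D).
Variables (Gs : nat -> 'rV[R]_n -> 'M[R]_n) (G : 'rV[R]_n -> 'M[R]_n).
Hypotheses (pGs : forall i y, D y -> posdef (Gs i y)) (pG : forall y, D y -> posdef (G y))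
  (CGs : forall i a b, Ck_on 2 D (fun y => Gs i y a b))
  (CG : forall a b, Ck_on 2 D (fun y => G y a b))
  (GsG : forall a b, C0W12_cvg D K (fun i y => Gs i y a b) (fun y => G y a b)).

Let uGs i y : D y -> Gs i y \in unitmx. Proof. by move=> Dy; exact: posdef_unitmx (pGs i Dy). Qed.
Let uG y : D y -> G y \in unitmx. Proof. by move=> Dy; exact: posdef_unitmx (pG Dy). Qed.

Let unif_of us u : C0W12_cvg D K us u -> unif_cvg D K us u. Proof. by case. Qed.
Let L2_of us u j : C0W12_cvg D K us u ->
  L2_cvg D K (fun i => partial j (us i)) (partial j u). Proof. by case. Qed.

Let invG a b : C0W12_cvg D K (fun i y => invmx (Gs i y) a b) (fun y => invmx (G y) a b).
Proof. exact: C0W12_invmx. Qed.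

Let unif_m1 : unif_cvg D K (fun _ _ => -1) (fun=> -1).
Proof. by apply: unif_cvg_cst; exact: continuous_on_cst. Qed.

Let L2B us u vs v : L2_cvg D K us u -> L2_cvg D K vs v ->
  L2_cvg D K (fun i y => us i y - vs i y) (fun y => u y - v y).
Proof.
move=> hu hv; have h := L2_cvgD oD cK KD hu (unif_L2_cvgM oD cK KD unif_m1 hv).
by apply: L2_cvg_eq h => // [i y _|y _]; rewrite mulN1r.
Qed.

Lemma christoffel_L2_cvg k a b :
  L2_cvg D K (fun i => christoffel (Gs i) k a b) (christoffel G k a b).
Proof.
rewrite /christoffel; apply: unif_L2_cvgM => //.
  by apply: unif_cvg_cst; exact: continuous_on_cst.
apply: L2_cvg_sum => // l; apply: unif_L2_cvgM => //; first exact: unif_of (invG k l).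
by apply: L2B; [apply: L2_cvgD => //|]; apply: L2_of; exact: GsG.
Qed.

Variable phi : 'rV[R]_n -> R.
Hypotheses (Cphi : C1_on D phi) (phi0 : forall y, D y -> ~ K y -> phi y = 0).

(** The coefficient of the Ricci component (s, v) in the weighted curvature density. It contains no
    derivative of the metric, and [phi] makes it vanish off K, so integration by parts has no
    boundary term. *)
Let W (H : 'rV[R]_n -> 'M[R]_n) s v (y : 'rV[R]_n) : R := phi y * (Num.sqrt (\det (H y)) * invmx (H y) s v).

Let W_cvg s v : C0W12_cvg D K (fun i => W (Gs i) s v) (W G s v).
Proof.
apply: C0W12M => //; first exact: C0W12_cst.
apply: C0W12M => //; apply: C0W12_sqrt => // [i y Dy|y Dy|].
- exact: posdef_det_gt0 (pGs i Dy).
- exact: posdef_det_gt0 (pG Dy).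
- exact: C0W12_det.
Qed.

Let W0 H s v y : D y -> ~ K y -> W H s v y = 0.
Proof. by move=> Dy Ky; rewrite /W phi0// mul0r. Qed.

Let dchr_cvg s v j r a b :
  integral_cvg D K (fun i y => W (Gs i) s v y * partial j (christoffel (Gs i) r a b) y)
    (fun y => W G s v y * partial j (christoffel G r a b) y).
Proof.
apply: integral_cvg_partial => //.
- by move=> i y; exact: W0.
- by move=> y; exact: W0.
- exact: christoffel_L2_cvg.
- by move=> i; apply: (christoffel_C1 oD (@uGs i)); exact: CGs.
- by apply: (christoffel_C1 oD uG); exact: CG.
Qed.

Let chr_chr_cvg s v r a b r' a' b' :
  integral_cvg D K
    (fun i y => W (Gs i) s v y * christoffel (Gs i) r a b y * christoffel (Gs i) r' a' b' y)
    (fun y => W G s v y * christoffel G r a b y * christoffel G r' a' b' y).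
Proof.
apply: L2_cvg_mul => //; last exact: christoffel_L2_cvg.
by apply: unif_L2_cvgM => //; [exact: unif_of (W_cvg s v)|exact: christoffel_L2_cvg].
Qed.

Let integral_cvgN us u : integral_cvg D K us u ->
  integral_cvg D K (fun i y => - us i y) (fun y => - u y).
Proof.
move=> [cus cu hu]; split.
- by move=> i y Dy; apply: continuousN; exact: cus.
- by move=> y Dy; apply: continuousN; exact: cu.
- move=> e /hu; apply: filterS => i.
  have E f : continuous_on D f -> compact_integral K (fun y => - f y) = - compact_integral K f.
    move=> cf; rewrite -mulN1r -(compact_integralZ oD cK KD)//.
    by apply: eq_compact_integral => y _; rewrite mulN1r.
  by rewrite !E// -opprD normrN.
Qed.

Theorem scalar_curvature_integral_cvg :
  integral_cvg D K
    (fun i y => phi y * scalar_curvature_loc (Gs i) y * Num.sqrt (\det (Gs i y)))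
    (fun y => phi y * scalar_curvature_loc G y * Num.sqrt (\det (G y))).
Proof.
(* The integrand, multiplied out until each summand is a coefficient times a derivative of a
   Christoffel symbol or times two Christoffel symbols. *)
pose X H y := \sum_s \sum_v \sum_r
  ((W H s v y * partial r (christoffel H r v s) y +
    - (W H s v y * partial v (christoffel H r r s) y)) +
   \sum_l (W H s v y * christoffel H r r l y * christoffel H l v s y +
     - (W H s v y * christoffel H r v l y * christoffel H l r s y))).
have alg1 (p w i a b S : R) :
    p * w * (i * (a - b + S)) = (p * (w * i) * a - p * (w * i) * b) + p * (w * i) * S.
  by ring.
have alg2 (p a b c d : R) : p * (a * b - c * d) = p * a * b - p * c * d by ring.
have XE H y : X H y = phi y * scalar_curvature_loc H y * Num.sqrt (\det (H y)).
  rewrite /X /scalar_curvature_loc mulrAC mulr_sumr; apply: eq_bigr => s _.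
  rewrite mulr_sumr; apply: eq_bigr => v _.
  rewrite /ricci !mulr_sumr; apply: eq_bigr => r _.
  rewrite /riemann [RHS]alg1; congr (_ + _).
  by rewrite mulr_sumr; apply: eq_bigr => l _; rewrite [RHS]alg2.
apply: (@integral_cvg_eq _ _ D K oD KD (fun i => X (Gs i)) (X G)).
- by move=> i y _; rewrite XE.
- by move=> y _; rewrite XE.
rewrite /X.
apply: integral_cvg_sum => // s; apply: integral_cvg_sum => // v.
apply: integral_cvg_sum => // r.
pose T1 H (y : 'rV[R]_n) := W H s v y * partial r (christoffel H r v s) y.
pose T2 H (y : 'rV[R]_n) := W H s v y * partial v (christoffel H r r s) y.
pose U1 l H (y : 'rV[R]_n) := W H s v y * christoffel H r r l y * christoffel H l v s y.
pose U2 l H (y : 'rV[R]_n) := W H s v y * christoffel H r v l y * christoffel H l r s y.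
have hT : integral_cvg D K (fun i y => T1 (Gs i) y + - T2 (Gs i) y) (fun y => T1 G y + - T2 G y).
  by apply: (integral_cvgD oD cK KD); [exact: dchr_cvg|apply: integral_cvgN; exact: dchr_cvg].
have hU : integral_cvg D K (fun i y => \sum_l (U1 l (Gs i) y + - U2 l (Gs i) y))
    (fun y => \sum_l (U1 l G y + - U2 l G y)).
  apply: integral_cvg_sum => // l.
  by apply: (integral_cvgD oD cK KD); [exact: chr_chr_cvg|apply: integral_cvgN; exact: chr_chr_cvg].
exact: (integral_cvgD oD cK KD hT hU).
Qed.

End local_curvature_cvg.

(** * Partition of unity *)

Lemma C1_on_local {R : realType} {n : nat} (D : set 'rV[R]_n) (f : 'rV[R]_n -> R) :
  (forall y, D y -> exists U, [/\ open U, U y & C1_on U f]) -> C1_on D f.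
Proof.
move=> H; split=> [y Dy|j y Dy]; have [U [oU Uy CU]] := H y Dy.
  exact: C1_differentiable CU Uy.
exact: C1_partial_continuous CU Uy.
Qed.

Lemma C1_coord {R : realType} {n : nat} (D : set 'rV[R]_n) (j : 'I_n) :
  open D -> C1_on D (fun y : 'rV[R]_n => y 0 j).
Proof.
move=> oD.
have cc : continuous (fun y : 'rV[R]_n => y 0 j) by exact: coord_continuous.
have lc : linear (fun y : 'rV[R]_n => y 0 j) by move=> k u v; rewrite [LHS]mxE [in LHS]mxE.
pose cL := GRing.isLinear.Build R 'rV[R]_n R *:%R (fun y : 'rV[R]_n => y 0 j) lc.
pose f : {linear 'rV[R]_n -> R} := HB.pack (fun y : 'rV[R]_n => y 0 j) cL.
have dc (y : 'rV[R]_n) : differentiable (fun y : 'rV[R]_n => y 0 j) y.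
  exact: differentiable_coord.
apply: (C1_onI oD (df := fun i _ => (delta_mx 0 i : 'rV[R]_n) 0 j)) => [y _|i y _|i y _].
- exact: dc.
- by rewrite /partial deriveE// (diff_lin _ (f := f)).
- exact: cst_continuous.
Qed.

(** The squared positive part has a continuous derivative, so it can replace the usual smooth
    cut-off. *)
Lemma is_derive_pos_sqr {R : realType} (t : R) :
  is_derive t 1 (fun t => Num.max 0 t ^+ 2) (2 * Num.max 0 t).
Proof.
pose f (t : R) := Num.max 0 t ^+ 2.
have fE (h : R) : `|f (h + t) - f t - 2 * Num.max 0 t * h| <= h ^+ 2.
  rewrite /f; case: (lerP t 0) => t0; case: (lerP (h + t) 0) => ht0; rewrite ler_norml; nra.
have cf : h^-1 *: ((f \o shift t) (h *: 1) - f t) @[h --> 0^'] --> 2 * Num.max 0 t.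
  apply/cvgrPdist_le => e e0; near=> h; rewrite /GRing.scale/= mulr1.
  have h0 : h != 0 by near: h; exact: nbhs_dnbhs_neq.
  have -> : 2 * Num.max 0 t - h^-1 * (f (h + t) - f t) =
      - h^-1 * (f (h + t) - f t - 2 * Num.max 0 t * h) by field.
  rewrite normrM normrN normfV ler_pdivrMl ?normr_gt0//; apply: le_trans (fE h) _.
  rewrite -real_normK ?num_real// expr2 ler_wpM2l//; near: h; exact: dnbhs0_le.
by apply: DeriveDef; [apply/cvg_ex; exists (2 * Num.max 0 t)|exact: cvg_lim].
Unshelve. all: by end_near. Qed.

Lemma C1_bump {R : realType} {n : nat} (D : set 'rV[R]_n) (c : 'rV[R]_n) : open D -> D c ->
  exists (b : 'rV[R]_n -> R) (K : set 'rV[R]_n),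
    [/\ compact K, K `<=` D, C1_on D b, forall y, 0 <= b y &
      0 < b c /\ forall y, ~ K y -> b y = 0].
Proof.
move=> oD Dc; have [e e0 He] : exists2 e : R, 0 < e & forall y, `|y - c| <= e -> D y.
  have /nbhs_ballP[e /= e0 He] := open_nbhs_nbhs (conj oD Dc).
  exists (e / 2) => [|y yc]; first by rewrite divr_gt0.
  by apply: He; rewrite -ball_normE /= distrC (le_lt_trans yc)// ltr_pdivrMr// ltr_pMr// ltr1n.
(* The norm on row vectors is the max norm, which is not differentiable; the bump is built on the
   squared Euclidean distance, whose closed ball of radius e is contained in that of the max
   norm. *)
pose q (y : 'rV[R]_n) := \sum_j (y 0 j - c 0 j) ^+ 2.
pose K := [set y | q y <= e ^+ 2].
have K_norm y : K y -> `|y - c| <= e.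
  move=> Ky; rewrite [`|_|]mx_normrE; apply: bigmax_le => [|[i j] _]; first exact: ltW.
  have h : `|y 0 j - c 0 j| ^+ 2 <= e ^+ 2.
    rewrite real_normK ?num_real//; apply: le_trans Ky; rewrite /q (bigD1 j)//= lerDl.
    by apply: sumr_ge0 => k _; exact: sqr_ge0.
  by rewrite ord1 /= mxE mxE -(@ler_pXn2r _ 2)// nnegrE// ltW.
have Cq : C1_on setT q.
  apply: C1_sum => [|j _]; first exact: openT.
  have h : C1_on setT (fun y : 'rV[R]_n => y 0 j - c 0 j).
    by apply: C1B; [exact: openT|apply: C1_coord; exact: openT|apply: C1_cst; exact: openT].
  exact: (C1M openT h h).
have cq : continuous q by move=> y; exact: C1_continuous Cq _.
exists (fun y => Num.max 0 (e ^+ 2 - q y) ^+ 2), K; split.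
- apply: bounded_closed_compact.
    exists (e + `|c|); split; first exact: num_real.
    move=> r er y Ky; apply: ltW; apply: le_lt_trans er.
    by rewrite -[y](subrK c) (le_trans (ler_normD _ _))// lerD2r K_norm.
  by apply: (@preimage_closed _ _ q [set t | t <= e ^+ 2]) => // y _; exact: cq.
- by move=> y /K_norm; exact: He.
- apply: (C1_comp1 oD (h := fun t => Num.max 0 t ^+ 2) (h' := fun t => 2 * Num.max 0 t)).
  + apply: C1B => //; first exact: C1_cst.
    exact: C1_onS (@subsetT _ D) Cq.
  + by move=> y _; exact: is_derive_pos_sqr.
  + move=> y _; apply: continuousM; first exact: cst_continuous.
    by apply: (@continuous_max _ _ (fun=> 0) id); [exact: cst_continuous|exact: cvg_id].
- by move=> y; exact: sqr_ge0.
- split=> [|y Ky].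
    rewrite /q big1 => [|j _]; last by rewrite subrr expr0n.
    by rewrite subr0 exprn_gt0// lt_max exprn_gt0 ?orbT.
  have /negP : ~ (q y <= e ^+ 2) by [].
  by rewrite -ltNge => /ltW h; rewrite max_l ?expr0n// subr_le0.
Qed.

Section partition_of_unity.
Context {R : realType} {n : nat} {M : ptopologicalType}.
Variable A : smooth_manifold R n M.
Local Notation dom a := (dom (s := A) a).
Local Notation chart a := (chart (s := A) a).
Local Notation chart_inv a := (chart_inv (s := A) a).
Local Notation cod a := (chart a @` dom a).
Implicit Types (a b : chart_index A) (f : M -> R) (K : set 'rV[R]_n).

Definition chart_C1 f := forall b, C1_on (cod b) (f \o chart_inv b).

Definition chart_supported a K f := [/\ compact K, K `<=` cod a &
  forall x, ~ (dom a x /\ K (chart a x)) -> f x = 0].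

Let oc a : open (cod a). Proof. exact: open_cod. Qed.

Lemma chart_C1_continuous f : chart_C1 f -> forall x, {for x, continuous f}.
Proof.
move=> Cf; apply: (continuous_of_charts (floc := fun a => f \o chart_inv a)) => [a x ax|a y ay].
  by rewrite /= chartK.
exact: C1_continuous (Cf a) ay.
Qed.

Lemma compact_chart_image a K : compact K -> K `<=` cod a -> compact (chart_inv a @` K).
Proof.
move=> cK Ka; apply: continuous_compact => //; apply: continuous_in_subspaceT => y.
by rewrite inE => /Ka ay; exact: chart_inv_continuous.
Qed.

Lemma chart_bump x : hausdorff_space M -> exists f K,
  [/\ chart_supported (chart_at A x) K f, chart_C1 f, forall z, 0 <= f z & 0 < f x].
Proof.
move=> hM; set a := chart_at A x; have ax : dom a x by exact: dom_chart_at.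
have [] := @C1_bump _ _ (cod a) (chart a x) (@oc a); first by exists x.
move=> h [K [cK Ka Ch h0 [hx hK]]].
pose f z := if z \in dom a then h (chart a z) else 0.
have fE z : dom a z -> f z = h (chart a z) by move=> az; rewrite /f mem_set.
have f0 z : ~ (dom a z /\ K (chart a z)) -> f z = 0.
  rewrite /f; case: ifPn => //; rewrite inE => az nK; apply: hK => Kz; exact: nK.
exists f, K; split=> //.
(* Where the point lies in [dom a], f is h composed with a transition map. Elsewhere the point
   avoids the image of K in M, which is compact and hence closed as M is Hausdorff, so f vanishes
   nearby. *)
- move=> b; apply: C1_on_local => y by_.
  have [az|naz] := pselect (dom a (chart_inv b y)).
    exists (chart b @` (dom b `&` dom a)); split; first exact: overlap_open.
      by rewrite overlapE.
    have := C1_comp (@overlap_open _ _ _ A b a) _ (fun k => smooth_transition b a k 1) Ch.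
    move=> /(_ _)/C1_eq; apply; first exact: overlap_open.
      by rewrite overlapE => z [bz az'] /=; rewrite fE.
    by rewrite overlapE => z [bz az']; exists (chart_inv b z).
  exists (cod b `&` chart_inv b @^-1` (~` (chart_inv a @` K))); split.
  + apply: open_setI_preimage; [exact: oc|by move=> z; exact: chart_inv_continuous|].
    by apply: closed_openC; apply: compact_closed => //; exact: compact_chart_image.
  + by split=> // -[z Kz E]; apply: naz; rewrite -E; exact/dom_chart_inv/Ka.
  + have oU : open (cod b `&` chart_inv b @^-1` (~` (chart_inv a @` K))).
      apply: open_setI_preimage; [exact: oc|by move=> z; exact: chart_inv_continuous|].
      by apply: closed_openC; apply: compact_closed => //; exact: compact_chart_image.
    apply: (C1_eq oU _ (C1_cst oU 0)) => z [bz nK] /=; rewrite f0// => -[az Kz].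
    by apply: nK; exists (chart a (chart_inv b z)) => //; rewrite chartK.
- by move=> z; rewrite /f; case: ifP.
- by rewrite fE.
Qed.

Lemma partition_of_unity : compact [set: M] -> hausdorff_space M ->
  exists (s : seq M) (K : M -> set 'rV[R]_n) (phi : M -> M -> R),
    (forall p, chart_supported (chart_at A p) (K p) (phi p) /\ chart_C1 (phi p)) /\
    forall x, \sum_(p <- s) phi p x = 1.
Proof.
move=> cM hM.
have [f Hf] := choice (fun x => chart_bump x hM).
have [K {}Hf] := choice Hf.
move: cM; rewrite compact_cover => /(_ M setT (fun p => [set z | 0 < f p z])) [].
- move=> p _; have [_ Cf _ _] := Hf p.
  have := open_comp (f := f p) (D := [set t | 0 < t]); apply; last exact: open_gt.
  by move=> z _; exact: chart_C1_continuous.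
- by move=> x _; exists x => //=; have [] := Hf x.
move=> s _ cov.
(* One bump per point, and by compactness finitely many of them are positive somewhere at each x;
   dividing by their positive sum keeps the supports. *)
pose S x := \sum_(p <- finmap.enum_fset s) f p x.
have S0 x : 0 < S x.
  have [p /= ps fp] := cov x Logic.I.
  rewrite /S (big_rem p)//= ltr_wpDr//; apply: sumr_ge0 => q _.
  by have [] := Hf q.
exists (finmap.enum_fset s), K, (fun p x => f p x / S x); split=> [p|x]; last first.
  by rewrite -mulr_suml -/(S x) divff// gt_eqF.
have [[cK Kp fK] Cf _ _] := Hf p; split; first split=> //.
  by move=> x /fK ->; rewrite mul0r.
move=> b; have CS : C1_on (cod b) (S \o chart_inv b).
  by rewrite /S; apply: (C1_sum (@oc b)) => q _; have [_ Cq _ _] := Hf q; exact: Cq.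
have CV : C1_on (cod b) (fun y => ((S \o chart_inv b) y)^-1).
  by apply: (C1V (@oc b)) => // y _; rewrite gt_eqF//; exact: S0.
exact: (C1M (@oc b) (Cf b) CV).
Qed.

End partition_of_unity.

(** * Passage from norms on the manifold to coordinates *)

Section local_bounds.
Context {R : realType} {n : nat}.
Variables (D K : set 'rV[R]_n) (G : 'rV[R]_n -> 'M[R]_n).
Hypotheses (oD : open D) (cK : compact K) (KD : K `<=` D)
  (pG : forall y, D y -> posdef (G y))
  (CG : forall i j, Ck_on 2 D (fun y => G y i j)).

Lemma compact_integral_EFin f : continuous_on D f ->
  ((compact_integral K f)%:E = \int[lebesgue_tuple n]_(t in (@row_of_tuple R n) @^-1` K)
    (f (row_of_tuple t))%:E)%E.
Proof.
move=> cf; rewrite /compact_integral /Rintegral fineK//; apply: integrable_fin_num.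
  exact: measurable_row_compact.
exact: (continuous_on_integrable oD cK KD cf).
Qed.

Lemma uniform_bound (I : finType) (F : I -> 'rV[R]_n -> R) :
  (forall i, continuous_on D (F i)) ->
  exists2 C : R, 0 <= C & forall y, K y -> forall i, `|F i y| <= C.
Proof.
move=> cF.
have HC i : exists C : R, 0 <= C /\ forall y, K y -> `|F i y| <= C.
  have [C C0 HC] := compact_continuous_bounded cK (fun y Ky => cF i y (KD Ky)).
  by exists C.
have [C {}HC] := choice HC.
exists (\sum_i C i) => [|y Ky i]; first by apply: sumr_ge0 => i _; have [] := HC i.
apply: le_trans ((HC i).2 y Ky) _; rewrite (bigD1 i)//= lerDl.
by apply: sumr_ge0 => j _; have [] := HC j.
Qed.

(** The constant depends on G and K but not on H, so one constant serves for all the differences g_i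
    - g. *)
Lemma entry_le_tensor_norm : exists2 c : R, 0 <= c & forall (H : 'rV[R]_n -> 'M[R]_n) y i j, K y ->
  `|H y i j| <= c * tensor_norm_loc G H y /\
  forall k, `|covariant_derivative G H k i j y| <= c * gradient_norm_loc G H y.
Proof.
have [M M0 HM] := uniform_bound (F := fun i y => G y i i)
  (fun i y Dy => C1_continuous (C2_C1 (CG i i)) Dy).
set b := n%:R * (1 + M); have b0 : 0 <= b by rewrite mulr_ge0// addr_ge0.
exists (b ^+ 2 + b ^+ 3) => [|H y i j Ky]; first by rewrite addr_ge0 ?exprn_ge0.
have pGy := pG (KD Ky); have GM l : G y l l <= M by exact: le_trans (ler_norm _) (HM y Ky l).
split=> [|k].
  apply: le_trans (tensor2_sq_lower_bound (H y) pGy M0 GM i j) _.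
  by rewrite tensor_norm_locE mulrDl lerDl mulr_ge0 ?exprn_ge0 ?sqrtr_ge0.
have := tensor3_sq_lower_bound (fun k => covariant_mx G H k y) pGy M0 GM k i j.
rewrite -gradient_norm_locE [covariant_mx _ _ _ _ _ _]mxE => h; apply: le_trans h _.
by rewrite mulrDl lerDr mulr_ge0 ?exprn_ge0 ?sqrtr_ge0.
Qed.

Lemma partial_le_gradient_norm : exists2 c : R, 0 <= c & forall (H : 'rV[R]_n -> 'M[R]_n) y i j k, K y ->
  `|partial k (fun z => H z i j) y| <=
    c * (gradient_norm_loc G H y + tensor_norm_loc G H y).
Proof.
have [c c0 Hc] := entry_le_tensor_norm.
have [C C0 HC] := uniform_bound (F := fun p y => christoffel G p.1 p.2.1 p.2.2 y)
  (fun p y Dy => C1_continuous (christoffel_C1 oD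
     (fun y Dy => posdef_unitmx (pG Dy)) CG p.1 p.2.1 p.2.2) Dy).
(* A partial derivative is the covariant one plus two Christoffel contractions: [c] pays for the
   former, n C c for each of the latter. *)
exists (c + 2 * (n%:R * (C * c))) => [|H y i j k Ky].
  by rewrite addr_ge0// mulr_ge0// mulr_ge0// mulr_ge0.
set S1 := \sum_m christoffel G m k i y * H y m j.
set S2 := \sum_m christoffel G m k j y * H y i m.
have hS (F : 'I_n -> R) (E : 'I_n -> R) t : (forall m, `|F m| <= C) -> (forall m, `|E m| <= c * t) ->
    `|\sum_m F m * E m| <= n%:R * (C * c) * t.
  move=> hF hE; apply: le_trans (ler_norm_sum _ _ _) _.
  rewrite -mulrA mulr_natl -[X in _ <= _ *+ X]card_ord -sumr_const; apply: ler_sum => m _.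
  by rewrite normrM -mulrA ler_pM.
set t := tensor_norm_loc G H y; set d := gradient_norm_loc G H y.
have h1 : `|S1| <= n%:R * (C * c) * t.
  by apply: hS => m; [exact: (HC y Ky (m, (k, i)))|exact: (Hc H y m j Ky).1].
have h2 : `|S2| <= n%:R * (C * c) * t.
  by apply: hS => m; [exact: (HC y Ky (m, (k, j)))|exact: (Hc H y i m Ky).1].
have E : partial k (fun z => H z i j) y = covariant_derivative G H k i j y + S2 + S1.
  by rewrite /covariant_derivative subrK subrK.
have h3 := (Hc H y i j Ky).2 k; rewrite -/d in h3.
have d0 : 0 <= d by exact: sqrtr_ge0.
have t0 : 0 <= t by exact: sqrtr_ge0.
rewrite E; apply: le_trans (ler_normD _ _) _.
apply: le_trans (lerD (ler_normD _ _) (lexx _)) _.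
apply: le_trans (lerD (lerD h3 h2) h1) _.
rewrite mulrDl mulrDr -addrA; apply: lerD; first by rewrite lerDl mulr_ge0.
rewrite mulrDr; apply: ler_wpDl; first by rewrite !mulr_ge0.
by rewrite -(mulrA 2) (mulr_natl _ 2) mulr2n.
Qed.

End local_bounds.

(** * Integrals over M and in one chart, and local convergence of the metrics *)

Section assembly.
Context {R : realType} {n : nat} {M : ptopologicalType}.
Variable A : smooth_manifold R n M.
Local Notation dom a := (dom (s := A) a).
Local Notation chart a := (chart (s := A) a).
Local Notation chart_inv a := (chart_inv (s := A) a).
Local Notation cod a := (chart a @` dom a).
Local Notation row := (@row_of_tuple R n).
Implicit Types (a b : chart_index A) (f : M -> R) (K : set 'rV[R]_n).

Let oc a : open (cod a). Proof. exact: open_cod. Qed.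

Section given_volume.
Variables (g : C2_metric A) (mu : {measure set (@borel M) -> \bar R}).
Hypothesis gmu : is_riemannian_volume g mu.
Variables (a : chart_index A) (K : set 'rV[R]_n).
Hypotheses (cK : compact K) (KD : K `<=` cod a).

(** The constant bounds the inverse of the volume density on K and is the same for all F. It
    transfers the L^2 smallness of the gradients from M to coordinates. *)
Lemma compact_integral_le_integral : exists2 C : R, 0 <= C &
  forall (F : M -> R) (Floc : 'rV[R]_n -> R),
  (forall x, 0 <= F x) -> (forall x, {for x, continuous F}) ->
  (forall x, dom a x -> F x = Floc (chart a x)) ->
  (forall y, cod a y -> {for y, continuous Floc}) ->
  ((compact_integral K Floc)%:E <= C%:E * \int[mu]_x (F x)%:E)%E.
Proof.
have w0 y : cod a y -> 0 < volume_density g a y.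
  by move=> ay; rewrite sqrtr_gt0 metric_det_gt0.
have cwV : continuous_on (cod a) (fun y => (volume_density g a y)^-1).
  move=> y ay; apply: continuousV; first by rewrite gt_eqF// w0.
  exact: volume_density_continuous.
have [C C0 HC] := compact_continuous_bounded cK (fun y Ky => cwV y (KD Ky)).
exists C => // F Floc F0 cF FE cFloc.
have Floc0 y : cod a y -> 0 <= Floc y by move=> [x ax <-]; rewrite -FE.
(* F need not vanish off the chart, as [integral_chart] requires; cutting it off only decreases the
   integral of a nonnegative function. *)
pose F1 x := F x * \1_(dom a) x.
have mdom : measurable (dom a : set (@borel M)).
  by apply: measurable_borel_open; exact: open_dom.
have mF1 : measurable_fun [set: @borel M] F1.
  apply: measurable_funM; first exact: continuous_measurable_borel.
  exact: measurable_indic.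
have mw : measurable_fun setT (fun t => Floc (row t) * (volume_density g a (row t) * \1_(cod a) (row t))).
  under eq_fun do rewrite mulrA.
  apply: (measurable_row_patch (f := fun y => Floc y * volume_density g a y)) => // y ay.
  by apply: continuousM; [exact: cFloc|exact: volume_density_continuous].
have pos t : 0 <= Floc (row t) * (volume_density g a (row t) * \1_(cod a) (row t)).
  rewrite indicE; have [ta|ta] := pselect (cod a (row t)); last by rewrite memNset// !mulr0.
  by rewrite mem_set// mulr1 mulr_ge0//; [exact: Floc0|exact/ltW/w0].
apply: (@le_trans _ _ (C%:E * \int[mu]_x (F1 x)%:E)%E); last first.
  rewrite lee_wpmul2l ?lee_fin//; apply: ge0_le_integral => //.
  - by move=> x _; rewrite lee_fin mulr_ge0.
  - by apply/measurable_EFinP; exact: mF1.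
  - by apply/measurable_EFinP; exact: continuous_measurable_borel.
  - by move=> x _; rewrite lee_fin /F1 ler_piMr// indicE; case: (_ \in _).
rewrite (integral_chart gmu (a := a) (Floc := Floc)) //; last 2 first.
- by move=> x nax; rewrite /F1 indicE memNset// mulr0.
- by move=> x ax; rewrite /F1 indicE mem_set// mulr1 FE.
rewrite -ge0_integralZl//; last 2 first.
- exact/measurable_EFinP.
- by move=> t _; rewrite lee_fin.
rewrite (compact_integral_EFin (@oc a) cK KD cFloc).
have mK := measurable_row_compact cK.
have mC (B : set (n.-tuple R)) : measurable_fun B (fun t =>
    C%:E * (Floc (row t) * (volume_density g a (row t) * \1_(cod a) (row t)))%:E)%E.
  apply: (@measurable_funS _ _ _ _ setT) => //.
  by apply/measurable_EFinP; apply: measurable_funM.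
apply: (@le_trans _ _ (\int[lebesgue_tuple n]_(t in row @^-1` K) (C%:E *
    (Floc (row t) * (volume_density g a (row t) * \1_(cod a) (row t)))%:E))%E).
  apply: ge0_le_integral => //.
  - by move=> t /= /KD/Floc0; rewrite lee_fin.
  - exact: (measurable_int (lebesgue_tuple n) (continuous_on_integrable (@oc a) cK KD cFloc)).
  - move=> t /= Kt; rewrite -EFinM lee_fin indicE mem_set; last exact: KD.
    rewrite mulr1 mulrCA ler_peMr//; first exact/Floc0/KD.
    have := HC _ Kt; rewrite gtr0_norm ?invr_gt0 ?w0//; last exact: KD.
    by rewrite -ler_pdivrMr ?div1r// w0//; exact: KD.
apply: ge0_subset_integral => //.
by move=> t _; rewrite -EFinM lee_fin mulr_ge0.
Qed.

Lemma integral_chart_supported (F : M -> R) : chart_supported a K F ->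
  (forall x, {for x, continuous F}) ->
  (\int[mu]_x (F x)%:E =
    (compact_integral K (fun y => F (chart_inv a y) * volume_density g a y))%:E)%E.
Proof.
move=> [_ _ FK] cF.
have cFl : continuous_on (cod a) (fun y => F (chart_inv a y) * volume_density g a y).
  move=> y ay; apply: continuousM; last exact: volume_density_continuous.
  apply: (@continuous_comp _ _ _ (chart_inv a) F); last exact: cF.
  exact: chart_inv_continuous.
rewrite (integral_chart gmu (a := a) (Floc := F \o chart_inv a)); last 3 first.
- exact: continuous_measurable_borel.
- by move=> x nax; apply: FK => -[].
- by move=> x ax; rewrite /= chartK.
rewrite (compact_integral_EFin (@oc a) cK KD cFl).
rewrite [RHS]integral_mkcond; apply: eq_integral => t _; rewrite patchE.
case: ifPn => [|/negP]; rewrite inE => Kt /=.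
  by rewrite indicE mem_set ?mulr1//; exact: KD.
rewrite indicE; have [ta|ta] := pselect (cod a (row t)); last by rewrite memNset// !mulr0.
rewrite FK ?mul0r// => -[_].
by rewrite chart_invK.
Qed.

Lemma chart_supported_integrable (F : M -> R) : chart_supported a K F ->
  (forall x, {for x, continuous F}) -> mu.-integrable setT (EFin \o F).
Proof.
move=> [_ _ FK] cF; apply/integrableP; split.
  by apply/measurable_EFinP; exact: continuous_measurable_borel.
have -> : (\int[mu]_x `|(EFin \o F) x| = \int[mu]_x (`|F x|)%:E)%E by [].
rewrite integral_chart_supported ?ltry//; first split=> //.
  by move=> x /FK ->; rewrite normr0.
by move=> x; apply: (@continuous_comp _ _ _ F (fun r : R => `|r|)); [exact: cF|exact: norm_continuous].
Qed.

End given_volume.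

Lemma C0_cvg_near (gs : nat -> C2_metric A) (g : C2_metric A) : C0_cvg gs g ->
  forall e : R, 0 < e -> \forall i \near \oo, forall x, dist_norm g (gs i) x <= e.
Proof.
move=> gsg e e0.
have : \forall i \near \oo, (ereal_sup (range (fun x => (dist_norm g (gs i) x)%:E)) < e%:E)%E.
  by apply: (gsg [set z | (z < e%:E)%E]); apply: open_ereal_lt'; rewrite lte_fin.
apply: filterS => i hi x; rewrite -lee_fin; apply: le_trans (ltW hi).
by apply: ereal_sup_ubound; exists x.
Qed.

Lemma Lnorm2_cvg0_near d (T : measurableType d) (mu : {measure set T -> \bar R})
    (fs : nat -> T -> R) :
  ('N[mu]_2%:E[EFin \o fs i]%E @[i --> \oo] --> 0%E) ->
  forall e : R, 0 < e -> \forall i \near \oo, (\int[mu]_x (fs i x ^+ 2)%:E <= e%:E)%E.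
Proof.
move=> fs0 e e0.
have : \forall i \near \oo, ('N[mu]_2%:E[EFin \o fs i] < (Num.sqrt e)%:E)%E.
  by apply: (fs0 [set z | (z < (Num.sqrt e)%:E)%E]); apply: open_ereal_lt'; rewrite lte_fin sqrtr_gt0.
apply: filterS => i hi.
have -> : (\int[mu]_x (fs i x ^+ 2)%:E = \int[mu]_x (`|(EFin \o fs i) x| `^ 2))%E.
  apply: eq_integral => x _; congr EFin.
  by rewrite [RHS](powR_mulrn 2)// -normrX ger0_norm ?sqr_ge0.
rewrite -poweR_Lnorm//.
have -> : e%:E = ((Num.sqrt e)%:E `^ 2)%E.
  by congr EFin; rewrite [RHS](powR_mulrn 2) ?sqr_sqrtr ?sqrtr_ge0// ltW.
by apply: gt0_ler_poweR => //; rewrite ?in_itv/= ?leey ?andbT ?Lnorm_ge0 ?lee_fin ?sqrtr_ge0// ltW.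
Qed.

Section metric_convergence.
Variables (gs : nat -> C2_metric A) (g : C2_metric A) (mu : {measure set (@borel M) -> \bar R}).
Hypotheses (gmu : is_riemannian_volume g mu) (gsg : C0_cvg gs g)
  (dgs0 : 'N[mu]_2%:E[EFin \o dist_gradient_norm g (gs i)]%E @[i --> \oo] --> 0%E).
Variables (a : chart_index A) (K : set 'rV[R]_n).
Hypotheses (cK : compact K) (KD : K `<=` cod a).

Let pG (h : C2_metric A) y : cod a y -> posdef (metric_comp h a y).
Proof. exact: metric_posdefE. Qed.

Let CG (h : C2_metric A) i j : C1_on (cod a) (fun y => metric_comp h a y i j).
Proof. exact/C2_C1/metric_C2. Qed.

Let dH i y := metric_comp (gs i) a y - metric_comp g a y.

Let tens_near e : 0 < e -> \forall i \near \oo, forall y, K y ->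
  tensor_norm_loc (metric_comp g a) (dH i) y <= e.
Proof.
move=> e0; apply: filterS (C0_cvg_near gsg e0) => i hi y /KD [x ax <-].
by have := hi x; rewrite (dist_normE g (gs i) ax).
Qed.

Let grad_near e : 0 < e -> \forall i \near \oo,
  compact_integral K (fun y => gradient_norm_loc (metric_comp g a) (dH i) y ^+ 2) <= e.
Proof.
move=> e0; have [C C0 HC] := compact_integral_le_integral gmu cK KD.
have e1 : 0 < e / (C + 1) by rewrite divr_gt0// ltr_wpDl.
apply: filterS (Lnorm2_cvg0_near dgs0 e1) => i hi.
rewrite -lee_fin; apply: (@le_trans _ _ (C%:E * (e / (C + 1))%:E)%E); last first.
  by rewrite -EFinM lee_fin mulrA ler_pdivrMr ?ltr_wpDl// mulrC ler_wpM2l ?ltW// ltrDl ltr01.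
have C0' : (0 <= C%:E)%E by rewrite lee_fin.
apply: le_trans (lee_wpmul2l C0' hi).
apply: HC => [x|x|x ax|y ay].
- exact: sqr_ge0.
- apply: (@continuous_comp _ _ _ (dist_gradient_norm g (gs i)) (fun r : R => r ^+ 2)).
    exact: dist_gradient_norm_continuous.
  exact: exprn_continuous.
- by rewrite (dist_gradient_normE g (gs i) ax).
- apply: (@continuous_comp _ _ _ (gradient_norm_loc (metric_comp g a) (dH i)) (fun r : R => r ^+ 2)).
    apply: (gradient_norm_loc_continuous (@oc a) (@metric_unitmx _ _ _ _ g a) _ _ ay) => p q.
      exact: metric_C2.
    exact: metric_diff_C1.
  exact: exprn_continuous.
Qed.

Lemma metric_C0W12_cvg p q : C0W12_cvg (cod a) K
  (fun i y => metric_comp (gs i) a y p q) (fun y => metric_comp g a y p q).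
Proof.
have c0 (h : C2_metric A) : continuous_on (cod a) (fun y => metric_comp h a y p q).
  by move=> y ay; exact: C1_continuous (CG h p q) ay.
have cp (h : C2_metric A) k : continuous_on (cod a) (partial k (fun y => metric_comp h a y p q)).
  by move=> y ay; exact: C1_partial_continuous (CG h p q) ay.
split=> [i||| k]; [exact: CG|exact: CG| |].
  split=> [i||e e0]; [exact: c0|exact: c0|].
  have [c c_ge0 Hc] := entry_le_tensor_norm cK KD (@pG g) (metric_C2 g a).
  have e1 : 0 < e / (c + 1) by rewrite divr_gt0// ltr_wpDl.
  apply: filterS (tens_near e1) => i hi y Ky.
  have := (Hc (dH i) y p q Ky).1; rewrite [dH i y p q]mxE [X in _ + X]mxE => h.
  apply: le_trans h _; apply: le_trans (ler_wpM2l c_ge0 (hi y Ky)) _.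
  by rewrite mulrA ler_pdivrMr ?ltr_wpDl// mulrC ler_wpM2l ?ltW// ltrDl ltr01.
split=> [i||e e0]; [exact: cp|exact: cp|].
have [c c_ge0 Hc] := partial_le_gradient_norm (@oc a) cK KD (@pG g) (metric_C2 g a).
set V := compact_integral K (fun=> 1).
have V0 : 0 <= V by apply: compact_integral_ge0.
(* On K the squared derivative of the difference is at most 2 c^2 (N^2 + e / B), the tensor norm
   being uniformly at most the root of e / B. Its integral is then at most 2 c^2 (1 + V) e / B <= e;
   the final 1 keeps B positive. *)
pose B := 2 * c ^+ 2 * (1 + V) + 1.
have B0 : 0 < B by rewrite ltr_wpDl// !mulr_ge0 ?sqr_ge0 ?addr_ge0.
have e1 : 0 < e / B by rewrite divr_gt0.
have s0 : 0 < Num.sqrt (e / B) by rewrite sqrtr_gt0.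
apply: filterS2 (tens_near s0) (grad_near e1) => i ht hg.
set N := gradient_norm_loc (metric_comp g a) (dH i).
have cN : continuous_on (cod a) (fun y => N y ^+ 2).
  apply: continuous_onX => y ay.
  apply: (gradient_norm_loc_continuous (@oc a) (@metric_unitmx _ _ _ _ g a) _ _ ay) => r s.
    exact: metric_C2.
  exact: metric_diff_C1.
have cst r : continuous_on (cod a) (fun=> r) by exact: continuous_on_cst.
have cNs : continuous_on (cod a) (fun y => N y ^+ 2 + e / B * 1).
  by apply: continuous_onD => //; apply: cst.
apply: (@le_trans _ _ (compact_integral K (fun y => 2 * c ^+ 2 * (N y ^+ 2 + e / B * 1)))).
  apply: (le_compact_integral (@oc a) cK KD).
  - by apply: continuous_onX; apply: continuous_onB; exact: cp.
  - by apply: continuous_onM => //; apply: cst.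
  move=> y Ky; have ay := KD Ky.
  have h : `|partial k (fun y => metric_comp (gs i) a y p q) y -
      partial k (fun y => metric_comp g a y p q) y| <= c * (N y + Num.sqrt (e / B)).
    rewrite -partialB; [|exact: C1_differentiable (CG _ p q) ay|exact: C1_differentiable (CG _ p q) ay].
    have -> : (fun z => metric_comp (gs i) a z p q - metric_comp g a z p q) =
       (fun z => dH i z p q) by apply/funext => z; rewrite [RHS]mxE [X in _ = _ + X]mxE.
    apply: le_trans (Hc (dH i) y p q k Ky) _; rewrite ler_wpM2l// lerD2l.
    exact: ht.
  apply: le_trans (sqr_le_of_norm_le h) _.
  have := sqrD_le (N y) (Num.sqrt (e / B)); rewrite (sqr_sqrtr (ltW e1)).
  by move=> h2; rewrite exprMn mulr1 [2 * c ^+ 2]mulrC -(mulrA (c ^+ 2)) ler_wpM2l// sqr_ge0.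
rewrite (compact_integralZ (@oc a) cK KD)// (compact_integralD (@oc a) cK KD)//.
rewrite (compact_integralZ (@oc a) cK KD)//.
apply: (@le_trans _ _ (2 * c ^+ 2 * (e / B + e / B * V))).
  by rewrite ler_wpM2l ?mulr_ge0 ?sqr_ge0// lerD2r.
by rewrite -[X in X + _]mulr1 -mulrDr mulrCA mulrAC ler_pdivrMr// ler_wpM2l ?ltW// ltrDl.
Qed.

Lemma supported_curvature_integral_cvg phi : chart_supported a K phi -> chart_C1 A phi ->
  integral_cvg (cod a) K
    (fun i y => phi (chart_inv a y) * scalar_curvature_loc (metric_comp (gs i) a) y *
      volume_density (gs i) a y)
    (fun y => phi (chart_inv a y) * scalar_curvature_loc (metric_comp g a) y *
      volume_density g a y).
Proof.
move=> [_ _ phiK] Cphi.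
apply: (scalar_curvature_integral_cvg (@oc a) cK KD (fun i => @pG (gs i)) (@pG g)
  (fun i => metric_C2 (gs i) a) (metric_C2 g a) metric_C0W12_cvg (Cphi a)) => y ay nK /=.
by apply: phiK => -[_]; rewrite chart_invK.
Qed.

End metric_convergence.

End assembly.

(** * Total scalar curvature *)

(** The partition does not depend on the metric, so the same finite sum represents the total
    curvatures of g and of all g_i, and the limit can be taken term by term. *)
Lemma total_scalar_curvature_partition (R : realType) (n : nat) (M : ptopologicalType)
    (A : smooth_manifold R n M) (g : C2_metric A) (s : seq M)
    (K : M -> set 'rV[R]_n) (phi : M -> M -> R) :
  is_riemannian_volume g (riemannian_volume g) ->
  (forall p, chart_supported (chart_at A p) (K p) (phi p) /\ chart_C1 A (phi p)) ->
  (forall x, \sum_(p <- s) phi p x = 1) ->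
  total_scalar_curvature g = (\sum_(p <- s) compact_integral (K p) (fun y =>
    phi p (chart_inv (chart_at A p) y) *
    scalar_curvature_loc (metric_comp g (chart_at A p)) y *
    volume_density g (chart_at A p) y))%:E.
Proof.
move=> gmu Hphi sum1; rewrite /total_scalar_curvature.
have cF p x : {for x, continuous (fun x => phi p x * scalar_curvature g x)}.
  apply: continuousM; last exact: scalar_curvature_continuous.
  exact: chart_C1_continuous (Hphi p).2 x.
have sF p : chart_supported (chart_at A p) (K p) (fun x => phi p x * scalar_curvature g x).
  have [[cK KD phiK] _] := Hphi p.
  by split=> // x /phiK ->; rewrite mul0r.
transitivity (\int[riemannian_volume g]_x
    (\sum_(p <- s) (phi p x * scalar_curvature g x)%:E)%E)%E.
  apply: eq_integral => x _; rewrite sumEFin; congr EFin.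
  by rewrite -mulr_suml sum1 mul1r.
rewrite integral_sum//; last first.
  move=> p; have [cK KD _] := sF p.
  exact: (chart_supported_integrable gmu cK KD (sF p) (cF p)).
rewrite -sumEFin; apply: eq_bigr => p _; have [cK KD _] := sF p.
apply: etrans (integral_chart_supported gmu cK KD (sF p) (cF p)) _.
apply: (congr1 (@EFin R)).
apply: eq_compact_integral => y /KD ay.
have -> : scalar_curvature_loc (metric_comp g (chart_at A p)) y =
    scalar_curvature g (chart_inv (chart_at A p) y).
  by rewrite (scalar_curvatureE g (dom_chart_inv ay)) chart_invK.
by [].
Qed.

Theorem fact1p2 (R : realType) (n : nat) (M : ptopologicalType)
    (A : smooth_manifold R n M) (g : C2_metric A) (gs : nat -> C2_metric A) :
  (3 <= n)%N -> compact [set: M] -> hausdorff_space M ->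
  C0_cvg gs g -> W1p_cvg 2 gs g ->
  (total_scalar_curvature (gs i) @[i --> \oo] --> total_scalar_curvature g) /\
  (forall kappa : R,
     (forall i, (kappa%:E <= total_scalar_curvature (gs i))%E) ->
     (kappa%:E <= total_scalar_curvature g)%E).
Proof.
move=> _ cM hM gsg [_ dgs0].
suff cvg_total : total_scalar_curvature (gs i) @[i --> \oo] --> total_scalar_curvature g.
  split=> // kappa hk; apply: cvge_ge cvg_total.
  exact: nearW.
have [eg|neg] := pselect (exists mu, is_riemannian_volume g mu); last first.
  rewrite (total_scalar_curvature_no_volume _ neg).
  under eq_fun do rewrite (total_scalar_curvature_no_volume _ neg).
  exact: cvg_cst.
have gmu := riemannian_volumeP eg.
have gsmu i : is_riemannian_volume (gs i) (riemannian_volume (gs i)).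
  by apply: riemannian_volumeP; exact: volume_transfer gmu (gs i).
have [s [K [phi [Hphi sum1]]]] := partition_of_unity A cM hM.
rewrite (total_scalar_curvature_partition gmu Hphi sum1).
under eq_fun do rewrite (total_scalar_curvature_partition (gsmu _) Hphi sum1).
apply: cvg_EFin; first exact: nearW.
apply: (@cvg_big _ _ +%R) => // [|p _]; first exact: add_continuous.
have [[cK KD phiK] Cphi] := Hphi p.
have [_ _ cvgI] := supported_curvature_integral_cvg gmu gsg dgs0 cK KD (And3 cK KD phiK) Cphi.
apply/cvgrPdist_le => e /cvgI; apply: filterS => i.
by rewrite distrC.
Qed.
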